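(* Let $\bar M$ be a saturated $o$-minimal expansion of a real closed field. Let $G$ be a definably connected, definably compact, commutative group definable in $\bar M$, and let $\pi: G\to G/G^{00}$ be the canonical surjective homomorphism. Then $G$ is compactly dominated: for every definable subset $X$ of $G$, the set $$Y_X=\{b\in G/G^{00} : \pi^{-1}(b)\cap X\neq\emptyset \text{ and } \pi^{-1}(b)\cap (G\setminus X)\neq\emptyset\}$$ has Haar measure $0$ in the compact group $G/G^{00}$.
   Context: ''Definable'' means definable with parameters in $\bar M$; ''small'' means of cardinality less than that of $\bar M$. $G^{00}$ denotes the smallest subgroup of $G$ of bounded index (index less than $|\bar M|$) which is type-definable over a small set of parameters; it exists in this setting and does not depend on the parameter set. $G/G^{00}$ is equipped with the logic topology (a subset is closed iff its preimage under $\pi$ is type-definable over a small set), under which it is a compact Hausdorff group; Haar measure means the normalized Haar measure of this compact group. Definable compactness and definable connectedness are in the $o$-minimal sense (definable connectedness: no proper definable subgroup of finite index; definable compactness: every definable continuous curve in $G$, with respect to its definable group topology, has limits in $G$).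
   Formalization: It is additionally assumed that the saturated model has cardinality greater than 2^{ℵ0}; when its cardinality equals 2^{ℵ0} (possible under CH), ''bounded index'' forces G^{00}=G and the claim fails for every infinite G, e.g. the circle group. *)

(* Defs.v *)
From HB Require Import structures.
From mathcomp Require Import all_boot all_order all_algebra.
From mathcomp Require Import all_classical all_reals all_analysis.

Set Implicit Arguments.
Unset Strict Implicit.
Unset Printing Implicit Defensive.

Import Order.TTheory GRing.Theory Num.Theory.
Import numFieldNormedType.Exports.

Local Open Scope classical_set_scope.
Local Open Scope ring_scope.
Local Open Scope quotient_scope.
Local Open Scope card_scope.

Definition card_lt (T U : Type) (A : set T) (B : set U) : Prop :=
  (A #<= B) /\ ~ (B #<= A).

(* The symbols of the expansion other than those of ordered rings, which are
   built into the terms and formulas below. *)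
Record language := Language {
  fsym : Type;
  farity : fsym -> nat;
  rsym : Type;
  rarity : rsym -> nat }.

(* Terms and formulas in the variables 'I_n; a quantifier binds variable 0 and
   shifts the others by one. *)
Inductive term (L : language) (n : nat) : Type :=
| tvar of 'I_n
| tzero
| tone
| tadd of term L n & term L n
| topp of term L n
| tmul of term L n & term L n
| tapp (f : fsym L) of ('I_(farity f) -> term L n).

Inductive formula (L : language) : nat -> Type :=
| feq n of term L n & term L n : formula L n
| flt n of term L n & term L n : formula L n
| frel n (r : rsym L) of ('I_(rarity r) -> term L n) : formula L n
| fnot n of formula L n : formula L n
| fand n of formula L n & formula L n : formula L n
| fexists n of formula L n.+1 : formula L n.

Record expansion (L : language) (M : rcfType) := Expansion {
  fint : forall f : fsym L, 'rV[M]_(farity f) -> M;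
  rint : forall r : rsym L, set 'rV[M]_(rarity r) }.

Fixpoint eval (L : language) (M : rcfType) (S : expansion L M) (n : nat)
    (v : 'rV[M]_n) (t : term L n) : M :=
  match t with
  | tvar i => v 0 i
  | tzero => 0
  | tone => 1
  | tadd t1 t2 => eval S v t1 + eval S v t2
  | topp t1 => - eval S v t1
  | tmul t1 t2 => eval S v t1 * eval S v t2
  | tapp f ts => fint S (\row_i eval S v (ts i))
  end.

Fixpoint sat (L : language) (M : rcfType) (S : expansion L M) (n : nat)
    (phi : formula L n) : 'rV[M]_n -> Prop :=
  match phi with
  | feq _ t1 t2 => fun v => eval S v t1 = eval S v t2
  | flt _ t1 t2 => fun v => eval S v t1 < eval S v t2
  | frel _ r ts => fun v => rint S (\row_i eval S v (ts i))
  | fnot _ phi1 => fun v => ~ sat S phi1 v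
  | fand _ phi1 phi2 => fun v => sat S phi1 v /\ sat S phi2 v
  | fexists _ phi1 => fun v =>
      exists a : M, sat S phi1 (row_mx (a%:M : 'rV[M]_1) v)
  end.

Definition definable_over (L : language) (M : rcfType) (S : expansion L M)
    (A : set M) (n : nat) (D : set 'rV[M]_n) : Prop :=
  exists (m : nat) (p : 'rV[M]_m) (phi : formula L (m + n)),
    (forall i, A (p 0 i)) /\ D = [set x | sat S phi (row_mx p x)].

Definition definable (L : language) (M : rcfType) (S : expansion L M)
    (n : nat) (D : set 'rV[M]_n) : Prop :=
  definable_over S setT D.

Definition small (M : rcfType) (A : set M) : Prop := card_lt A [set: M].

Definition type_definable (L : language) (M : rcfType) (S : expansion L M)
    (n : nat) (D : set 'rV[M]_n) : Prop :=
  exists (A : set M) (F : set (set 'rV[M]_n)),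
    [/\ small A, forall E, F E -> definable_over S A E &
        D = \bigcap_(E in F) E].

(* A partial n-type over A is represented by the family of the A-definable sets
   that its formulas define. *)
Definition saturated (L : language) (M : rcfType) (S : expansion L M) : Prop :=
  forall (A : set M) (n : nat) (F : set (set 'rV[M]_n)),
    small A -> (forall E, F E -> definable_over S A E) -> finI F id ->
    \bigcap_(E in F) E !=set0.

(* [interval M] includes the points [a, a] and has endpoints in M or infinite. *)
Definition o_minimal (L : language) (M : rcfType) (S : expansion L M) : Prop :=
  forall E : set M, definable S [set (x%:M : 'rV[M]_1) | x in E] ->
    exists s : seq (interval M), E = [set x | has (fun i => x \in i) s].

(* A commutative group G, identified through [code] with a definable subset of
   M^n on which the group operation is definable. *)
Definition definable_group (L : language) (M : rcfType) (S : expansion L M)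
    (G : zmodType) (n : nat) (code : G -> 'rV[M]_n) : Prop :=
  [/\ injective code,
      definable S (range code) &
      definable S [set z | exists x y : G,
        z = row_mx (row_mx (code x) (code y)) (code (x + y))]].

(* The topology of G is its definable group topology, i.e. the unique group
   topology making it a definable manifold: G has a finite cover by open sets
   [U i] with definable homeomorphisms [f i] onto open subsets of M^d (take
   [W := U i] for the openness of the image). *)
Definition definable_group_topology (L : language) (M : rcfType)
    (S : expansion L M) (G : topologicalZmodType) (n : nat)
    (code : G -> 'rV[M]_n) : Prop :=
  exists (d k : nat) (U : 'I_k -> set G) (f : 'I_k -> G -> 'rV[M]_d),
    (forall x : G, exists i, U i x) /\
    (forall i : 'I_k,
      [/\ open (U i),
          definable S [set row_mx (code x) (f i x) | x in U i],
          {in U i &, injective (f i)} &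
          forall W, W `<=` U i -> (open W <-> open (f i @` W))]).

(* Curves on bounded intervals suffice: in an ordered field every open interval
   is definably homeomorphic to a bounded one. *)
Definition definably_compact (L : language) (M : rcfType) (S : expansion L M)
    (G : topologicalZmodType) (n : nat) (code : G -> 'rV[M]_n) : Prop :=
  forall (a b : M) (s : M -> G), a < b ->
    definable S [set row_mx (x%:M : 'rV[M]_1) (code (s x)) | x in `]a, b[] ->
    {in `]a, b[, continuous s} ->
    (exists g : G, s x @[x --> a^'+] --> g) /\
    (exists g : G, s x @[x --> b^'-] --> g).

Notation quot := Quotient.quot.

HB.instance Definition _ (G : zmodType) (H : zmodClosed G) :=
  isPointed.Build (quot H) 0.

Definition definably_connected (L : language) (M : rcfType) (S : expansion L M)
    (G : zmodType) (n : nat) (code : G -> 'rV[M]_n) : Prop :=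
  forall H : zmodClosed G, definable S (code @` [set` H]) ->
    finite_set [set: quot H] -> [set` H] = [set: G].

Definition bounded_type_definable (L : language) (M : rcfType)
    (S : expansion L M) (G : zmodType) (n : nat) (code : G -> 'rV[M]_n)
    (H : zmodClosed G) : Prop :=
  type_definable S (code @` [set` H]) /\ card_lt [set: quot H] [set: M].

Definition is_G00 (L : language) (M : rcfType) (S : expansion L M)
    (G : zmodType) (n : nat) (code : G -> 'rV[M]_n) (N : zmodClosed G) : Prop :=
  bounded_type_definable S code N /\
  forall H : zmodClosed G, bounded_type_definable S code H ->
    [set` N] `<=` [set` H].

Definition logic_closed (L : language) (M : rcfType) (S : expansion L M)
    (G : zmodType) (n : nat) (code : G -> 'rV[M]_n) (N : zmodClosed G)
    : set (set (quot N)) :=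
  [set C | type_definable S (code @` (\pi_(quot N) @^-1` C))].
Arguments logic_closed [L M] S [G n] code N _.

(* [mu] is the normalized Haar measure of the quotient by N, for the topology
   whose closed sets are [closedQ] (assumed compact Hausdorff, so that compact
   sets are the closed ones): the translation-invariant regular Borel
   probability measure. *)
Definition is_haar (R : realType) (G : zmodType) (N : zmodClosed G)
    (closedQ : set (set (quot N)))
    (mu : probability (g_sigma_algebraType closedQ) R) : Prop :=
  (forall (q : quot N) (B : set (quot N)), <<s closedQ >> B ->
     mu [set q + x | x in B] = mu B) /\
  (forall (B : set (quot N)) (e : R), <<s closedQ >> B -> 0 < e ->
     exists C U : set (quot N),
       [/\ closedQ C, closedQ (~` U), C `<=` B, B `<=` U &
           (mu (U `\` C) < e%:E)%E]).

Definition split_cosets (G : zmodType) (N : zmodClosed G) (X : set G)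
    : set (quot N) :=
  [set b | ((\pi_(quot N) @^-1` [set b]) `&` X !=set0) /\
           ((\pi_(quot N) @^-1` [set b]) `&` ~` X !=set0)].
Arguments split_cosets [G] N X _.

(* Main.v *)
Require Import Defs.
From HB Require Import structures.
From mathcomp Require Import all_boot all_order all_algebra.
From mathcomp Require Import finmap zify lra ring.
From mathcomp Require Import all_classical all_reals all_analysis.
From mathcomp Require Import measurable_realfun.

Set Implicit Arguments.
Unset Strict Implicit.
Unset Printing Implicit Defensive.

Import Order.TTheory GRing.Theory Num.Theory.
Import numFieldNormedType.Exports.

Local Open Scope classical_set_scope.
Local Open Scope ring_scope.
Local Open Scope card_scope.

(** Call a set [X] thin (to order [e]) when some finite list of translates of
[X] covers every point with multiplicity less than a fraction [1/e] of its
length, i.e. when the upper Banach density of [X] is below [1/e].  Thin sets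
are closed under translation and, with a loss in [e], under unions; integrating
multiplicities, a subset of the quotient whose preimage is [e]-thin has Haar
measure at most [1/e].  So it is enough to show that the preimage of the set of
split cosets is [e]-thin for every [e].

In a definable family a set is [e]-thin or its closure is [K]-generic (finitely
many translates, [K] of them, cover [G]), with [K] uniform.  Indeed, if [X] is
not thin, multiplicative weights and an epsilon-net (polynomially many traces)
pierce any finite subfamily of the translates by a bounded number of points,
and a closed definable family of this kind in a definably compact space has
points definable over the parameters (Peterzil-Pillay), so that saturation
yields finitely many translates.  The latter is proved by induction on the
number of parameters: an invariant ultrafilter shows that the closed set can
be replaced by its intersection over a definable interval of the first
parameter, and an epsilon-net turns finite intersections into piercing.

Boundaries of definable sets have no interior, hence are thin.  A definable
family of sets parametrized by a line is almost constant on the pieces of a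
finite partition: disjoint intervals over which the family varies on a
non-thin set are bounded in number, and the variation near an end is thin.
By induction, for every definable family [X_b] the parameter space has a
finite definable partition with [U_b X_b] minus [inter_b X_b] thin over each
piece.

Applied twice to the translates of [X], this gives a definable non-thin [P]
such that [X + (P - P)] exceeds [X] by a thin set only, and likewise for the
complement.  The stabilizer of [P] up to thin sets is a type-definable subgroup
of bounded index contained in [P - P], hence [G00 <= P - P]. *)

(** * Definable sets and hulls of cosets *)

(** Largeness in [G] is expressed by finite counts of translates rather than by a measure: a bound
    on such a count is a first-order condition, so that saturation applies to it directly. Cell
    decomposition and dimension are replaced by one invariant: how often membership in a definable
    subset of the line can change to the right of a point. Saturation bounds it uniformly in
    families, it is monotone in the point, and membership does not change on a region where it is
    constant. Polynomial trace bounds, invariant ultrafilters, continuity near an end and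
    homogeneous boxes all come from it. Saturation concerns small parameter sets, hence the constant
    attention to parameters; a point fixed by a formula over [A] plays the part of a point of a
    small model. The stabilizer is reached only as a countable intersection of definable sets that
    need not be groups, so its index is bounded by the continuum; the hypothesis [M_large] makes
    this less than the cardinality of the model. *)

Definition pullback (T : Type) (m n : nat) (s : 'I_n -> 'I_m) (v : 'rV[T]_m) :
  'rV[T]_n := \row_i v 0 (s i).

Section Definability.
Variables (L : language) (M : rcfType) (S : expansion L M).

Fixpoint term_rename (m n : nat) (s : 'I_n -> 'I_m) (t : term L n) : term L m :=
  match t with
  | tvar i => tvar L (s i)
  | tzero => tzero L m
  | tone => tone L m
  | tadd t1 t2 => tadd (term_rename s t1) (term_rename s t2)
  | topp t1 => topp (term_rename s t1)
  | tmul t1 t2 => tmul (term_rename s t1) (term_rename s t2)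
  | tapp f ts => tapp (fun i => term_rename s (ts i))
  end.

Lemma eval_rename m n (s : 'I_n -> 'I_m) (t : term L n) v :
  Defs.eval S v (term_rename s t) = Defs.eval S (pullback s v) t.
Proof.
elim: t => //=.
- by move=> i; rewrite mxE.
- by move=> t1 -> t2 ->.
- by move=> t1 ->.
- by move=> t1 -> t2 ->.
- by move=> f ts IH; congr (fint S _); apply/rowP => i; rewrite !mxE IH.
Qed.

(** A renaming of variables passes under a quantifier by fixing the bound variable 0. *)
Lemma pullback_lift m n (s : 'I_n -> 'I_m) :
  exists s' : 'I_n.+1 -> 'I_m.+1, forall (a : M) (v : 'rV[M]_m),
    pullback s' (row_mx (a%:M : 'rV[M]_1) v) =
    row_mx (a%:M : 'rV[M]_1) (pullback s v).
Proof.
exists (fun i : 'I_(1 + n) => match fintype.split i with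
   | inl j => lshift m j | inr j => rshift 1 (s j) end).
move=> a v; apply/rowP => i; rewrite mxE [in RHS]mxE.
case: (@fintype.split 1 n i) => j /=; first exact: row_mxEl.
by apply: etrans (row_mxEr _ _ _ _) _; rewrite mxE.
Qed.

Lemma formula_rename n (phi : formula L n) m (s : 'I_n -> 'I_m) :
  exists psi : formula L m,
    forall v, sat S psi v <-> sat S phi (pullback s v).
Proof.
elim: phi m s => {n}.
- move=> n t1 t2 m s; exists (feq (term_rename s t1) (term_rename s t2)) => v.
  by rewrite /= !eval_rename.
- move=> n t1 t2 m s; exists (flt (term_rename s t1) (term_rename s t2)) => v.
  by rewrite /= !eval_rename.
- move=> n r ts m s; exists (Defs.frel (fun i => term_rename s (ts i))) => v /=.
  suff -> : (\row_i Defs.eval S v (term_rename s (ts i))) =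
    (\row_i Defs.eval S (pullback s v) (ts i)) by [].
  by apply/rowP => i; rewrite !mxE eval_rename.
- move=> n phi IH m s; have [psi H] := IH m s.
  by exists (fnot psi) => v /=; rewrite H.
- move=> n p1 IH1 p2 IH2 m s; have [q1 H1] := IH1 m s; have [q2 H2] := IH2 m s.
  by exists (fand q1 q2) => v /=; rewrite H1 H2.
- move=> n phi IH m s; have [s' Hs] := pullback_lift s.
  have [psi H] := IH _ s'; exists (fexists psi) => v /=.
  by split=> -[a Ha]; exists a; move: Ha; rewrite H Hs.
Qed.

Lemma definable_overS (A B : set M) n (D : set 'rV[M]_n) :
  A `<=` B -> definable_over S A D -> definable_over S B D.
Proof.
by move=> AB [m [p [phi [Ap ->]]]]; exists m, p, phi; split=> // i; exact/AB/Ap.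
Qed.

Lemma definable_overT (A : set M) n : definable_over S A [set: 'rV[M]_n].
Proof.
exists 0%N, 0, (feq (tzero L (0 + n)) (tzero L (0 + n))); split; first by case.
by apply/seteqP; split.
Qed.

Lemma definable_over_pullback (A : set M) m n (s : 'I_n -> 'I_m)
    (D : set 'rV[M]_n) :
  definable_over S A D -> definable_over S A (pullback s @^-1` D).
Proof.
move=> [k [p [phi [Ap ->]]]].
pose t (i : 'I_(k + n)) : 'I_(k + m) := match fintype.split i with
   | inl j => lshift m j | inr j => rshift k (s j) end.
have [psi H] := formula_rename phi t.
exists k, p, psi; split=> //; apply/seteqP.
have E v : pullback t (row_mx p v) = row_mx p (pullback s v).
  apply/rowP => i; rewrite mxE [in RHS]mxE /t.
  case: (fintype.split i) => j /=; first by rewrite row_mxEl.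
  by rewrite row_mxEr mxE.
by split=> v /=; rewrite H E.
Qed.

Lemma definable_overI (A : set M) n (D E : set 'rV[M]_n) :
  definable_over S A D -> definable_over S A E ->
  definable_over S A (D `&` E).
Proof.
move=> [k [p [phi [Ap ->]]]] [l [q [psi [Aq ->]]]].
pose t1 (i : 'I_(k + n)) : 'I_((k + l) + n) := match fintype.split i with
   | inl j => lshift n (lshift l j) | inr j => rshift (k + l) j end.
pose t2 (i : 'I_(l + n)) : 'I_((k + l) + n) := match fintype.split i with
   | inl j => lshift n (rshift k j) | inr j => rshift (k + l) j end.
have [phi' H1] := formula_rename phi t1.
have [psi' H2] := formula_rename psi t2.
have E1 v : pullback t1 (row_mx (row_mx p q) v) = row_mx p v.
  apply/rowP => i; rewrite mxE [in RHS]mxE /t1.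
  case: (fintype.split i) => j /=; first by rewrite !row_mxEl.
  by rewrite row_mxEr.
have E2 v : pullback t2 (row_mx (row_mx p q) v) = row_mx q v.
  apply/rowP => i; rewrite mxE [in RHS]mxE /t2.
  case: (fintype.split i) => j /=; first by rewrite row_mxEl row_mxEr.
  by rewrite row_mxEr.
exists (k + l)%N, (row_mx p q), (fand phi' psi'); split.
  by move=> i; rewrite mxE; case: (fintype.split i).
by apply/seteqP; split=> v /=; rewrite H1 H2 E1 E2.
Qed.

Lemma definable_overC (A : set M) n (D : set 'rV[M]_n) :
  definable_over S A D -> definable_over S A (~` D).
Proof. by move=> [m [p [phi [Ap ->]]]]; exists m, p, (fnot phi). Qed.

Lemma definable_over_fiber (A : set M) k n (a : 'rV[M]_k)
    (D : set 'rV[M]_(k + n)) :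
  definable_over S A D ->
  definable_over S (A `|` range (a 0)) [set x | D (row_mx a x)].
Proof.
move=> [m [p [phi [Ap ->]]]].
pose t (i : 'I_(m + (k + n))) : 'I_((m + k) + n) := match fintype.split i with
   | inl j => lshift n (lshift k j)
   | inr j => match fintype.split j with
     | inl l => lshift n (rshift m l) | inr l => rshift (m + k) l end end.
have [psi H] := formula_rename phi t.
exists (m + k)%N, (row_mx p a), psi; split.
  move=> i; rewrite mxE; case: (fintype.split i) => j; first by left.
  by right; exists j.
have E v : pullback t (row_mx (row_mx p a) v) = row_mx p (row_mx a v).
  apply/rowP => i; rewrite mxE [in RHS]mxE /t.
  case: (fintype.split i) => j /=; first by rewrite !row_mxEl.
  rewrite [in RHS]mxE.
  case: (fintype.split j) => l; first by rewrite row_mxEl row_mxEr.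
  by rewrite row_mxEr.
by apply/seteqP; split=> v /=; rewrite H E.
Qed.

Lemma definable_over_exists1 (A : set M) n (D : set 'rV[M]_(1 + n)) :
  definable_over S A D ->
  definable_over S A [set x | exists a : M, D (row_mx (a%:M : 'rV[M]_1) x)].
Proof.
move=> [m [p [phi [Ap ->]]]].
pose t (i : 'I_(m + (1 + n))) : 'I_(1 + (m + n)) := match fintype.split i with
   | inl j => rshift 1 (lshift n j)
   | inr j => match fintype.split j with
     | inl l => lshift (m + n) l | inr l => rshift 1 (rshift m l) end end.
have [psi H] := formula_rename phi t.
exists m, p, (fexists psi); split=> //.
have E a v : pullback t (row_mx (a%:M : 'rV[M]_1) (row_mx p v)) =
    row_mx p (row_mx (a%:M : 'rV[M]_1) v).
  apply/rowP => i; rewrite mxE [in RHS]mxE /t.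
  case: (fintype.split i) => j /=; first by rewrite row_mxEr row_mxEl.
  rewrite [in RHS]mxE.
  case: (fintype.split j) => l; first by rewrite row_mxEl.
  by rewrite !row_mxEr.
by apply/seteqP; split=> v /= [a Ha]; exists a; move: Ha; rewrite H E.
Qed.

(** Quantifiers bind one variable, so the block is projected away one coordinate at a time; [D']
    moves the first coordinate of the block next to the surviving variables. *)
Lemma definable_over_exists (A : set M) k n (D : set 'rV[M]_(k + n)) :
  definable_over S A D ->
  definable_over S A [set x | exists y : 'rV[M]_k, D (row_mx y x)].
Proof.
elim: k n D => [|k IH] n D defD.
  have := definable_over_pullback (fun i : 'I_(0 + n) => (i : 'I_n)) defD.
  congr (definable_over S A _); apply/seteqP.
  have E (v : 'rV[M]_n) y : pullback (fun i : 'I_(0 + n) => (i : 'I_n)) v =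
      row_mx (y : 'rV[M]_0) v.
    apply/rowP => i; rewrite mxE -[i in RHS](_ : rshift 0 (i : 'I_n) = i).
      by rewrite row_mxEr.
    exact: val_inj.
  split=> v /=; first by move=> Dv; exists 0; rewrite -E.
  by move=> [y]; rewrite -E.
pose D' : set 'rV[M]_(k + (1 + n)) := [set w |
   D (row_mx (row_mx (lsubmx (rsubmx w)) (lsubmx w) : 'rV_(1 + k))
             (rsubmx (rsubmx w)))].
have dD' : definable_over S A D'.
  pose t (i : 'I_((1 + k) + n)) : 'I_(k + (1 + n)) := match fintype.split i with
   | inl j => match fintype.split j with
     | inl l => rshift k (lshift n l) | inr l => lshift (1 + n) l end
   | inr j => rshift k (rshift 1 j) end.
  have := definable_over_pullback t defD.
  congr (definable_over S A _); apply/seteqP.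
  have E w : pullback t w =
   row_mx (row_mx (lsubmx (rsubmx w)) (lsubmx w) : 'rV_(1 + k))
             (rsubmx (rsubmx w)).
    apply/rowP => i; rewrite mxE [in RHS]mxE /t.
    case: (fintype.split i) => j; last by rewrite !mxE.
    by rewrite [in RHS]mxE; case: (fintype.split j) => l; rewrite !mxE.
  by split=> w /=; rewrite E.
have := definable_over_exists1 (IH _ _ dD').
congr (definable_over S A _); apply/seteqP; split=> v /=.
  move=> [a [y]]; rewrite /D' /= !(row_mxKl, row_mxKr) => Dy.
  by exists (row_mx (a%:M : 'rV[M]_1) y).
move=> [y Dy]; exists (@lsubmx M 1 1 k y 0 0), (@rsubmx M 1 1 k y).
rewrite /D' /= !(row_mxKl, row_mxKr) -mx11_scalar.
by rewrite (_ : row_mx (@lsubmx M 1 1 k y) _ = y) //; exact: hsubmxK.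
Qed.

End Definability.

Lemma definable_over_bigcap (L : language) (M : rcfType) (S : expansion L M)
    (A : set M) n (D : {fset set 'rV[M]_n}) :
  (forall E, E \in D -> definable_over S A E) ->
  definable_over S A (\bigcap_(E in [set E | E \in D]) E).
Proof.
move=> defD.
rewrite -[X in definable_over _ _ X]/(\bigcap_(E in [set` D]) id E) bigcap_fset.
rewrite big_seq; elim/big_ind: _ => //.
- exact: definable_overT.
- by move=> ? ?; exact: definable_overI.
Qed.

(** * Small sets and finite sets of parameters *)

Lemma realField_card_le_tail (M : realFieldType) (b : M) :
  [set: M] #<= [set x : M | b < x].
Proof.
pose f (x : M) := b + (if 0 <= x then 1 + x else (1 - x)^-1).
have fpos (x : M) : 0 < (if 0 <= x then 1 + x else (1 - x)^-1).
  case: (leP 0 x) => hx; first by rewrite ltr_pwDl.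
  by rewrite invr_gt0 subr_gt0 (lt_trans hx).
have f_inj : injective f.
  move=> x y /addrI.
  case: (leP 0 x) => hx; case: (leP 0 y) => hy.
  - by move/addrI.
  - move=> E; have : 1 <= (1 - y)^-1 by rewrite -E lerDl.
    by rewrite leNgt invf_lt1 ?subr_gt0 ?(lt_trans hy) // ltrDl oppr_gt0 hy.
  - move=> E; have : 1 <= (1 - x)^-1 by rewrite E lerDl.
    by rewrite leNgt invf_lt1 ?subr_gt0 ?(lt_trans hx) // ltrDl oppr_gt0 hx.
  - by move/invr_inj/addrI/oppr_inj.
have := card_image_le f [set: M].
have -> : [set: M] = f @^-1` [set x | b < x].
  by apply/seteqP; split=> // x _ /=; rewrite /f ltrDl.
move=> _; apply: card_ge_preimage; exact: in2W.
Qed.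

(** An injection of the field into the union takes values in the finite set [B] at finitely many
    arguments only; beyond them it is an injection into [A], and a half-line is as large as the
    field. *)
Lemma small_setU_finite (M : rcfType) (A B : set M) :
  small A -> finite_set B -> small (A `|` B).
Proof.
move=> [_ nA] finB; split; first exact: subset_card_le.
move=> /pcard_leP[f]; apply: nA.
have f_inj : injective f by move=> x y; apply: inj; rewrite ?inE.
have : finite_set (f @^-1` B).
  by apply: finite_preimage => //; exact: in2W.
move=> /finite_seqP[s sE].
have [b bP] : exists b : M, forall x, x \in s -> x <= b.
  exists (\sum_(x <- s) `|x|) => x xs.
  rewrite (big_rem x xs) /=; apply: le_trans (ler_norm x) _.
  by rewrite lerDl sumr_ge0.
apply: card_le_trans (realField_card_le_tail b) _.
apply: (@card_le_trans _ _ _ (f @^-1` A)); last first.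
  by apply: card_ge_preimage; exact: in2W.
apply: subset_card_le => x /= bx.
have [//|Bx] : (A `|` B) (f x) by apply: (funS (s := f)).
have : [set` s] x by rewrite -sE.
by move=> /bP; rewrite leNgt bx.
Qed.

Lemma finite_range_row (T : choiceType) k (a : 'rV[T]_k) :
  finite_set (range (a 0)).
Proof. exact: finite_image. Qed.

Lemma type_definableI (L : language) (M : rcfType) (S : expansion L M)
    n (A : set M) (F F' : set (set 'rV[M]_n)) :
  small A -> (forall E, F E -> definable_over S A E) ->
  (forall E, F' E -> definable_over S A E) ->
  type_definable S (\bigcap_(E in F) E `&` \bigcap_(E in F') E).
Proof.
move=> sA dF dF'; exists A, (F `|` F'); split=> //.
  by move=> E [/dF|/dF'].
by rewrite bigcap_setU.
Qed.

Section CosetHull.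
Variables (L : language) (M : rcfType) (S : expansion L M).
Hypothesis S_sat : saturated S.
Variables (G : zmodType) (n : nat) (code : G -> 'rV[M]_n).
Hypothesis code_inj : injective code.

(** This is the sum [X + H]. *)
Definition coset_hull (H X : set G) : set G :=
  [set g | exists2 x, X x & H (g - x)].

Definition code_add (X E : set 'rV[M]_n) : set 'rV[M]_n :=
  [set z | exists x y : G, [/\ z = code (x + y), X (code x) & E (code y)]].

Definition add_graph : set 'rV[M]_(n + n + n) :=
  [set z | exists x y : G, z = row_mx (row_mx (code x) (code y)) (code (x + y))].

Lemma add_graphE x y z : add_graph (row_mx (row_mx x y) z) <->
  exists a b, [/\ x = code a, y = code b & z = code (a + b)].
Proof.
split=> [[a [b]]|[a [b [-> -> ->]]]]; last by exists a, b.
by move=> /eq_row_mx[/eq_row_mx[-> ->] ->]; exists a, b.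
Qed.

Lemma definable_over_code_add (A : set M) (X E : set 'rV[M]_n) :
  definable_over S A add_graph -> definable_over S A X ->
  definable_over S A E -> definable_over S A (code_add X E).
Proof.
move=> dG dX dE.
pose s1 (i : 'I_n) : 'I_(n + n + n) := lshift n (lshift n i).
pose s2 (i : 'I_n) : 'I_(n + n + n) := lshift n (rshift n i).
have p1 x y z : pullback s1 (row_mx (row_mx x y) z) = x :> 'rV[M]_n.
  by apply/rowP => i; rewrite mxE !row_mxEl.
have p2 x y z : pullback s2 (row_mx (row_mx x y) z) = y :> 'rV[M]_n.
  by apply/rowP => i; rewrite mxE row_mxEl row_mxEr.
have := definable_over_exists (definable_overI dG (definable_overI
  (definable_over_pullback s1 dX) (definable_over_pullback s2 dE))).
congr (definable_over S A _); apply/seteqP; split=> z /=.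
  move=> [w]; rewrite -[w]hsubmxK => -[/add_graphE[a [b [-> -> ->]]]].
  by rewrite p1 p2 => -[Xa Eb]; exists a, b.
move=> [a [b [-> Xa Eb]]]; exists (row_mx (code a) (code b)).
by rewrite p1 p2; split=> //; apply/add_graphE; exists a, b.
Qed.

(* Saturation turns a point in all the sets X + E into a point of X + H. *)
Lemma coset_hull_code (A : set M) (F : set (set 'rV[M]_n)) (H X : set G) :
  small A -> definable_over S A add_graph ->
  definable_over S A (code @` X) ->
  (forall E, F E -> definable_over S A E) ->
  code @` H = \bigcap_(E in F) E ->
  exists F' : set (set 'rV[M]_n),
    (forall E, F' E -> definable_over S A E) /\
    code @` coset_hull H X = \bigcap_(E in F') E.
Proof.
move=> sA dG dX dF HE.
(* Finite intersections of [F] are used so that, for a given [z], the conditions on the summand in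
   [H] become finitely satisfiable. *)
exists [set code_add (code @` X) (\bigcap_(E in [set E | E \in D]) E)
  | D in [set D : {fset set 'rV[M]_n} | {subset D <= F}]]; split.
  move=> _ [D DF <-]; apply: definable_over_code_add => //.
  by apply: definable_over_bigcap => E /DF; rewrite inE => /dF.
apply/seteqP; split=> z.
  move=> [g [x Xx Hgx] <-] _ [D DF <-].
  exists x, (g - x); split; first by rewrite addrC subrK.
    by exists x.
  move=> E /= ED; have : (code @` H) (code (g - x)) by exists (g - x).
  by rewrite HE; apply; move: (DF _ ED); rewrite inE.
move=> zF'.
pose swap (i : 'I_(n + n + n)) : 'I_(n + (n + n)) := match fintype.split i with
   | inl j => match fintype.split j with
     | inl l => lshift (n + n) l | inr l => rshift n (rshift n l) end
   | inr j => rshift n (lshift n j) end.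
have swapE x y : pullback swap (row_mx x (row_mx z y)) =
    row_mx (row_mx x y) z :> 'rV[M]_(n + n + n).
  apply/rowP => i; rewrite mxE [in RHS]mxE /swap.
  case: (fintype.split i) => j; last by rewrite row_mxEr row_mxEl.
  rewrite [in RHS]mxE; case: (fintype.split j) => l; first by rewrite row_mxEl.
  by rewrite !row_mxEr.
pose B := A `|` range (z 0).
(* [P] consists of the codes of [z - x] with [x] in [X]; a point of [P] in every member of [F] is
   the code of an element of [H]. *)
pose P := [set y : 'rV[M]_n | exists x, (code @` X) x /\
  add_graph (row_mx (row_mx x y) z)].
have dP : definable_over S B P.
  have dX' := definable_over_pullback (fun i : 'I_n => lshift (n + n) i) dX.
  have := definable_over_fiber z (definable_over_exists
    (definable_overI dX' (definable_over_pullback swap dG))).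
  congr (definable_over S B _); apply/seteqP.
  have E (x : 'rV[M]_n) w :
      pullback (fun i : 'I_n => lshift (n + n) i) (row_mx x w) = x.
    by apply/rowP => i; rewrite mxE row_mxEl.
  split=> y /= [x].
    by rewrite E swapE => ?; exists x.
  by move=> ?; exists x; rewrite E swapE.
have sB : small B by apply: small_setU_finite => //; exact: finite_range_row.
have dFP E : (F `|` [set P]) E -> definable_over S B E.
  by move=> [/dF|->//]; apply: definable_overS => ? ?; left.
have [|y Fy] := S_sat sB dFP.
  move=> D DFP.
  have [|x [y [zE Xx Fy]]] :=
    zF' (code_add (code @` X)
      (\bigcap_(E in [set E | E \in [fset E in D | E \in F]%fset]) E)).
    exists [fset E in D | E \in F]%fset => //.
    by move=> E; rewrite !inE /= => /andP[_ FE]; apply/set_mem.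
  exists (code y) => E /= ED; have := DFP _ ED; rewrite inE => -[FE|->].
    by apply: Fy; rewrite /= !inE ED /=; apply/mem_set.
  by exists (code x); split=> //; apply/add_graphE; exists x, y.
have [x [[a Xa ax]]] : P y by apply: Fy; right.
move=> /add_graphE[a' [b [xE yE ->]]].
have aE : a = a' by apply: code_inj; rewrite ax.
exists (a' + b) => //; exists a; first by [].
have : (code @` H) y by rewrite HE => E FE; apply: Fy; left.
by rewrite yE => -[b' Hb' /code_inj <-]; rewrite aE addrC addKr.
Qed.

End CosetHull.

Section SplitCosets.
Variables (L : language) (M : rcfType) (S : expansion L M).
Hypothesis S_sat : saturated S.
Variables (G : zmodType) (n : nat) (code : G -> 'rV[M]_n).
Hypothesis G_def : definable_group S code.
Variables (N : zmodClosed G) (X : set G).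

Lemma split_cosetsE : \pi_(quot N)%qT @^-1` split_cosets N X =
  coset_hull [set` N] X `&` coset_hull [set` N] (~` X).
Proof.
have piE g x : (\pi_(quot N)%qT x = \pi_(quot N)%qT g) <-> (g - x \in N).
  split=> [/esym/eqP|H]; first by rewrite -Quotient.idealrBE.
  by apply/esym/eqP; rewrite -Quotient.idealrBE.
apply/seteqP; split=> g /=.
  by move=> [[x [/= /piE gx Xx]] [y [/= /piE gy Xy]]]; split; [exists x|exists y].
move=> [[x Xx /= gx] [y Xy /= gy]].
by split; [exists x|exists y]; split=> //=; apply/piE.
Qed.

(** The set of split cosets is closed, hence Borel. One small set [A'] carries the parameters of
    [N], of [X] and of the group, because saturation is applied over all of them together. *)
Lemma logic_closed_split_cosets :
  type_definable S (code @` [set` N]) -> definable S (code @` X) ->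
  logic_closed S code N (split_cosets N X).
Proof.
move=> [A [F [sA dF NE]]] defX; rewrite /logic_closed /= split_cosetsE.
have [code_inj dR dG] := G_def.
have finite_par k (D : set 'rV[M]_k) : definable S D ->
    exists B, finite_set B /\ definable_over S B D.
  move=> [m [p [phi [_ ->]]]]; exists (range (p 0)).
  split; first exact: finite_range_row.
  by exists m, p, phi; split=> // i; exists i.
have [B1 [f1 d1]] := finite_par _ _ dG.
have [B2 [f2 d2]] := finite_par _ _ defX.
have [B3 [f3 d3]] := finite_par _ _ dR.
pose A' := A `|` (B1 `|` B2 `|` B3).
have sA' : small A' by apply: small_setU_finite => //; rewrite !finite_setU.
have d1' : definable_over S A' (add_graph code).
  by apply: definable_overS d1 => ? ?; right; left; left.
have d2' : definable_over S A' (code @` X).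
  by apply: definable_overS d2 => ? ?; right; left; right.
have d3' : definable_over S A' (range code).
  by apply: definable_overS d3 => ? ?; right; right.
have dF' E : F E -> definable_over S A' E.
  by move=> /dF; apply: definable_overS => ? ?; left.
have d4 : definable_over S A' (code @` (~` X)).
  have := definable_overI d3' (definable_overC d2').
  congr (definable_over S A' _); apply/seteqP; split=> z.
    by move=> [[x _ <-] nX]; exists x => // Xx; apply: nX; exists x.
  by move=> [x nX <-]; split; [exists x|move=> [y Xy /code_inj yx]; apply: nX; rewrite -yx].
have [F1 [dF1 E1]] := coset_hull_code S_sat code_inj sA' d1' d2' dF' NE.
have [F2 [dF2 E2]] := coset_hull_code S_sat code_inj sA' d1' d4 dF' NE.
have -> : code @` (coset_hull [set` N] X `&` coset_hull [set` N] (~` X)) =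
    code @` coset_hull [set` N] X `&` code @` coset_hull [set` N] (~` X).
  apply/seteqP; split=> z; first by move=> [g [? ?] <-]; split; exists g.
  by move=> [[g Xg <-] [g' Xg' /code_inj E]]; exists g => //; split=> //; rewrite -E.
by rewrite E1 E2; exact: type_definableI dF1 dF2.
Qed.

End SplitCosets.

(** * Coded types *)

Section CodedTypes.
Variables (L : language) (M : rcfType) (S : expansion L M) (A0 : set M).

Lemma definable_over_feq (A : set M) n (t1 t2 : term L n) :
  definable_over S A [set z | Defs.eval S z t1 = Defs.eval S z t2].
Proof.
exists 0%N, 0, (feq (term_rename (@rshift 0 n) t1) (term_rename (@rshift 0 n) t2)).
split; first by case.
have E z : pullback (@rshift 0 n) (row_mx (0 : 'rV[M]_0) z) = z.
  by apply/rowP => i; rewrite mxE row_mxEr.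
by apply/seteqP; split=> z /=; rewrite !eval_rename E.
Qed.

Lemma definable_over_flt (A : set M) n (t1 t2 : term L n) :
  definable_over S A [set z | Defs.eval S z t1 < Defs.eval S z t2].
Proof.
exists 0%N, 0, (flt (term_rename (@rshift 0 n) t1) (term_rename (@rshift 0 n) t2)).
split; first by case.
have E z : pullback (@rshift 0 n) (row_mx (0 : 'rV[M]_0) z) = z.
  by apply/rowP => i; rewrite mxE row_mxEr.
by apply/seteqP; split=> z /=; rewrite !eval_rename E.
Qed.

(** Pairs, tuples, elements of [M] and of [G] all occur as parameters of definable families; a coded
    type lets definability be stated and proved on them without coordinates. [A0] holds the fixed
    parameters (group law, charts); further ones are recorded in each statement by [A]. *)
Record dtype := DType {
  dsort :> Type;
  ddim : nat;
  denc : dsort -> 'rV[M]_ddim;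
  denc_inj : injective denc;
  dran : definable_over S A0 (range denc) }.

Definition dset (T : dtype) (A : set M) (P : T -> Prop) : Prop :=
  definable_over S (A0 `|` A) (@denc T @` [set t | P t]).

(** These maps select coordinates of the code, so preimages of definable sets are obtained by
    renaming variables. *)
Definition cmap (T U : dtype) (f : T -> U) : Prop :=
  exists s : 'I_(ddim U) -> 'I_(ddim T), forall t, denc (f t) = pullback s (denc t).

Definition dran' (T : dtype) A : definable_over S (A0 `|` A) (range (@denc T)).
Proof. by apply: definable_overS (dran T) => x ?; left. Qed.

Lemma dset_ext (T : dtype) A (P Q : T -> Prop) :
  (forall t, P t <-> Q t) -> dset A P -> dset A Q.
Proof. by move=> PQ; rewrite (_ : P = Q)//; apply/funext => t; apply/propext. Qed.

Lemma dset_mono (T : dtype) (A B : set M) (P : T -> Prop) :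
  A `<=` B -> dset A P -> dset B P.
Proof. by move=> AB; apply: definable_overS => x [?|/AB ?]; [left|right]. Qed.

Lemma dset_cmap (T U : dtype) A (f : T -> U) (P : U -> Prop) :
  cmap f -> dset A P -> dset A (fun t => P (f t)).
Proof.
move=> [s sE] dP; rewrite /dset.
have := definable_overI (dran' T A) (definable_over_pullback s dP).
congr (definable_over S _ _); apply/seteqP; split=> z /=.
  move=> [[t _ <-]]; rewrite -sE => -[u Pu /denc_inj E]; exists t => //.
  by rewrite -E.
by move=> [t Pt <-]; split; [exists t|rewrite -sE; exists (f t)].
Qed.

Lemma dset_true (T : dtype) A : dset A (fun _ : T => True).
Proof. by have := dran' T A; congr (definable_over S _ _). Qed.

Lemma dset_and (T : dtype) A (P Q : T -> Prop) :
  dset A P -> dset A Q -> dset A (fun t => P t /\ Q t).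
Proof.
move=> dP dQ; have := definable_overI dP dQ.
congr (definable_over S _ _); apply/seteqP; split=> z /=.
  by move=> [[t Pt <-] [u Qu /denc_inj E]]; exists t => //; split; rewrite // -E.
by move=> [t [Pt Qt] <-]; split; exists t.
Qed.

Lemma dset_not (T : dtype) A (P : T -> Prop) :
  dset A P -> dset A (fun t => ~ P t).
Proof.
move=> dP; have := definable_overI (dran' T A) (definable_overC dP).
congr (definable_over S _ _); apply/seteqP; split=> z /=.
  by move=> [[t _ <-] nP]; exists t => // Pt; apply: nP; exists t.
move=> [t nP <-]; split; first by exists t.
by move=> [u Pu /denc_inj E]; apply: nP; rewrite -E.
Qed.

Lemma dset_or (T : dtype) A (P Q : T -> Prop) :
  dset A P -> dset A Q -> dset A (fun t => P t \/ Q t).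
Proof.
move=> dP dQ; have := dset_not (dset_and (dset_not dP) (dset_not dQ)).
apply: dset_ext => t; split; last by case=> ? [].
by move=> H; apply/not_notP => /not_orP.
Qed.

Lemma dset_imp (T : dtype) A (P Q : T -> Prop) :
  dset A P -> dset A Q -> dset A (fun t => P t -> Q t).
Proof.
move=> dP dQ; have := dset_or (dset_not dP) dQ.
by apply: dset_ext => t; rewrite implyE.
Qed.

Lemma dset_iff (T : dtype) A (P Q : T -> Prop) :
  dset A P -> dset A Q -> dset A (fun t => P t <-> Q t).
Proof. by move=> dP dQ; apply: dset_and; apply: dset_imp. Qed.

Lemma dset_false (T : dtype) A : dset A (fun _ : T => False).
Proof.
by have := dset_not (dset_true T A); apply: dset_ext => t; split.
Qed.

Lemma dset_cst (T : dtype) A (P : Prop) : dset A (fun _ : T => P).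
Proof.
case: (pselect P) => p; [have := dset_true T A|have := dset_false T A];
  by apply: dset_ext => t; split.
Qed.

Lemma cmap_id (T : dtype) : cmap (fun t : T => t).
Proof. by exists id => t; apply/rowP => i; rewrite mxE. Qed.

Lemma cmap_comp (T U V : dtype) (f : T -> U) (g : U -> V) :
  cmap f -> cmap g -> cmap (fun t => g (f t)).
Proof.
move=> [s sE] [r rE]; exists (s \o r) => t; rewrite rE sE.
by apply/rowP => i; rewrite !mxE.
Qed.

Section Prod.
Variables T U : dtype.
Let enc (p : T * U) := row_mx (denc p.1) (denc p.2).

Fact prod_enc_inj : injective enc.
Proof.
by move=> [a b] [c d]; rewrite /enc /= => /eq_row_mx[/denc_inj -> /denc_inj ->].
Qed.

Fact prod_ran : definable_over S A0 (range enc).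
Proof.
have := definable_overI
  (definable_over_pullback (lshift (ddim U)) (dran T))
  (definable_over_pullback (@rshift (ddim T) _) (dran U)).
congr (definable_over S _ _); apply/seteqP; split=> z /=.
  move=> [[t _ tE] [u _ uE]]; exists (t, u) => //; rewrite /enc /= tE uE.
  rewrite -[RHS]hsubmxK; congr row_mx; apply/rowP => i; rewrite !mxE //.
move=> [[t u] _ <-]; split; [exists t|exists u] => //; apply/rowP => i.
  by rewrite mxE row_mxEl.
by rewrite mxE row_mxEr.
Qed.

Definition dprod := DType prod_enc_inj prod_ran.

Lemma cmap_fst0 : cmap (fun p : dprod => p.1 : T).
Proof. by exists (lshift _) => p; apply/rowP => i; rewrite mxE row_mxEl. Qed.

Lemma cmap_snd0 : cmap (fun p : dprod => p.2 : U).
Proof. by exists (@rshift _ _) => p; apply/rowP => i; rewrite mxE row_mxEr. Qed.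
End Prod.

Lemma cmap_pair (V T U : dtype) (f : V -> T) (g : V -> U) :
  cmap f -> cmap g -> cmap (fun v => (f v, g v) : dprod T U).
Proof.
move=> [s sE] [r rE].
exists (fun i : 'I_(ddim T + ddim U) => match fintype.split i with
   | inl j => s j | inr j => r j end) => v.
rewrite [LHS]/(row_mx (denc (f v)) (denc (g v))) sE rE.
apply/rowP => i; rewrite mxE [in RHS]mxE.
by case: (@fintype.split (ddim T) (ddim U) i) => j; rewrite mxE.
Qed.

Lemma cmap_fst (V T U : dtype) (f : V -> dprod T U) :
  cmap f -> cmap (fun v => (f v).1 : T).
Proof. by move=> cf; exact: cmap_comp cf (cmap_fst0 T U). Qed.

Lemma cmap_snd (V T U : dtype) (f : V -> dprod T U) :
  cmap f -> cmap (fun v => (f v).2 : U).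
Proof. by move=> cf; exact: cmap_comp cf (cmap_snd0 T U). Qed.

Fact unit_enc_inj : injective (fun _ : unit => 0 : 'rV[M]_0).
Proof. by move=> [] []. Qed.

Fact unit_ran : definable_over S A0 (range (fun _ : unit => 0 : 'rV[M]_0)).
Proof.
have := definable_overT S A0 0; congr (definable_over S _ _).
by apply/seteqP; split=> z // _; exists tt => //; apply/rowP => -[].
Qed.

Definition dunit := DType unit_enc_inj unit_ran.

Fact M_enc_inj : injective (fun x : M => (x%:M : 'rV[M]_1)).
Proof. by move=> x y /matrixP /(_ 0 0); rewrite !mxE. Qed.

Fact M_ran : definable_over S A0 (range (fun x : M => (x%:M : 'rV[M]_1))).
Proof.
have := definable_overT S A0 1; congr (definable_over S _ _).
by apply/seteqP; split=> z // _; exists (z 0 0) => //; rewrite -mx11_scalar.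
Qed.

Definition dM := DType M_enc_inj M_ran.

Fact vec_ran m : definable_over S A0 (range (fun v : 'rV[M]_m => v)).
Proof.
have := definable_overT S A0 m; congr (definable_over S _ _).
by apply/seteqP; split=> z // _; exists z.
Qed.

Definition dvec m := @DType 'rV[M]_m m id (@inj_id _) (vec_ran m).

Fixpoint dpow (T : dtype) (k : nat) : dtype :=
  if k is k'.+1 then dprod T (dpow T k') else dunit.

Lemma dset_ex (T U : dtype) A (R : T -> U -> Prop) :
  dset A (fun p : dprod T U => R p.1 p.2) -> dset A (fun t => exists u, R t u).
Proof.
move=> dR.
have cs : cmap (fun p : dprod U T => (p.2, p.1) : dprod T U).
  by apply: cmap_pair; [exact: cmap_snd0|exact: cmap_fst0].
have := definable_over_exists (dset_cmap cs dR : definable_over _ _ (_ : set 'rV[M]_(_ + _))).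
congr (definable_over S _ _); apply/seteqP; split=> z /=.
  move=> [y [[u t] /= Rtu /eq_row_mx[_ <-]]].
  by exists t => //; exists u.
by move=> [t [u Rtu] <-]; exists (denc u), (u, t).
Qed.

Lemma dset_all (T U : dtype) A (R : T -> U -> Prop) :
  dset A (fun p : dprod T U => R p.1 p.2) -> dset A (fun t => forall u, R t u).
Proof.
move=> dR; have := dset_not (dset_ex (R := fun t u => ~ R t u) (dset_not dR)).
apply: dset_ext => t; split; first by move=> H u; apply/not_notP => n; apply: H; exists u.
by move=> H [u]; apply; exact: H.
Qed.

Lemma dset_eq0 (T : dtype) A : dset A (fun p : dprod T T => p.1 = p.2).
Proof.
pose n := ddim T.
have dE : definable_over S (A0 `|` A) (\big[setI/setT]_(i < n)
    [set z : 'rV[M]_(n + n) | z 0 (lshift n i) = z 0 (rshift n i)]).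
  elim/big_ind: _ => //; first exact: definable_overT.
    by move=> ? ?; exact: definable_overI.
  move=> i _.
  exact: (definable_over_feq _ (tvar L (lshift n i)) (tvar L (rshift n i))).
have := definable_overI (dran' (dprod T T) A) dE.
congr (definable_over S _ _); apply/seteqP; split=> z /=.
  move=> [[[t u] _ <-]] E; exists (t, u) => //=.
  apply: denc_inj; apply/rowP => i; move: E; rewrite (bigD1 i) //= => -[E _].
  by move: E; rewrite row_mxEl row_mxEr.
move=> [[t u] /= -> <-]; split; first by exists (u, u).
elim/big_ind: _ => // i _ /=.
by rewrite row_mxEl row_mxEr.
Qed.

End CodedTypes.

(** * Definable functions and homogeneity *)

Canonical dM.
Canonical dprod.
Canonical dunit.
Canonical dvec.

Section DefinableFunctions.
Variables (L : language) (M : rcfType) (S : expansion L M) (A0 : set M).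
Local Notation dtype := (dtype S A0).
Local Notation dM := (dM S A0).

Definition dfun (T U : dtype) (A : set M) (f : T -> U) : Prop :=
  dset A (fun p : dprod T U => p.2 = f p.1).

Lemma dfun_cmap (T U : dtype) A (f : T -> U) : cmap f -> dfun A f.
Proof.
move=> cf; apply: (dset_cmap (f := fun p : dprod T U => (p.2, f p.1) : dprod U U)
  (P := fun q => q.1 = q.2) _ (dset_eq0 U A)).
apply: cmap_pair; first exact: cmap_snd0.
exact: cmap_comp (cmap_fst0 T U) cf.
Qed.

Lemma dfun_mono (T U : dtype) (A B : set M) (f : T -> U) :
  A `<=` B -> dfun A f -> dfun B f.
Proof. exact: dset_mono. Qed.

Lemma dset_comp (T U : dtype) A (f : T -> U) (P : U -> Prop) :
  dset A P -> dfun A f -> dset A (fun t => P (f t)).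
Proof.
move=> dP df.
have := dset_ex (R := fun t u => u = f t /\ P u)
  (dset_and df (dset_cmap (cmap_snd0 T U) dP)).
apply: dset_ext => t; split; first by move=> [u [->]].
by move=> Pt; exists (f t).
Qed.

Lemma dfun_pair (V T U : dtype) A (f : V -> T) (g : V -> U) :
  dfun A f -> dfun A g -> dfun A (fun v => (f v, g v) : dprod T U).
Proof.
move=> df dg.
have c1 : cmap (fun p : dprod V (dprod T U) => (p.1, p.2.1) : dprod V T).
  by apply: cmap_pair; [exact: cmap_fst0|apply: cmap_fst; exact: cmap_snd0].
have c2 : cmap (fun p : dprod V (dprod T U) => (p.1, p.2.2) : dprod V U).
  by apply: cmap_pair; [exact: cmap_fst0|apply: cmap_snd; exact: cmap_snd0].
have := dset_and (dset_cmap c1 df) (dset_cmap c2 dg).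
by apply: dset_ext => -[v [t u]] /=; split=> [[-> ->]//|[-> ->]].
Qed.

Lemma dfun_comp (T U V : dtype) A (f : T -> U) (g : U -> V) :
  dfun A g -> dfun A f -> dfun A (fun t => g (f t)).
Proof.
move=> dg df; rewrite /dfun.
apply: (dset_comp (f := fun p : dprod T V => (f p.1, p.2) : dprod U V)
  (P := fun q => q.2 = g q.1)) => //.
apply: dfun_pair; last exact/dfun_cmap/cmap_snd0.
rewrite /dfun; apply: (dset_cmap
  (f := fun q : dprod (dprod T V) U => (q.1.1, q.2) : dprod T U)
  (P := fun p => p.2 = f p.1)) => //.
by apply: cmap_pair; [apply: cmap_fst; exact: cmap_fst0|exact: cmap_snd0].
Qed.

Lemma dset_comp2 (T U V : dtype) A (f : T -> U) (g : T -> V) (R : U -> V -> Prop) :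
  dset A (fun q : dprod U V => R q.1 q.2) -> dfun A f -> dfun A g ->
  dset A (fun t => R (f t) (g t)).
Proof.
move=> dR df dg.
by apply: (dset_comp (f := fun t => (f t, g t) : dprod U V) dR); exact: dfun_pair.
Qed.

Lemma dset_comp3 (T U V W : dtype) A (f : T -> U) (g : T -> V) (h : T -> W)
    (R : U -> V -> W -> Prop) :
  dset A (fun q : dprod (dprod U V) W => R q.1.1 q.1.2 q.2) ->
  dfun A f -> dfun A g -> dfun A h ->
  dset A (fun t => R (f t) (g t) (h t)).
Proof.
move=> dR df dg dh.
apply: (dset_comp (f := fun t => ((f t, g t), h t) : dprod (dprod U V) W) dR).
by apply: dfun_pair => //; exact: dfun_pair.
Qed.

Lemma dfun_comp2 (T U V W : dtype) A (f : T -> U) (g : T -> V) (h : U -> V -> W) :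
  dfun A (fun q : dprod U V => h q.1 q.2) -> dfun A f -> dfun A g ->
  dfun A (fun t => h (f t) (g t)).
Proof.
move=> dh df dg.
by apply: (dfun_comp (f := fun t => (f t, g t) : dprod U V) dh); exact: dfun_pair.
Qed.

Lemma dfun_fst (V T U : dtype) A (f : V -> dprod T U) :
  dfun A f -> dfun A (fun v => (f v).1 : T).
Proof. by move=> df; exact: dfun_comp (dfun_cmap A (cmap_fst0 T U)) df. Qed.

Lemma dfun_snd (V T U : dtype) A (f : V -> dprod T U) :
  dfun A f -> dfun A (fun v => (f v).2 : U).
Proof. by move=> df; exact: dfun_comp (dfun_cmap A (cmap_snd0 T U)) df. Qed.

Lemma dset_eq (T U : dtype) A (f g : T -> U) :
  dfun A f -> dfun A g -> dset A (fun t => f t = g t).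
Proof. exact/(dset_comp2 (R := fun x y => x = y))/dset_eq0. Qed.

Lemma dset_lt0 A : dset A (fun p : dprod dM dM => p.1 < p.2).
Proof.
have := definable_over_flt S (A0 `|` A) (tvar L (@lshift 1 1 0)) (tvar L (@rshift 1 1 0)).
congr (definable_over S _ _); apply/seteqP; split=> z /=.
  move=> H; exists (z 0 (@lshift 1 1 0), z 0 (@rshift 1 1 0)) => //=.
  rewrite -[RHS](@hsubmxK _ 1 1 1); congr row_mx; apply/rowP => i;
    by rewrite !mxE (ord1 i).
by move=> [[x y] /= xy <-]; rewrite row_mxEl row_mxEr !mxE.
Qed.

Lemma dset_lt (T : dtype) A (f g : T -> dM) :
  dfun A f -> dfun A g -> dset A (fun t => f t < g t).
Proof. exact/(dset_comp2 (R := fun x y : M => x < y))/dset_lt0. Qed.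

Lemma dset_le (T : dtype) A (f g : T -> dM) :
  dfun A f -> dfun A g -> dset A (fun t => f t <= g t).
Proof.
move=> df dg; have := dset_not (dset_lt dg df).
by apply: dset_ext => t; rewrite leNgt; split=> /negP.
Qed.

Lemma dfun_term2 A (t : term L (1 + 1 + 1)) (op : M -> M -> M) :
  (forall z, Defs.eval S z t =
     op (z 0 (lshift 1 (@lshift 1 1 0))) (z 0 (lshift 1 (@rshift 1 1 0)))) ->
  dfun A (fun p : dprod dM dM => op p.1 p.2 : dM).
Proof.
move=> tE.
have := definable_over_feq S (A0 `|` A) (tvar L (@rshift 2 1 0)) t.
congr (definable_over S _ _); apply/seteqP; split=> z /=.
  rewrite tE => H; exists ((z 0 (lshift 1 (@lshift 1 1 0)), z 0 (lshift 1 (@rshift 1 1 0))),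
    z 0 (@rshift 2 1 0)) => //=.
  rewrite -[RHS](@hsubmxK _ 1 2 1); congr row_mx; last first.
    by apply/rowP => i; rewrite !mxE (ord1 i).
  rewrite -[RHS](@hsubmxK _ 1 1 1); congr row_mx; apply/rowP => i;
    by rewrite !mxE (ord1 i).
move=> [[[x y] w] /= -> <-]; rewrite tE.
by rewrite row_mxEr !row_mxEl row_mxEr !mxE.
Qed.

Lemma dfun_addM (T : dtype) A (f g : T -> dM) :
  dfun A f -> dfun A g -> dfun A (fun t => f t + g t : dM).
Proof.
apply: (dfun_comp2 (h := fun x y : dM => x + y : dM)).
by apply: (@dfun_term2 _ (tadd (tvar L (lshift 1 (@lshift 1 1 0)))
  (tvar L (lshift 1 (@rshift 1 1 0))))).
Qed.

Lemma dfun_mulM (T : dtype) A (f g : T -> dM) :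
  dfun A f -> dfun A g -> dfun A (fun t => f t * g t : dM).
Proof.
apply: (dfun_comp2 (h := fun x y : dM => x * y : dM)).
by apply: (@dfun_term2 _ (tmul (tvar L (lshift 1 (@lshift 1 1 0)))
  (tvar L (lshift 1 (@rshift 1 1 0))))).
Qed.

Lemma dfun_oppM (T : dtype) A (f : T -> dM) :
  dfun A f -> dfun A (fun t => - f t : dM).
Proof.
move=> df.
apply: (dfun_comp2 (h := fun x y : dM => - x : dM) _ df df).
by apply: (@dfun_term2 _ (topp (tvar L (lshift 1 (@lshift 1 1 0)))) (fun x y => - x)).
Qed.

(** Definability of the singleton of [u] over [A] expresses that [u] lies in the definable closure
    of the parameters; this form, rather than membership of coordinates in [A], is the one used
    throughout. *)
Lemma dpt_par (T : dtype) (A : set M) (u : T) :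
  (forall i, A (denc u 0 i)) -> dset A (fun t : T => t = u).
Proof.
move=> Au.
have := definable_over_fiber (denc u) (dset_eq0 T A : definable_over _ _ (_ : set 'rV[M]_(_ + _))).
move=> /definable_overS H.
have := H (A0 `|` A); rewrite /dset => {}H.
suff -> : denc (d:=T) @` [set t | t = u] =
  [set x | [set denc (d:=dprod T T) t | t in [set t | t.1 = t.2]] (row_mx (denc u) x)].
  by apply: H => x [//|[i _ <-]]; right.
apply/seteqP; split=> z /=; first by move=> [t -> <-]; exists (u, u).
by move=> [[a b] /= -> /eq_row_mx[/denc_inj -> <-]]; exists u.
Qed.

Lemma dfun_cst (T U : dtype) A (u : U) :
  dset A (fun v : U => v = u) -> dfun A (fun _ : T => u).
Proof. exact/dset_cmap/cmap_snd0. Qed.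

Lemma dset_fiber (T U : dtype) A (R : T -> U -> Prop) (t : T) :
  dset A (fun q : dprod T U => R q.1 q.2) -> dset A (fun s : T => s = t) ->
  dset A (R t).
Proof.
move=> dR dt; apply: (dset_comp2 dR); first exact: dfun_cst.
exact/dfun_cmap/cmap_id.
Qed.

Lemma dpt_M0 A : dset A (fun x : dM => x = 0).
Proof.
have : dset A (fun x : dM => x + x = x :> M).
  by apply: dset_eq; [apply: dfun_addM|]; apply/dfun_cmap/cmap_id.
apply: dset_ext => x; split=> [/eqP|->]; last by rewrite addr0.
by rewrite -subr_eq0 addrK => /eqP.
Qed.

Lemma dpt_M1 A : dset A (fun x : dM => x = 1).
Proof.
have : dset A (fun x : dM => x * x = x :> M /\ x <> 0 :> M).
  apply: dset_and; last exact/dset_not/dpt_M0.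
  by apply: dset_eq; [apply: dfun_mulM|]; apply/dfun_cmap/cmap_id.
apply: dset_ext => x; split=> [[/eqP xx /eqP x0]|->]; last first.
  by split; [rewrite mulr1|apply/eqP; rewrite oner_eq0].
by apply/eqP; rewrite -(inj_eq (mulfI x0)) mulr1.
Qed.

Lemma dset_allseq (T : dtype) A (s : seq (set T)) :
  (forall P, P \in s -> dset A P) -> dset A (fun t => forall P, P \in s -> P t).
Proof.
elim: s => [|P s IH] ds; first by apply: dset_ext (dset_true T A) => t; split.
have ds' Q : Q \in s -> dset A Q by move=> Qs; apply: ds; rewrite inE Qs orbT.
have := dset_and (ds P (mem_head _ _)) (IH ds').
apply: dset_ext => t; split; first by move=> [Pt st] Q; rewrite inE => /orP[/eqP->|/st].
by move=> H; split=> [|Q Qs]; apply: H; rewrite inE ?eqxx ?Qs ?orbT.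
Qed.

(** Equality of types over the parameters; one implication suffices because definable sets are
    closed under complement. *)
Definition eqtp (T : dtype) A (t t' : T) := forall P, dset A P -> P t -> P t'.

Lemma eqtp_refl (T : dtype) A (t : T) : eqtp A t t.
Proof. by []. Qed.

Lemma eqtp_sym (T : dtype) A (t t' : T) : eqtp A t t' -> eqtp A t' t.
Proof.
by move=> tt' P dP Pt'; apply/not_notP => nPt; apply: tt' (dset_not dP) nPt Pt'.
Qed.

Lemma eqtp_trans (T : dtype) A (t u v : T) : eqtp A t u -> eqtp A u v -> eqtp A t v.
Proof. by move=> tu uv P dP Pt; exact: uv dP (tu P dP Pt). Qed.

Lemma eqtp_fun (T U : dtype) A (f : T -> U) t t' :
  dfun A f -> eqtp A t t' -> eqtp A (f t) (f t').
Proof. by move=> df tt' P dP; apply: (tt' (fun t => P (f t))); exact: dset_comp. Qed.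

Section Saturation.
Hypothesis S_sat : saturated S.

Lemma dsat (T : dtype) A (F : set (set T)) :
  small (A0 `|` A) -> (forall P, F P -> dset A P) ->
  (forall s : seq (set T), (forall P, P \in s -> F P) ->
     exists t, forall P, P \in s -> P t) ->
  exists t, forall P, F P -> P t.
Proof.
move=> sA dF finF.
pose F' : set (set 'rV[M]_(ddim T)) :=
  [set denc (d:=T) @` P | P in F] `|` [set range (denc (d:=T))].
have dF' E : F' E -> definable_over S (A0 `|` A) E.
  by move=> [[P FP <-]|->]; [exact: dF|exact: dran'].
have preK (P : set T) : denc (d:=T) @^-1` (denc (d:=T) @` P) = P.
  by apply/seteqP; split=> t; [move=> [u Pu /denc_inj <-]|exists t].
have [|z zF] := S_sat sA dF'.
  move=> D DF.
  pose pre (E : set 'rV[M]_(ddim T)) : set T := denc (d:=T) @^-1` E.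
  have [|t tP] := finF [seq pre E | E <- D & `[< F (pre E) >]].
    by move=> P /mapP[E]; rewrite mem_filter => /andP[/asboolP FE _] ->.
  exists (denc t) => E /= ED; have := DF _ ED; rewrite inE => -[[P FP PE]|->].
    have : pre E t.
      apply: tP; apply: map_f; rewrite mem_filter ED andbT.
      by apply/asboolP; rewrite /pre -PE preK.
    by [].
  by exists t.
have [t _ tz] : range (denc (d:=T)) z by apply: zF; right.
exists t => P FP; have [u Pu] : (denc (d:=T) @` P) z by apply: zF; left; exists P.
by rewrite -tz => /denc_inj <-.
Qed.

(** Compactness, in the form that makes pointwise statements uniform: what holds at every point for
    a reason definable over [A] holds everywhere for finitely many such reasons. *)
Lemma dcover (T : dtype) A (F : set (set T)) :
  small (A0 `|` A) -> (forall P, F P -> dset A P) ->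
  (forall t, exists2 P, F P & P t) ->
  exists s : seq (set T), (forall P, P \in s -> F P) /\
    (forall t, exists2 P, P \in s & P t).
Proof.
move=> sA dF cF; apply/not_notP => nex.
have [|s sF|t tF] := @dsat T A [set ~` P | P in F] sA.
- by move=> _ [P FP <-]; exact/dset_not/dF.
- apply/not_notP => nt; apply: nex.
  exists [seq ~` P | P <- s]; split.
    by move=> _ /mapP[P /sF[Q FQ <-] ->]; rewrite setCK.
  move=> t; apply/not_notP => nP; apply: nt; exists t => P Ps.
  apply/not_notP => nPt; apply: nP; exists (~` P) => //.
  by apply/mapP; exists P.
- by have [P FP Pt] := cF t; apply: (tF (~` P)) => //; exists P.
Qed.

Lemma small_par (T : dtype) A (t : T) : small (A0 `|` A) ->
  small (A0 `|` (A `|` range (denc t 0))).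
Proof.
by move=> sA; rewrite setUA; apply: small_setU_finite => //; exact: finite_range_row.
Qed.

Lemma dpt_addpar (T : dtype) (A : set M) (t : T) :
  dset (A `|` range (denc t 0)) (fun s : T => s = t).
Proof. by apply: dpt_par => i; right; exists i. Qed.

(** Homogeneity of a saturated structure, in one step; it takes the place of automorphisms fixing
    [A]. *)
Lemma eqtp_ext (T U : dtype) A (d d' : T) (a : U) : small (A0 `|` A) ->
  eqtp A d d' -> exists a', eqtp A ((d, a) : dprod T U) (d', a').
Proof.
move=> sA dd'.
pose B := A `|` range (denc d' 0).
have AB : A `<=` B by move=> x; left.
have [||a' aF] := @dsat U B [set (fun a' => P ((d', a') : dprod T U)) |
    P in [set P : set (dprod T U) | dset A P /\ P (d, a)]] (small_par d' sA).
- move=> _ [P [dP _] <-].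
  apply: (@dset_fiber T U B (fun x y => P (x, y)) d'); last exact: dpt_addpar.
  by apply: dset_ext (dset_mono AB dP) => -[].
- move=> s sF.
  (* Every condition on [a'] is a fibre over [d'] of an [A]-definable set containing [(d, a)];
     lifting the finite list makes its joint solvability a property of the type of [d]. *)
  have [r [rP rs]] : exists r : seq (set (dprod T U)),
      (forall P, P \in r -> dset A P /\ P (d, a)) /\
      (forall Q, Q \in s -> exists2 P, P \in r & Q = fun a' => P ((d', a') : dprod T U)).
    elim: s sF => [|Q s IH] sF; first by exists [::].
    have [P PP PQ] := sF Q (mem_head _ _).
    have [|r [rP rs]] := IH; first by move=> R Rs; apply: sF; rewrite inE Rs orbT.
    exists (P :: r); split=> R; rewrite inE => /orP[/eqP->|] //.
    + exact: rP.
    + by exists P; rewrite ?mem_head.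
    + by move=> /rs[P' P'r RE]; exists P'; rewrite // inE P'r orbT.
  have dr : dset A (fun x : T => exists y : U, forall P, P \in r -> P ((x, y) : dprod T U)).
    apply: (@dset_ex _ _ _ _ T U A (fun x y => forall P, P \in r -> P ((x, y) : dprod T U))).
    by apply: dset_ext (dset_allseq (fun P Pr => (rP P Pr).1)) => -[].
  have [|y yP] := dd' _ dr; first by exists a => P /rP[].
  by exists y => Q /rs[P Pr ->]; exact: yP.
by exists a' => P dP Pda; apply: (aF (fun a' => P ((d', a') : dprod T U))); exists P.
Qed.

End Saturation.

Fixpoint topow n : 'rV[M]_n -> dpow dM n :=
  match n with
  | 0 => fun _ => tt
  | n'.+1 => fun v => (v 0 ord0, topow (\row_i v 0 (lift ord0 i)))
  end.

Lemma topow_inj n : injective (@topow n).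
Proof.
elim: n => [|n IH] v w /=; first by move=> _; apply/rowP => -[].
move=> [E0 /IH E]; apply/rowP => i; case: (unliftP ord0 i) => [j|] -> //.
by move/rowP: E => /(_ j); rewrite !mxE.
Qed.

Lemma cmap_topow n : cmap (topow (n := n) : dvec S A0 n -> dpow dM n).
Proof.
elim: n => [|n [s sE]].
  by exists (fun i : 'I_0 => i) => t; apply/rowP => -[].
exists (fun i : 'I_(1 + ddim (dpow dM n)) => match fintype.split i with
   | inl j => ord0 | inr j => lift ord0 (s j) end) => v.
apply/rowP => i; rewrite [LHS]mxE [RHS]mxE.
case: (@fintype.split 1 _ i) => j /=; first by rewrite mxE (ord1 j).
by have := sE (\row_i v 0 (lift ord0 i)) => /rowP/(_ j) /= ->; rewrite !mxE.
Qed.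

(** Inductions on the number of coordinates run over powers of [M]; this map carries their
    conclusions to an arbitrary coded type. *)
Definition emb (T : dtype) (t : T) : dpow dM (ddim T) := topow (denc t).

Lemma emb_inj (T : dtype) : injective (@emb T).
Proof. by move=> t u /topow_inj/denc_inj. Qed.

Lemma cmap_emb (T : dtype) : cmap (@emb T).
Proof.
apply: (@cmap_comp _ _ _ _ T (dvec S A0 (ddim T)) _ (fun t => denc t)).
  by exists id => t; apply/rowP => i; rewrite mxE.
exact: cmap_topow.
Qed.

End DefinableFunctions.

(** * Alternation numbers *)

(** The three tactics follow the syntax of a predicate and reduce its definability to that of its
    atoms, found among the hypotheses. *)
Ltac cmap_tac :=
  lazymatch goal with
  | |- cmap (fun p => p) => apply: cmap_id
  | |- cmap (fun p => (@?f p, @?g p)) =>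
      apply: (cmap_pair (f := f) (g := g)); cmap_tac
  | |- cmap (fun p => fst (@?f p)) => apply: (cmap_fst (f := f)); cmap_tac
  | |- cmap (fun p => snd (@?f p)) => apply: (cmap_snd (f := f)); cmap_tac
  end.

Ltac dfun_tac :=
  first
  [ solve [apply: dfun_cmap; cmap_tac]
  | solve [apply: dfun_cst; first [assumption | exact: dpt_M0 | exact: dpt_M1]]
  | lazymatch goal with
    | |- dfun _ (fun p => GRing.add (@?f p) (@?g p)) =>
        apply: (dfun_addM (f := f) (g := g)); dfun_tac
    | |- dfun _ (fun p => GRing.mul (@?f p) (@?g p)) =>
        apply: (dfun_mulM (f := f) (g := g)); dfun_tac
    | |- dfun _ (fun p => GRing.opp (@?f p)) =>
        apply: (dfun_oppM (f := f)); dfun_tac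
    | |- dfun _ (fun p => (@?f p, @?g p)) =>
        apply: (dfun_pair (f := f) (g := g)); dfun_tac
    | |- dfun _ (fun p => fst (@?f p)) => apply: (dfun_fst (f := f)); dfun_tac
    | |- dfun _ (fun p => snd (@?f p)) => apply: (dfun_snd (f := f)); dfun_tac
    end
  | match goal with
    | H : dfun _ ?h |- dfun _ (fun p => ?h (@?f p)) =>
        apply: (dfun_comp (g := h) (f := f) H); dfun_tac
    | H : dfun _ (fun q => ?h q.1 q.2) |- dfun _ (fun p => ?h (@?f p) (@?g p)) =>
        apply: (dfun_comp2 (h := h) (f := f) (g := g) H); dfun_tac
    end
  ].

Ltac dset_tac :=
  lazymatch goal with
  | |- dset _ (fun p => @?P p /\ @?Q p) =>
      apply: (dset_and (P := P) (Q := Q)); dset_tac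
  | |- dset _ (fun p => @?P p \/ @?Q p) =>
      apply: (dset_or (P := P) (Q := Q)); dset_tac
  | |- dset _ (fun p => ~ @?P p) => apply: (dset_not (P := P)); dset_tac
  | |- dset _ (fun p => @?P p <-> @?Q p) =>
      apply: (dset_iff (P := P) (Q := Q)); dset_tac
  | |- dset _ (fun p => @?P p -> @?Q p) =>
      apply: (dset_imp (P := P) (Q := Q)); dset_tac
  | |- dset _ (fun p => exists x, @?R p x) =>
      apply: (dset_ex (R := R)); dset_tac
  | |- dset _ (fun p => forall x, @?R p x) =>
      apply: (dset_all (R := R)); dset_tac
  | |- dset _ (fun p => is_true (Order.lt (@?f p) (@?g p))) =>
      apply: (dset_lt (f := f) (g := g)); dfun_tac
  | |- dset _ (fun p => is_true (Order.le (@?f p) (@?g p))) =>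
      apply: (dset_le (f := f) (g := g)); dfun_tac
  | |- dset _ (fun p => @?f p = @?g p) =>
      apply: (dset_eq (f := f) (g := g)); dfun_tac
  | |- _ =>
    first
    [ assumption
    | exact: dset_cst
    | match goal with
      | H : dset _ (fun q => ?R q.1.1 q.1.2 q.2)
        |- dset _ (fun p => ?R (@?f p) (@?g p) (@?h p)) =>
          apply: (dset_comp3 (R := R) (f := f) (g := g) (h := h) H); dfun_tac
      | H : dset _ (fun q => ?R q.1 q.2)
        |- dset _ (fun p => ?R (@?f p) (@?g p)) =>
          apply: (dset_comp2 (R := R) (f := f) (g := g) H); dfun_tac
      | H : dset _ ?R |- dset _ (fun p => ?R (@?f p)) =>
          apply: (dset_comp (P := R) (f := f) H); dfun_tac
      end ]
  end.

Section Alternation.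
Variable M : rcfType.
Implicit Types (E : M -> Prop) (y z : M).

(** A weakly increasing sequence of [j] points from [y] on, along which membership in [E]
    alternates, starting with the value [b]. By recursion on [j] this is a first-order condition on
    [y]; it becomes stronger as [y] or [j] grows. *)
Fixpoint altf E (b : bool) (j : nat) y : Prop :=
  if j is j'.+1 then exists z, [/\ y <= z, E z <-> b & altf E (~~ b) j' z] else True.

Definition alt E j y := altf E true j y \/ altf E false j y.

Lemma altf_le E b j y y' : y' <= y -> altf E b j y -> altf E b j y'.
Proof. by case: j => //= j yy' [z [yz Ez H]]; exists z; split=> //; exact: le_trans yz. Qed.

Lemma alt_le E j y y' : y' <= y -> alt E j y -> alt E j y'.
Proof. by move=> yy' [] H; [left|right]; exact: altf_le H. Qed.

Lemma altf_trunc E b j y : altf E b j.+1 y -> altf E b j y.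
Proof.
elim: j b y => //= j IH b y [z [yz Ez H]]; exists z; split=> //; exact: IH.
Qed.

Lemma altS E j y : alt E j.+1 y -> alt E j y.
Proof. by case=> H; [left|right]; exact: altf_trunc. Qed.

Lemma alt_leq E i j y : (i <= j)%N -> alt E j y -> alt E i y.
Proof.
move=> ij; rewrite -(subnK ij); elim: (j - i)%N => // k IH; rewrite addSn => /altS.
exact: IH.
Qed.

Lemma alt1 E y : alt E 1 y.
Proof. by case: (pselect (E y)) => Ey; [left|right]; exists y. Qed.

Lemma altf_head E b j y : altf E b j.+1 y -> ~ (E y <-> b) -> alt E j.+2 y.
Proof.
move=> H nE; have Ey : E y <-> ~~ b.
  by case: b {H} nE => /= nE; split=> // Ey; [|apply/not_notP => nEy]; exfalso; apply: nE.
by case: b H nE Ey => H nE Ey; [right|left]; exists y; split.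
Qed.

(** Where the alternation number does not change, neither does membership: a point with the wrong
    value could be put in front of an alternation found further right, making it longer. *)
Lemma alt_homog E j y y' : y <= y' -> alt E j y' -> ~ alt E j.+1 y -> (E y <-> E y').
Proof.
move=> yy'; case: j => [_ []|j]; first exact: alt1.
have aux b : altf E b j.+1 y' -> ~ alt E j.+2 y -> (E y <-> E y').
  move=> H n; have Hy := altf_le yy' H.
  have E1 : E y <-> b by apply/not_notP => /(altf_head Hy).
  have E2 : E y' <-> b.
    by apply/not_notP => /(altf_head H) /(alt_le yy').
  by rewrite E1 E2.
by case; exact: aux.
Qed.

Lemma itv_mid (i : interval M) (x y z : M) : x <= y -> y <= z -> x \in i -> z \in i -> y \in i.
Proof.
move=> xy yz; case: i => [[b l|b] [c u|c]]; rewrite !itv_boundlr /=;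
  move=> /andP[xl xu] /andP[zl zu]; apply/andP; split=> //.
all: try exact: le_trans xl (_ : BLeft x <= BLeft y)%O.
all: try by apply: le_trans zu; rewrite bnd_simp.
all: try by apply: le_trans xl _; rewrite bnd_simp.
Qed.

(** An interval once left is never met again, so each visit to [E] uses up one interval of [s], and
    an alternation of this length contains one visit too many. *)
Lemma altf_itv (s : seq (interval M)) E y :
  (forall z, y <= z -> (E z <-> has (fun i => z \in i) s)) ->
  ~ altf E true (size s).*2.+1 y.
Proof.
have [n] := ubnP (size s); elim: n s y => // n IH s y /ltnSE sn Es /= [z [yz Ez H]].
have /hasP[i si zi] : has (fun i => z \in i) s by apply/Es => //; apply/Ez.
have s0 : (0 < size s)%N by case: (s) si.
have sE : (size s).*2 = (size s).-1.*2.+2 by rewrite -doubleS prednK.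
move: H; rewrite sE => -[z2 [zz2 Ez2]]; rewrite -[(size s).-1](size_rem si).
apply: IH; first by rewrite size_rem // prednK.
move=> w z2w; rewrite Es ?(le_trans yz) ?(le_trans zz2) //.
have nwi : w \notin i.
  apply/negP => wi; have : E z2.
    by apply/Es; [exact: le_trans zz2|apply/hasP; exists i => //; exact: itv_mid zi wi].
  by rewrite Ez2.
rewrite (perm_has _ (perm_to_rem si)) /= (negbTE nwi) //.
Qed.

Lemma alt_itv (s : seq (interval M)) E y :
  (forall z, E z <-> has (fun i => z \in i) s) -> ~ alt E (size s).*2.+2 y.
Proof.
move=> Es; case.
  by move/altf_trunc; apply: altf_itv => z _; exact: Es.
by move=> [z [_ _]]; apply: altf_itv => w _; exact: Es.
Qed.

(* A down-closed set that is locally constant off a finite set has a supremum. *)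
Lemma finite_cut (U : M -> Prop) (C : seq M) y0 z0 :
  (forall y z, y <= z -> U z -> U y) ->
  (forall y z, y0 <= y -> y <= z -> z <= z0 -> (forall c, c \in C -> ~ (y <= c <= z)) ->
     (U y <-> U z)) ->
  U y0 -> ~ U z0 -> y0 <= z0 ->
  exists p, (forall y, y < p -> U y) /\ (forall y, p < y -> ~ U y).
Proof.
move=> dU; elim: C y0 z0 => [|c C IH] y0 z0 hC Uy0 nUz0 yz0.
  by exfalso; apply/nUz0/(hC y0 z0).
have [cin|cout] := boolP (y0 <= c <= z0); last first.
  apply: IH Uy0 nUz0 yz0 => y z y0y yz zz0 nC; apply: hC => // d.
  rewrite inE => /orP[/eqP-> /andP[yc cz]|/nC//].
  by move: cout; rewrite (le_trans y0y) //= (le_trans cz).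
have [Uc|nUc] := pselect (U c).
  have [[y1 [cy1 Uy1]]|none] := pselect (exists y1, c < y1 /\ U y1); last first.
    exists c; split=> y; first by move/ltW => yc; exact: dU yc Uc.
    by move=> cy Uy; apply: none; exists y.
  have y1z0 : y1 <= z0.
    by case: (leP y1 z0) => // /ltW h; exfalso; apply/nUz0/(dU _ _ h).
  apply: (IH y1 z0) => // y z y1y yz zz0 nC; apply: hC => //.
    by apply: le_trans y1y; apply: le_trans (ltW cy1); case/andP: cin.
  move=> d; rewrite inE => /orP[/eqP-> /andP[yc cz]|/nC//].
  by move: (lt_le_trans cy1 y1y); rewrite ltNge yc.
have [[z1 [z1c nUz1]]|none] := pselect (exists z1, z1 < c /\ ~ U z1); last first.
  exists c; split=> y; first by move=> yc; apply/not_notP => nU; apply: none; exists y.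
  by move=> cy Uy; apply/nUc/(dU _ _ (ltW cy)).
have y0z1 : y0 <= z1.
  by case: (leP y0 z1) => // /ltW h; exfalso; apply/nUz1/(dU _ _ h).
apply: (IH y0 z1) => // y z y0y yz zz1 nC; apply: hC => //.
  by apply: le_trans zz1 _; apply: le_trans (ltW z1c) _; case/andP: cin.
move=> d; rewrite inE => /orP[/eqP-> /andP[yc cz]|/nC//].
by move: (le_lt_trans zz1 z1c); rewrite ltNge cz.
Qed.

Definition itv_ends (i : interval M) : seq M :=
  match i with Interval l u =>
    (if l is BSide _ x then [:: x] else [::]) ++ (if u is BSide _ x then [:: x] else [::])
  end.

Lemma itv_ends_const (i : interval M) y z : y <= z ->
  (forall c, c \in itv_ends i -> ~ (y <= c <= z)) -> (y \in i) = (z \in i).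
Proof.
have side b c : y <= z -> ~ (y <= c <= z) -> (BSide b c <= BLeft y)%O = (BSide b c <= BLeft z)%O.
  move=> yz /negP; rewrite negb_and -!ltNge => /orP[cy|zc].
    have cz := lt_le_trans cy yz; by case: b; rewrite !bnd_simp ?cy ?cz ?(ltW cy) ?(ltW cz).
  have yc := le_lt_trans yz zc; case: b; rewrite !bnd_simp;
    by rewrite ?[RHS]leNgt ?[LHS]leNgt ?[RHS]ltNge ?[LHS]ltNge ?zc ?yc ?(ltW zc) ?(ltW yc).
have side' b c : y <= z -> ~ (y <= c <= z) -> (BRight y <= BSide b c)%O = (BRight z <= BSide b c)%O.
  move=> yz /negP; rewrite negb_and -!ltNge => /orP[cy|zc].
    have cz := lt_le_trans cy yz; case: b; rewrite !bnd_simp;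
    by rewrite ?[RHS]leNgt ?[LHS]leNgt ?[RHS]ltNge ?[LHS]ltNge ?cy ?cz ?(ltW cy) ?(ltW cz).
  have yc := le_lt_trans yz zc; by case: b; rewrite !bnd_simp ?zc ?yc ?(ltW zc) ?(ltW yc).
move=> yz; case: i => l u H; rewrite !itv_boundlr; congr (_ && _).
  case: l H => [b c|[]] //= H; apply: side => //; apply: H.
  by rewrite inE eqxx.
case: u H => [b c|[]] //= H; apply: side' => //; apply: H.
by rewrite mem_cat mem_seq1 eqxx orbT.
Qed.

End Alternation.

(** * Uniform bounds, germs and cuts in an o-minimal structure *)

Section OMinimal.
Variables (L : language) (M : rcfType) (S : expansion L M) (A0 : set M).
Hypotheses (S_omin : o_minimal S) (S_sat : saturated S).
Local Notation dtype := (dtype S A0).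
Local Notation dM := (dM S A0).

Lemma dset_itv A (E : dM -> Prop) : dset A E ->
  exists s : seq (interval M), forall z, E z <-> has (fun i => z \in i) s.
Proof.
move=> dE; have [|s sE] := S_omin (E := E).
  by apply: definable_overS dE => x.
by exists s => z; rewrite sE.
Qed.

Lemma dset_alt (T : dtype) A (E : T -> dM -> Prop) j :
  dset A (fun q : dprod T dM => E q.1 q.2) ->
  dset A (fun q : dprod T dM => alt (E q.1) j q.2).
Proof.
move=> dE.
have H b : dset A (fun q : dprod T dM => altf (E q.1) b j q.2).
  elim: j b => [|j IH] b /=; first exact: dset_cst.
  have Ib := IH (~~ b).
  have : dset A (fun q : dprod T dM => exists z : dM,
      q.2 <= z /\ (E q.1 z <-> b) /\ altf (E q.1) (~~ b) j z).
    apply: dset_ex; apply: dset_and; first by dset_tac.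
    apply: dset_and; first by dset_tac.
    by apply: (@dset_comp2 _ _ _ _ _ T dM A (fun p : dprod (dprod T dM) dM => p.1.1)
      (fun p => p.2) (fun t z => altf (E t) (~~ b) j z) Ib); dfun_tac.
  by apply: dset_ext => q; split=> [[z [? [? ?]]]|[z [? ? ?]]]; exists z.
exact: dset_or.
Qed.

(** A single definable subset of the line is a finite union of intervals, hence of bounded
    alternation; a family without a common bound would, by saturation, have a member without
    bound. *)
Lemma alt_bound (T : dtype) A (E : T -> dM -> Prop) : small (A0 `|` A) ->
  dset A (fun q : dprod T dM => E q.1 q.2) ->
  exists r, forall t y, ~ alt (E t) r y.
Proof.
move=> sA dE; apply/not_notP => nex.
have [||t tP] := @dsat _ _ _ _ S_sat T A
  (range (fun r : nat => [set t : T | exists y, alt (E t) r y])) sA.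
- move=> _ [r _ <-]; apply: (dset_ex (U := dM)); exact: (@dset_alt T A E r).
(* Finitely many of the conditions follow from the one with the largest index; [xget] recovers an
   index from the set. *)
- move=> s sF; pose r := \max_(P <- s) xget 0%N [set r : nat | P = [set t : T | exists y, alt (E t) r y]].
  have [t [y ty]] : exists t y, alt (E t) r y.
    apply/not_notP => n; apply: nex; exists r => t y H; apply: n; by exists t, y.
  exists t => P Ps; have [k _ kP] := sF _ Ps.
  set g := fun P : set T => xget 0%N [set r : nat | P = [set t : T | exists y, alt (E t) r y]].
  have PE : P = [set t : T | exists y, alt (E t) (g P) y].
    by rewrite /g; case: xgetP => // /(_ k); rewrite -kP; case.
  rewrite PE; exists y; apply: alt_leq ty.
  by rewrite /r (big_rem P Ps) /= leq_maxl.
have [s sE] : exists s : seq (interval M), forall z, E t z <-> has (fun i => z \in i) s.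
  apply: (@dset_itv (A `|` range (denc t 0))).
  apply: (dset_fiber (R := E)); last exact: dpt_addpar.
  by apply: dset_mono dE => x; left.
have [y] := tP _ (imageT (fun r : nat => [set t : T | exists y, alt (E t) r y]) (size s).*2.+2).
exact: alt_itv sE.
Qed.

(** The largest alternation number attained beyond [a] is attained at some [b], hence everywhere
    between [a] and [b], and membership is constant there. *)
Lemma dset_eventually A (E : dM -> Prop) (a : M) : dset A E ->
  exists2 b, a < b & (forall u, a < u < b -> E u) \/ (forall u, a < u < b -> ~ E u).
Proof.
move=> /dset_itv[s sE].
pose Q j := `[< exists y, a < y /\ alt E j y >].
have [] := @ex_maxnP Q (size s).*2.+2.
- by exists 1%N; apply/asboolP; exists (a + 1); split; [rewrite ltrDl|exact: alt1].
- move=> j /asboolP[y [_ yj]]; rewrite leqNgt; apply/negP => /ltnW h.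
  exact: (alt_itv (y := y) sE) (alt_leq h yj).
move=> j /asboolP[b [ab bj]] jmax; exists b => //.
have hom u : a < u < b -> (E u <-> E b).
  move=> /andP[au ub]; apply: alt_homog (ltW ub) bj _ => H.
  have /jmax : Q j.+1 by apply/asboolP; exists u.
  by rewrite ltnn.
by case: (pselect (E b)) => Eb; [left|right] => u /hom ->.
Qed.

(** The supremum exists because membership in [U] changes only at ends of finitely many
    intervals. *)
Lemma dset_cut A (U : dM -> Prop) y0 z0 : dset A U ->
  (forall y z, y <= z -> U z -> U y) -> U y0 -> ~ U z0 ->
  exists p, (forall y, y < p -> U y) /\ (forall y, p < y -> ~ U y).
Proof.
move=> /dset_itv[s sE] dU Uy0 nUz0.
have y0z0 : y0 <= z0.
  by case: (leP y0 z0) => // /ltW h; exfalso; apply/nUz0/(dU _ _ h).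
apply: (@finite_cut _ U (flatten (map (@itv_ends M) s)) y0 z0) => // y z _ yz _ nC.
have Emem i : i \in s -> (y \in i) = (z \in i).
  move=> si; apply: itv_ends_const => // c ci; apply: nC.
  by apply/flattenP; exists (itv_ends i) => //; exact: map_f.
by rewrite !sE; split=> /hasP[i si yi]; apply/hasP; exists i => //; move: yi; rewrite Emem.
Qed.

End OMinimal.

(** * Definable choice *)

Section DefinableChoice.
Variables (L : language) (M : rcfType) (S : expansion L M) (A0 : set M).
Hypotheses (S_omin : o_minimal S) (S_sat : saturated S) (A00 : A0 0).
Local Notation dtype := (dtype S A0).
Local Notation dM := (dM S A0).

(** Each parameter of the formula either is in [A0] or [A], or is a coordinate of [t]; the latter
    are turned into variables. *)
Lemma dset_unfiber (T U : dtype) A (t : T) (P : U -> Prop) :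
  dset (A `|` range (denc t 0)) P ->
  exists R : T -> U -> Prop, dset A (fun q : dprod T U => R q.1 q.2) /\
    (forall u, P u <-> R t u).
Proof.
move=> [m [p [phi [pA PE]]]].
pose g i := `[< (A0 `|` A) (p 0 i) >].
have jP i : exists j : option 'I_(ddim T), if j is Some j then p 0 i = denc t 0 j else g i.
  case: (pA i) => [H|[H|[j _ jE]]].
  - by exists None; apply/asboolP; left.
  - by exists None; apply/asboolP; right.
  - by exists (Some j); rewrite jE.
have [k kP] := choice jP.
pose n := (ddim T + ddim U)%N.
pose tau (i : 'I_(m + ddim U)) : 'I_(m + n) := match fintype.split i with
  | inl i => if k i is Some j then rshift m (lshift (ddim U) j) else lshift n i
  | inr i => rshift m (rshift (ddim T) i) end.
have [psi psiE] := formula_rename S phi tau.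
(* The positions taken over by [t] still need a value in the parameter row; [0] is legal since [A0]
   contains it. *)
pose p' : 'rV[M]_m := \row_i if k i is Some _ then 0 else p 0 i.
pose R (t' : T) (u : U) := sat S psi (row_mx p' (row_mx (denc t') (denc u))).
exists R; split; last first.
  move=> u; transitivity ((denc (d:=U) @` [set u | P u]) (denc u)).
    by split=> [Pu|[v Pv /denc_inj <-]//]; exists u.
  rewrite PE /R /= psiE.
  suff -> : pullback tau (row_mx p' (row_mx (denc t) (denc u))) = row_mx p (denc u) by [].
  apply/rowP => i; rewrite mxE [in RHS]mxE /tau.
  case: (fintype.split i) => j; last by rewrite !row_mxEr.
  have := kP j; case E: (k j) => [l|] kj; first by rewrite row_mxEr row_mxEl kj.
  by rewrite row_mxEl mxE E.
have dR : definable_over S (A0 `|` A) [set z : 'rV[M]_n | sat S psi (row_mx p' z)].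
  exists m, p', psi; split=> // i; rewrite mxE; have := kP i.
  by case: (k i) => [_ _|/asboolP//]; left.
have := definable_overI (dran' (dprod T U) A) dR.
congr (definable_over S _ _); apply/seteqP; split=> z /=.
  by move=> [[[t' u] _ <-]] H; exists (t', u).
by move=> [[t' u] /= H <-]; split=> //; exists (t', u).
Qed.

Lemma dpt_fun (T U : dtype) A (f : T -> U) (t : T) : dfun A f ->
  dset A (fun s : T => s = t) -> dset A (fun u : U => u = f t).
Proof.
move=> df dt.
have : dset A (fun u : U => exists s : T, s = t /\ u = f s).
  apply: dset_ex; apply: dset_and.
    apply: (dset_cmap (f := fun q : dprod U T => q.2) (P := fun s => s = t)) => //.
    exact: cmap_snd0.
  apply: (dset_cmap (f := fun q : dprod U T => (q.2, q.1) : dprod T U)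
    (P := fun r => r.2 = f r.1)) => //.
  by cmap_tac.
by apply: dset_ext => u; split=> [[s [-> ->]]|->] //; exists t.
Qed.

Lemma dpt_pair (T U : dtype) A (t : T) (u : U) :
  dset A (fun s : T => s = t) -> dset A (fun s : U => s = u) ->
  dset A (fun q : dprod T U => q = (t, u)).
Proof.
move=> dt du.
have := dset_and (dset_cmap (cmap_fst0 T U) dt) (dset_cmap (cmap_snd0 T U) du).
by apply: dset_ext => -[a b] /=; split=> [[-> ->]|[-> ->]].
Qed.

Lemma dpt_unique (T : dtype) A (P : T -> Prop) t : dset A P ->
  P t -> (forall s, P s -> s = t) -> dset A (fun s => s = t).
Proof. by move=> dP Pt uP; apply: dset_ext dP => s; split=> [/uP//|->]. Qed.

Lemma dpt_cut A (U : dM -> Prop) (p : M) : dset A U ->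
  (forall y, y < p -> U y) -> (forall y, p < y -> ~ U y) ->
  dset A (fun x : dM => x = p).
Proof.
move=> dU lU gU.
apply: (@dpt_unique dM A (fun x : dM => (forall y : dM, y < x -> U y) /\
  (forall y : dM, x < y -> ~ U y))) => //; first by dset_tac.
move=> s [ls gs]; apply/eqP; rewrite eq_le; apply/andP; split; rewrite leNgt; apply/negP => h.
  by have [h1 h2] := midf_lt h; exact: (gU _ h1 (ls _ h2)).
by have [h1 h2] := midf_lt h; exact: (gs _ h1 (lU _ h2)).
Qed.

Lemma dpt_op (A : set M) (f : M -> M) (x : M) : dfun A (f : dM -> dM) ->
  dset A (fun y : dM => y = x) -> dset A (fun y : dM => y = f x).
Proof. exact: dpt_fun. Qed.

Lemma dpt_half A (p q : M) : dset A (fun x : dM => x = p) ->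
  dset A (fun x : dM => x = q) -> dset A (fun x : dM => x = (p + q) / 2).
Proof.
move=> dp dq.
apply: (@dpt_unique dM A (fun x : dM => x + x = p + q :> M)).
- by apply: dset_eq; dfun_tac.
- by rewrite -splitr.
- by move=> s /= E; lra.
Qed.

Lemma dset_alt1 A (E : dM -> Prop) j : dset A E -> dset A (alt E j : dM -> Prop).
Proof.
move=> dE.
have H : dset A (fun q : dprod (dunit S A0) dM => alt E j q.2).
  apply: (@dset_alt _ _ _ _ (dunit S A0) A (fun _ => E)).
  exact: dset_cmap (cmap_snd0 _ _) dE.
apply: (@dset_comp _ _ _ _ _ _ _ (fun x : dM => (tt, x) : dprod (dunit S A0) dM) _ H).
apply: dfun_pair; last by dfun_tac.
by apply: dfun_cst; apply: dset_ext (dset_true _ _) => -[].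
Qed.

(** The points of [E] with the largest alternation number form a convex set, in which some point is
    fixed by a formula: the minimum if there is one, else a midpoint, an end moved by 1, or [0],
    according to which ends exist. *)
Lemma dpoint_M A (E : dM -> Prop) : dset A E -> (exists y, E y) ->
  exists2 y, E y & dset A (fun x : dM => x = y).
Proof.
move=> dE [y0 Ey0].
have [s sE] := dset_itv S_omin dE.
pose Q j := `[< exists y, E y /\ alt E j y >].
have [] := @ex_maxnP Q (size s).*2.+2.
- by exists 1%N; apply/asboolP; exists y0; split=> //; exact: alt1.
- move=> j /asboolP[y [_ yj]]; rewrite leqNgt; apply/negP => /ltnW h.
  exact: (alt_itv (y := y) sE) (alt_leq h yj).
move=> j /asboolP[c0 [Ec0 c0j]] jmax.
pose C (y : dM) := E y /\ alt E j y.
have dC : dset A C.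
  apply: dset_and => //.
  exact: dset_alt1.
have convC x y z : C x -> C z -> x <= y -> y <= z -> C y.
  move=> [Ex xj] [Ez zj] xy yz; split; last exact: alt_le zj.
  have nx : ~ alt E j.+1 x.
    by move=> H; have /jmax : Q j.+1 by [apply/asboolP; exists x]; rewrite ltnn.
  by apply/(alt_homog xy (alt_le yz zj) nx).
have Cc0 : C c0 by [].
have CE y : C y -> E y by case.
have [[m [Cm mmin]]|nomin] := pselect (exists m, C m /\ forall y, C y -> m <= y).
  exists m; first exact: CE.
  apply: (@dpt_unique dM A (fun x : dM => C x /\ forall y : dM, C y -> x <= y)) => //.
    by dset_tac.
  by move=> x [Cx xmin]; apply/eqP; rewrite eq_le xmin // mmin.
have getsup z0 : (forall y, C y -> y < z0) -> exists q,
    [/\ dset A (fun x : dM => x = q), forall y, c0 <= y -> y < q -> C y & forall y, q < y -> ~ C y].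
  move=> ub; have dU : dset A (fun y : dM => exists z : dM, C z /\ y <= z) by dset_tac.
  have [|||q [lq gq]] := dset_cut S_omin (y0 := c0) (z0 := z0) dU.
  - by move=> y z yz [w [Cw zw]]; exists w; split=> //; exact: le_trans zw.
  - by exists c0.
  - by move=> [z [/ub zz0]]; rewrite leNgt zz0.
  exists q; split; first exact: dpt_cut lq gq.
    by move=> y c0y /lq[z [Cz yz]]; exact: convC c0y yz.
  by move=> y /gq n Cy; apply: n; exists y.
(* Without a strict lower bound, all points to the left of [c0] belong to [C]. *)
have [[z0 lb]|nolb] := pselect (exists z0, forall y, C y -> z0 < y); last first.
  have unb y : y <= c0 -> C y.
    move=> yc0; apply/not_notP => nCy; apply: nolb; exists y => z Cz.
    by rewrite ltNge; apply/negP => zy; apply/nCy/(convC z _ c0).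
  have [[z0 ub]|noub] := pselect (exists z0, forall y, C y -> y < z0).
    have [q [dq lq gq]] := getsup z0 ub.
    have qc : c0 <= q by rewrite leNgt; apply/negP => /gq.
    exists (q - 1).
      apply: CE; case: (leP (q - 1) c0) => [/unb//|/ltW h].
      by apply: lq => //; rewrite ltrBlDr ltrDl.
    by apply: (dpt_op (f := fun x => x - 1)) => //; dfun_tac.
  exists 0; last exact: dpt_M0.
  apply: CE; case: (leP 0 c0) => [/unb//|/ltW c00].
  apply/not_notP => nC0; apply: noub; exists 0 => z Cz.
  by rewrite ltNge; apply/negP => h; exact/nC0/(convC c0 _ z).
have dU : dset A (fun y : dM => forall z : dM, C z -> y < z) by dset_tac.
have [|||p [lp gp]] := dset_cut S_omin (y0 := z0) (z0 := c0) dU.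
- by move=> y z yz H w /H; exact: le_lt_trans.
- by [].
- by move=> /(_ c0 Cc0); rewrite ltxx.
have dp := dpt_cut dU lp gp.
have nCp y : y <= p -> ~ C y.
  rewrite le_eqVlt => /orP[/eqP-> Cp|/lp H /H]; last by rewrite ltxx.
  apply: nomin; exists p; split=> // z Cz; rewrite leNgt; apply/negP => zp.
  by have := lp _ zp z Cz; rewrite ltxx.
have pC y : p < y -> y <= c0 -> C y.
  move=> py yc0; apply/not_notP => nCy; apply: (gp _ py) => z Cz.
  by rewrite ltNge; apply/negP => zy; apply/nCy/(convC z _ c0).
have pc0 : p < c0 by rewrite ltNge; apply/negP => /nCp.
(* The infimum [p] is not in [C]. Either [p + 1] serves, or [C] is bounded and the midpoint of its
   ends does. *)
have [Cp1|nCp1] := pselect (C (p + 1)).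
  exists (p + 1); first exact: CE.
  by apply: (dpt_op (f := fun x => x + 1)) => //; dfun_tac.
have [|q [dq lq gq]] := getsup (p + 1).
  move=> y Cy; rewrite ltNge; apply/negP => p1y; apply: nCp1.
  case: (leP (p + 1) c0) => [|/ltW] h; first by apply: pC; rewrite // ltrDl.
  exact: convC h p1y.
have pq : p < q.
  by apply: lt_le_trans pc0 _; rewrite leNgt; apply/negP => /gq.
exists ((p + q) / 2); last exact: dpt_half.
have [h1 h2] := midf_lt pq; apply: CE.
by case: (leP ((p + q) / 2) c0) => [|/ltW] h; [exact: pC|exact: lq].
Qed.

Lemma dpoint_pow A k (E : dpow dM k -> Prop) : dset A E -> (exists y, E y) ->
  exists2 y, E y & dset A (fun x : dpow dM k => x = y).
Proof.
elim: k E => [|k IH] E dE [y Ey].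
  by exists tt; [case: y Ey|apply: dset_ext (dset_true _ _) => -[]].
case: y Ey => y c Ec.
have [||y0 [c0 Ey0] dy0] := @dpoint_M A (fun y : dM => exists c : dpow dM k, E (y, c)).
- by apply: dset_ex; apply: dset_ext dE => -[].
- by exists y, c.
have [||c1 Ec1 dc1] := IH (fun c => E (y0, c)).
- apply: (dset_fiber (R := fun (y : dM) c => E (y, c))) => //.
  by apply: dset_ext dE => -[].
- by exists c0.
by exists (y0, c1) => //; exact: dpt_pair.
Qed.

Lemma dpoint (T : dtype) A (E : T -> Prop) : dset A E -> (exists y, E y) ->
  exists2 y, E y & dset A (fun x : T => x = y).
Proof.
move=> dE [y Ey].
have demb : dfun A (@emb _ _ _ _ T) by exact/dfun_cmap/cmap_emb.
have [||c [t [Et cE]] dc] := @dpoint_pow A (ddim T) (fun c => exists t : T, E t /\ c = emb t).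
- by dset_tac.
- by exists (emb y), y.
exists t => //.
apply: (@dpt_unique _ A (fun s : T => emb s = c)) => //; first by dset_tac.
by move=> s; rewrite cE => /emb_inj.
Qed.

(** For each [t] the fibre has a point definable over [A] and [t], so some [A]-definable [rho]
    singles it out; by compactness finitely many [rho] serve all [t], and [f] uses the first that
    works. *)
Lemma dchoice (T U : dtype) A (R : T -> U -> Prop) : small (A0 `|` A) ->
  dset A (fun q : dprod T U => R q.1 q.2) -> (forall t, exists u, R t u) ->
  exists f : T -> U, dfun A f /\ forall t, R t (f t).
Proof.
move=> sA dR Rex.
pose un (rho : T -> U -> Prop) (t : T) := exists u, (R t u /\ rho t u) /\
  forall u', R t u' /\ rho t u' -> u' = u.
have dun rho : dset A (fun q : dprod T U => rho q.1 q.2) -> dset A (un rho).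
  by move=> dr; rewrite /un; dset_tac.
have [||s [sF sC]] := @dcover _ _ _ _ S_sat T A [set un rho | rho in
    [set rho : T -> U -> Prop | dset A (fun q : dprod T U => rho q.1 q.2)]] sA.
- by move=> _ [rho dr <-]; exact: dun.
- move=> t.
  have [||u Ru du] := @dpoint U (A `|` range (denc t 0)) (R t).
  + apply: (dset_fiber (R := R)); last exact: dpt_addpar.
    by apply: dset_mono dR => x; left.
  + exact: Rex.
  have [rho [dr rE]] := dset_unfiber du.
  exists (un rho); first by exists rho.
  by exists u; split; [split=> //; apply/rE|move=> u' [_ /rE]].
have [Phi [dPhi PhiR PhiU PhiC]] : exists Phi : T -> U -> Prop,
   [/\ dset A (fun q : dprod T U => Phi q.1 q.2),
       forall t u, Phi t u -> R t u,
       forall t u u', Phi t u -> Phi t u' -> u = u' &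
       forall t P, P \in s -> P t -> exists u, Phi t u].
  elim: s sF {sC} => [|P s IH] sF.
    by exists (fun _ _ => False); split=> //; exact: dset_cst.
  have [|Phi [dPhi PhiR PhiU PhiC]] := IH.
    by move=> Q Qs; apply: sF; rewrite inE Qs orbT.
  have [rho dr rP] := sF P (mem_head _ _).
  have dP : dset A P by rewrite -rP; exact: dun.
  exists (fun t u => (P t /\ (R t u /\ rho t u)) \/ (~ P t /\ Phi t u)); split.
  - by dset_tac.
  - by move=> t u [[_ []]|[_ /PhiR]].
  - move=> t u u'; rewrite -rP.
    move=> [[Pt H]|[nP H]] [[Pt' H']|[nP' H']]; last exact: PhiU H H'.
    + by case: Pt => v [_ vU]; rewrite (vU _ H) (vU _ H').
    + by exfalso; exact: nP'.
    + by exfalso; exact: nP.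
  - move=> t Q Qs Qt; have [Pt|nPt] := pselect (P t).
      by move: (Pt); rewrite -{1}rP => -[u [H _]]; exists u; left.
    move: Qs; rewrite inE => /orP[/eqP QP|Qs]; first by rewrite QP in Qt.
    by have [u Hu] := PhiC t Q Qs Qt; exists u; right.
have ex t : exists u, Phi t u by have [P Ps Pt] := sC t; exact: PhiC Ps Pt.
have [f fP] := choice ex.
exists f; split; last by move=> t; exact/PhiR/fP.
apply: dset_ext dPhi => -[t u] /=; split; last by move=> ->; exact: fP.
by move=> H; exact: PhiU H (fP t).
Qed.

End DefinableChoice.

(** * Continuity of definable functions *)

Section PiecewiseContinuity.
Variables (L : language) (M : rcfType) (S : expansion L M) (A0 : set M).
Hypotheses (S_omin : o_minimal S) (S_sat : saturated S) (A00 : A0 0).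
Local Notation dtype := (dtype S A0).
Local Notation dM := (dM S A0).

Lemma altf_sorted (E : M -> Prop) x s : path <%R x s ->
  (forall z, z \in x :: s -> E z) ->
  (forall a b, a < b -> exists u, a < u < b /\ ~ E u) ->
  altf E true (size s).*2.+1 x.
Proof.
elim: s x => [|y s IH] x /= => [_ xE _|/andP[xy ys] xE thin].
  by exists x; split=> //; split=> // _; apply: xE; rewrite mem_head.
have [u [/andP[xu uy] nEu]] := thin x y xy.
exists x; split=> //; first by split=> // _; apply: xE; rewrite mem_head.
exists u; split=> //; first exact: ltW.
have := IH y ys _ thin; rewrite /= => H.
have [|z [yz Ez Hz]] := H; first by move=> z zs; apply: xE; rewrite inE zs orbT.
by exists z; split=> //; apply: le_trans yz; exact: ltW.
Qed.

(** Consecutive points of the list are separated by a point outside the set, so the list yields an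
    alternation of about twice its length. *)
Lemma thin_bound (T : dtype) A (E : T -> dM -> Prop) : small (A0 `|` A) ->
  dset A (fun q : dprod T dM => E q.1 q.2) ->
  (forall t a b, a < b -> exists u, a < u < b /\ ~ E t u) ->
  exists r, forall t (s : seq M), sorted <%R s -> (forall x, x \in s -> E t x) ->
    (size s < r)%N.
Proof.
move=> sA dE thin; have [r rP] := alt_bound S_omin S_sat sA dE.
exists r.+1 => t [//|x s] xs sE; rewrite ltnNge; apply/negP => /= rs.
apply: (rP t x); apply: (@alt_leq _ _ r (size s).*2.+1).
  by rewrite -addnn; apply: leqW; apply: leq_trans (leq_addr _ _); rewrite -ltnS.
by left; apply: altf_sorted => //; exact: thin.
Qed.

Lemma itv_points (a b : M) n : a < b -> exists s : seq M,
  [/\ sorted <%R s, size s = n & forall x, x \in s -> a < x < b].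
Proof.
move=> ab; elim: n a ab => [|n IH] a ab; first by exists [::].
have [am mb] := midf_lt ab; have [s [ss sn sP]] := IH _ mb.
exists (((a + b) / 2) :: s); split=> /=.
- case: s ss sP {sn} => //= y s -> /(_ y (mem_head _ _)) /andP[-> _] //.
- by rewrite sn.
- move=> x; rewrite inE => /orP[/eqP->|/sP/andP[mx ->]]; first by rewrite am mb.
  by rewrite (lt_trans am mx).
Qed.

Definition ctsat (f : M -> M) (u : M) := forall e, 0 < e -> exists d, 0 < d /\
  forall v, u - d < v -> v < u + d -> f u - e < f v /\ f v < f u + e.

Lemma dset_ctsat A (f : dM -> dM) : dfun A f -> dset A (ctsat f : dM -> Prop).
Proof.
move=> df; rewrite /ctsat.
have d0 := dpt_M0 S A0 A.
by apply: (dset_all (U := dM)); dset_tac.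
Qed.

(** [p] is the lower limit of [f] to the right of [c], the supremum of the values that [f]
    eventually exceeds. Since a definable condition eventually holds or eventually fails, [f] is
    eventually at most [p + e / 2], so the lower limit is a limit. *)
Lemma right_osc A (f : dM -> dM) (c b v e : M) : dfun A f -> c < b -> 0 < e ->
  (forall u, c < u < b -> - v <= f u <= v) ->
  exists2 c', c < c' < b & exists p, forall u, c < u < c' -> p - e < f u /\ f u < p + e.
Proof.
move=> df cb e0 fv.
pose B := A `|` range (denc (c : dM) 0).
have dfB : dfun B f by apply: dfun_mono df => x; left.
have dc : dset B (fun x : dM => x = c) by exact: dpt_addpar.
pose U (y : dM) := exists c' : dM, c < c' /\ forall u : dM, c < u -> u < c' -> y < f u.
have dU : dset B U by rewrite /U; dset_tac.
have [|||p [lp gp]] := dset_cut S_omin (y0 := - v - 1) (z0 := v + 1) dU.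
- move=> y z yz [c' [cc' H]]; exists c'; split=> // u cu uc'.
  exact: le_lt_trans yz (H u cu uc').
- exists b; split=> // u cu ub; have /andP[h _] := fv u (introT andP (conj cu ub)).
  by apply: lt_le_trans h; rewrite ltrBlDr ltrDl.
- move=> [c' [cc' H]]; have cm : c < Num.min c' b by rewrite lt_min cc' cb.
  have [h1 h2] := midf_lt cm; move: h2; rewrite lt_min => /andP[h2 h3].
  have /andP[_ h] := fv _ (introT andP (conj h1 h3)).
  have := H _ h1 h2; rewrite ltNge => /negP; apply.
  by apply: le_trans h _; rewrite lerDl.
have [c1 [cc1 H1]] : U (p - e) by apply: lp; rewrite ltrBlDr ltrDl.
have e2 : 0 < e / 2 by rewrite divr_gt0.
have dE : dset (B `|` range (denc (p + e / 2 : dM) 0)) (fun u : dM => p + e / 2 < f u).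
  have d1 : dset (B `|` range (denc (p + e / 2 : dM) 0)) (fun x : dM => x = p + e / 2).
    exact: dpt_addpar.
  have d2 : dfun (B `|` range (denc (p + e / 2 : dM) 0)) f by apply: dfun_mono dfB => x; left.
  by dset_tac.
have [c2 cc2 [H2|H2]] := dset_eventually S_omin c dE.
  exfalso; apply: (gp (p + e / 2)); first by rewrite ltrDl.
  by exists c2; split=> // u cu uc2; apply: H2; rewrite cu uc2.
have cm : c < Num.min b (Num.min c1 c2) by rewrite !lt_min cb cc1 cc2.
have [h1 h2] := midf_lt cm; move: h2; rewrite !lt_min => /and3P[h2 h3 h4].
exists ((c + Num.min b (Num.min c1 c2)) / 2); first by rewrite h1 h2.
exists p => u /andP[cu uc]; split; first exact: H1 cu (lt_trans uc h3).
have := H2 u; rewrite cu (lt_trans uc h4) => /(_ isT) /negP; rewrite -leNgt => h.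
by apply: le_lt_trans h _; rewrite ltrD2l; lra.
Qed.

(** A Baire argument in which counting replaces category: if a monotone definable family of sets
    exhausts an interval, one of them contains an interval, since otherwise the sizes of their
    finite subsets would be bounded, whereas any finite set of points lies in one member. It is
    applied to the sets where [f] is bounded by [v], then to the sets where the oscillation is at
    least [e]. *)
Lemma dfun_ctsat A (f : dM -> dM) (a : M) : small (A0 `|` A) -> dfun A f ->
  exists2 b, a < b & forall u, a < u < b -> ctsat f u.
Proof.
move=> sA df; have [b ab [//|nc]] := dset_eventually S_omin a (dset_ctsat df).
  by exists b.
exfalso.
pose B := A `|` range (denc ((a, b) : dprod dM dM) 0).
have sB : small (A0 `|` B) by exact: small_par.
have dfB : dfun B f by apply: dfun_mono df => x; left.
have dab : dset B (fun x : dprod dM dM => x = (a, b)) by exact: dpt_addpar.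
have da : dset B (fun x : dM => x = a).
  by apply: (dpt_fun (f := fun q : dprod dM dM => q.1 : dM) _ dab); dfun_tac.
have db : dset B (fun x : dM => x = b).
  by apply: (dpt_fun (f := fun q : dprod dM dM => q.2 : dM) _ dab); dfun_tac.
pose F (v u : dM) := (a < u /\ u < b) /\ (- v <= f u /\ f u <= v).
have dF : dset B (fun q : dprod dM dM => F q.1 q.2) by rewrite /F; dset_tac.
have [v [a1 [b1 [ab1 Fv]]]] : exists v a1 b1, a1 < b1 /\ forall u, a1 < u < b1 -> F v u.
  apply/not_notP => n.
  have [|r rP] := thin_bound sB dF.
    move=> v a1 b1 ab1; apply/not_notP => nu; apply: n; exists v, a1, b1; split=> // u h.
    by apply/not_notP => nF; apply: nu; exists u.
  have [s [ss sr sP]] := itv_points r ab.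
  (* The sum bounds [f] at all [r] points, more than a set without interior may contain. *)
  have := rP (\sum_(x <- s) `|f x|) s ss; rewrite sr ltnn => H.
  have : false; last by []; apply: H => x xs; have /andP[ax xb] := sP x xs.
  split; first by [].
  have : `|f x| <= \sum_(x <- s) `|f x|.
    by rewrite (big_rem x xs) /= lerDl sumr_ge0.
  by rewrite ler_norml => /andP[].
pose B1 := B `|` range (denc ((a1, b1) : dprod dM dM) 0).
have sB1 : small (A0 `|` B1) by exact: small_par.
have dfB1 : dfun B1 f by apply: dfun_mono dfB => x; left.
have dab1 : dset B1 (fun x : dprod dM dM => x = (a1, b1)) by exact: dpt_addpar.
have da1 : dset B1 (fun x : dM => x = a1).
  by apply: (dpt_fun (f := fun q : dprod dM dM => q.1 : dM) _ dab1); dfun_tac.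
have db1 : dset B1 (fun x : dM => x = b1).
  by apply: (dpt_fun (f := fun q : dprod dM dM => q.2 : dM) _ dab1); dfun_tac.
pose D (e u : dM) := (0 < e) /\ ((a1 < u /\ u < b1) /\ (forall d : dM, 0 < d ->
  exists u1 : dM, (u - d < u1 /\ u1 < u + d) /\ ~ (f u - e < f u1 /\ f u1 < f u + e))).
have dz := dpt_M0 S A0 B1.
have dD : dset B1 (fun q : dprod dM dM => D q.1 q.2) by rewrite /D; dset_tac.
have [|r rP] := thin_bound sB1 dD.
  move=> e c c' cc'; apply/not_notP => nu.
  have inD u : c < u < c' -> D e u.
    by move=> h; apply/not_notP => nD; apply: nu; exists u.
  have [h1 h2] := midf_lt cc'.
  have [e0 [[a1m mb1] _]] := inD _ (introT andP (conj h1 h2)).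
  pose m := (c + c') / 2.
  have mm : m < Num.min c' b1 by rewrite lt_min h2 mb1.
  have e2 : 0 < e / 2 by rewrite divr_gt0.
  (* Values within [e / 2] of a common [p] are within [e] of each other, against the definition of
     [D]. *)
  have [|c2 /andP[mc2 c2m] [p pP]] := right_osc (v := v) dfB1 mm e2.
    move=> u /andP[mu]; rewrite lt_min => /andP[_ ub1].
    have [_ [h h']] := Fv u (introT andP (conj (lt_trans a1m mu) ub1)).
    by rewrite h h'.
  move: c2m; rewrite lt_min => /andP[c2c' _].
  have [k1 k2] := midf_lt mc2; pose w := (m + c2) / 2.
  have [_ [_ Dw]] := inD w (introT andP (conj (lt_trans h1 k1) (lt_trans k2 c2c'))).
  have d0 : 0 < Num.min (w - m) (c2 - w) by rewrite lt_min !subr_gt0 k1 k2.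
  have [u1 [[l1 l2]]] := Dw _ d0; apply.
  have hu1 : m < u1 < c2.
    have h3 : Num.min (w - m) (c2 - w) <= w - m by rewrite ge_min lexx.
    have h4 : Num.min (w - m) (c2 - w) <= c2 - w by rewrite ge_min lexx orbT.
    by apply/andP; split; lra.
  have [q1 q2] := pP _ hu1; have [q3 q4] := pP w (introT andP (conj k1 k2)).
  by split; lra.
have [s [ss sr sP]] := itv_points r ab1.
have ex u : u \in s -> exists e, D e u.
  move=> us; have a1ub1 := sP u us; have [[au ub] _] := Fv u a1ub1.
  have := nc u (introT andP (conj au ub)) => n; apply/not_notP => ne; apply: n => e e0.
  apply/not_notP => nd; apply: ne; exists e; split=> //.
  case/andP: a1ub1 => -> ->; split=> // d d0; apply/not_notP => nu; apply: nd.
  exists d; split=> // w w1 w2; apply/not_notP => nw; apply: nu; by exists w.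
have [e0 eD] : exists e, forall u, u \in s -> D e u.
  elim: s {ss sr sP} ex => [|u s IH] ex; first by exists 1.
  have [|e1 e1P] := IH; first by move=> w ws; apply: ex; rewrite inE ws orbT.
  have [e2 e2P] := ex u (mem_head _ _).
  have mono e e' w : 0 < e' -> e' <= e -> D e w -> D e' w.
    move=> e'0 e'e [_ [h H]]; split=> //; split=> // d /H[w1 [hw nw]].
    exists w1; split=> // -[h1 h2]; apply: nw; split; lra.
  case: s e1P {IH ex} => [|w s] e1P.
    by exists e2 => w; rewrite mem_seq1 => /eqP->.
  have e10 : 0 < e1 by case: (e1P w (mem_head _ _)).
  have e20 : 0 < e2 by case: e2P.
  have m0 : 0 < Num.min e1 e2 by rewrite lt_min e10 e20.
  exists (Num.min e1 e2) => x; rewrite inE => /orP[/eqP->|/e1P Dx].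
    by apply: mono e2P; rewrite // ge_min lexx orbT.
  by apply: mono Dx; rewrite // ge_min lexx.
by have := rP e0 s ss eD; rewrite sr ltnn.
Qed.

End PiecewiseContinuity.

(** * Epsilon-nets and piercing *)

Section Nets.
Local Open Scope nat_scope.

(** A polynomial bound on the number of traces on finite lists of indices: the form of NIP suited to
    counting arguments. The list [L] may contain traces that do not occur, so that upper bounds are
    easily combined. *)
Definition trb (X U : Type) (R : X -> U -> Prop) (C d : nat) :=
  forall F : seq X, exists L : seq (seq bool), size L <= C * (size F).+1 ^ d /\
    forall u, [seq `[< R f u >] | f <- F] \in L.

Lemma trb_comp (X U X' U' : Type) (R : X -> U -> Prop) C d (f : X' -> X) (g : U' -> U) :
  trb R C d -> trb (fun x u => R (f x) (g u)) C d.
Proof.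
move=> tR F; have [L [sL HL]] := tR (map f F); exists L; rewrite size_map in sL.
by split=> // u; have := HL (g u); rewrite -map_comp.
Qed.

Lemma trb_not (X U : Type) (R : X -> U -> Prop) C d :
  trb R C d -> trb (fun x u => ~ R x u) C d.
Proof.
move=> tR F; have [L [sL HL]] := tR F; exists (map (map negb) L); rewrite size_map.
split=> // u; have := map_f (map negb) (HL u); rewrite -map_comp.
move=> H; rewrite (eq_map (g := negb \o (fun f => `[< R f u >]))) // => x /=.
by rewrite asbool_neg.
Qed.

Lemma bernoulli_nat e n : e ^ n.+1 + n.+1 * e ^ n <= e.+1 ^ n.+1.
Proof.
elim: n => [|n IH]; first by rewrite !expn1 expn0 addn1.
rewrite [e.+1 ^ _]expnS; apply: leq_trans (leq_mul (leqnn e.+1) IH).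
rewrite !expnS; move: (e ^ n) => p.
have -> : e.+1 * (e * p + n.+1 * p) = e * (e * p) + n.+2 * (e * p) + n.+1 * p by nia.
exact: leq_addr.
Qed.

(** [(1 - 1 / e) ^ e] is at most one half. *)
Lemma expn_pred_double e : 0 < e -> 2 * e.-1 ^ e <= e ^ e.
Proof.
case: e => // e _ /=; apply: leq_trans (bernoulli_nat e e).
rewrite mul2n -addnn leq_add2l expnS; exact: leq_mul.
Qed.

(** Samples will consist of [l] blocks of [b] points: a set of density [1 / e] misses a given block
    with probability at most [1 / (2 l)], while the traces on two samples number less than half of
    [2 ^ l]. With [l = 2 ^ u] and [b = e (u + 1)] this needs only that [2 ^ u] exceed a linear
    function of [u]. *)
Lemma net_sizes C d e : 0 < e -> exists l b,
  [/\ 0 < l, 2 * l * e.-1 ^ b <= e ^ b & 2 * (C * (2 * l * b).+1 ^ d) < 2 ^ l].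
Proof.
move=> e0.
pose k := 4 + d * 5 + d * e + C.
have hk : exists u, k * u.+1 + k < 2 ^ u.
  exists (4 * k + 4).
  have h n : n.+1 <= 2 ^ n by exact: ltn_expl.
  have -> : 2 ^ (4 * k + 4) = 16 * 2 ^ (4 * k) by rewrite expnD mulnC.
  have : (2 * k) ^ 2 <= (2 ^ (2 * k)) ^ 2.
    by rewrite leq_exp2r // (leq_trans _ (h _)).
  rewrite -expnM; have -> : 2 * k * 2 = 4 * k by rewrite mulnAC.
  move=> H; have kp : 0 < k by [].
  have -> : k * (4 * k + 4).+1 + k = 4 * k ^ 2 + 6 * k by ring.
  have : (2 * k) ^ 2 = 4 * k ^ 2 by ring.
  move=> E; rewrite E in H; have : k <= k ^ 2 by rewrite -{1}(expn1 k) leq_pexp2l.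
  move: (2 ^ (4 * k)) (k ^ 2) H => a c; lia.
have [u uP] := hk; exists (2 ^ u), (e * u.+1); split.
- by rewrite expn_gt0.
- rewrite !(mulnC e) !expnM ![(_ ^ u.+1) ^ e]expnAC -!expnS.
  rewrite -expnMn leq_exp2r // expn_pred_double //.
- have H1 : (2 * 2 ^ u * (e * u.+1)).+1 <= 2 ^ (2 * u + e + 2).
    have h n : n.+1 <= 2 ^ n by exact: ltn_expl.
    have : e * u.+1 < 2 ^ (e + u.+1).
      rewrite expnD; apply: ltn_mul; exact: h.
    move=> {}h; apply: (@leq_trans ((2 ^ u.+1 * (e * u.+1).+1))).
      have p0 : 0 < 2 ^ u.+1 by rewrite expn_gt0.
      rewrite -expnS; move: (2 ^ u.+1) (e * u.+1) p0 => a c; nia.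
    have -> : 2 * u + e + 2 = u.+1 + (e + u.+1) by lia.
    by rewrite expnD leq_mul2l h orbT.
  have H2 : (2 * 2 ^ u * (e * u.+1)).+1 ^ d <= 2 ^ ((2 * u + e + 2) * d).
    by rewrite expnM; case: d {k hk uP} => // d; rewrite leq_exp2r.
  have H3 : C < 2 ^ C by exact: ltn_expl.
  apply: (@leq_ltn_trans (2 ^ (1 + C + (2 * u + e + 2) * d))).
    by rewrite -addnA !expnD expn1 leq_mul2l /= leq_mul // ltnW.
  rewrite ltn_exp2l //; apply: leq_ltn_trans uP; rewrite /k; nia.
Qed.

Section DoubleSampling.
Variables (X U : Type) (R : X -> U -> Prop) (C d e l b : nat) (Y : finType) (h : Y -> X).
Hypothesis tR : trb R C d.
Let Q := {ffun 'I_b -> Y}.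
Let S u : pred Y := fun y => `[< R (h y) u >].
Let T u : pred Q := fun z => [exists j, S u (z j)].

Let sw (w : {ffun 'I_l -> bool}) (p : {ffun 'I_l -> Q} * {ffun 'I_l -> Q}) :
  {ffun 'I_l -> Q} * {ffun 'I_l -> Q} :=
  ([ffun i => if w i then p.2 i else p.1 i], [ffun i => if w i then p.1 i else p.2 i]).

Let swK w : involutive (sw w).
Proof.
by move=> [x y]; congr pair; apply/ffunP => i; rewrite !ffunE /=; case: (w i).
Qed.

(** Two samples [x], [y] are drawn, where [f x] is missed by every block of [x]. For each [x], at
    least half of the [y] have all their blocks hit by [f x]. Conversely, in a fixed pair, the trace
    of the set on all points of both samples tells for each [i] which of the two blocks [i] was
    missed, so the favourable ways of exchanging blocks number at most the traces. Averaging over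
    the [2 ^ l] exchanges compares the two counts. *)
Lemma double_sampling (f : {ffun 'I_l -> Q} -> U) :
  (forall x i, ~~ T (f x) (x i)) ->
  (forall x, 2 * l * #|[pred z | ~~ T (f x) z]| <= #|{: Q}|) -> 0 < #|{: Q}| ->
  2 ^ l <= 2 * (C * (2 * l * b).+1 ^ d).
Proof.
move=> fx fT Q0.
pose good (p : {ffun 'I_l -> Q} * {ffun 'I_l -> Q}) := [forall i, T (f p.1) (p.2 i)].
pose q := #|{: Q}|.
have cQ : #|{: {ffun 'I_l -> Q}}| = q ^ l by rewrite card_ffun card_ord.
have lower x : q ^ l <= 2 * \sum_y good (x, y).
  have : 2 * \sum_y ~~ good (x, y) <= q ^ l.
    case: (posnP l) => [l0|l0].
      rewrite big1 ?muln0 // => y _; apply/eqP; rewrite eqb0 negbK.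
      by apply/forallP => i; have := ltn_ord i; rewrite {2}l0.
    have cnt (i : 'I_l) : \sum_(y : {ffun 'I_l -> Q}) ~~ T (f x) (y i) =
        #|[pred z | ~~ T (f x) z]| * q ^ l.-1.
      pose F (j : 'I_l) (z : Q) : nat := if j == i then ~~ T (f x) z : nat else 1.
      have := bigA_distr_bigA F; rewrite /= => FE.
      transitivity (\sum_(y : {ffun 'I_l -> Q}) \prod_j F j (y j)).
        apply: eq_bigr => y _; rewrite (bigD1 i) //= {1}/F eqxx big1 ?muln1 // => j ji.
        by rewrite /F (negbTE ji).
      rewrite -FE (bigD1 i) //= {1}/F eqxx; congr (_ * _).
        by rewrite -sum1_card [RHS]big_mkcond /=; apply: eq_bigr => z _; rewrite inE /=; case: (T (f x) z).
      rewrite (eq_bigr (fun=> q)); last first.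
        by move=> j ji; rewrite /F (negbTE ji) sum1_card.
      by rewrite prod_nat_const cardC1 card_ord.
    apply: (@leq_trans (2 * (l * (#|[pred z | ~~ T (f x) z]| * q ^ l.-1)))).
      rewrite leq_mul2l /=.
      apply: (@leq_trans (\sum_(y : {ffun 'I_l -> Q}) \sum_(i < l) ~~ T (f x) (y i))).
        apply: leq_sum => y _; rewrite /good /=.
        case: (boolP [forall i, T (f x) (y i)]) => //= /forallPn[i ni].
        by rewrite (bigD1 i) //= ni.
      rewrite exchange_big /= (eq_bigr (fun=> #|[pred z | ~~ T (f x) z]| * q ^ l.-1)).
        by rewrite sum_nat_const card_ord.
      by move=> i _; exact: cnt.
    have -> : q ^ l = q * q ^ l.-1 by rewrite -expnS prednK.
    by rewrite !mulnA leq_mul2r fT orbT.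
  have : \sum_y good (x, y) + \sum_y ~~ good (x, y) = q ^ l.
    by rewrite -big_split /= -cQ -sum1_card; apply: eq_bigr => y _; case: (good _).
  by move: (\sum_y good _) (\sum_y ~~ _) => a c; lia.
have upper p : \sum_w good (sw w p) <= C * (2 * l * b).+1 ^ d.
  pose pts (x : {ffun 'I_l -> Q}) := [seq h (x ij.1 ij.2) | ij <- enum {: 'I_l * 'I_b}].
  have [L [sL LP]] := tR (pts p.1 ++ pts p.2).
  have sz x : size (pts x) = l * b by rewrite size_map -cardE card_prod !card_ord.
  rewrite size_cat !sz addnn -mul2n mulnA in sL.
  apply: leq_trans sL.
  pose mk (w : {ffun 'I_l -> bool}) :=
    [seq `[< R z (f (sw w p).1) >] | z <- pts p.1 ++ pts p.2].
  (* Equal traces force equal exchanges, because in each favourable pair block [i] of the first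
     sample is missed and block [i] of the second is hit. *)
  have inj : {in [pred w | good (sw w p)] &, injective mk}.
    move=> w w' gw gw' E; apply/ffunP => i.
    have eqS x ij : (x = p.1 \/ x = p.2) ->
        S (f (sw w p).1) (x ij.1 ij.2) = S (f (sw w' p).1) (x ij.1 ij.2).
      move: E; rewrite /mk !map_cat => /eqP; rewrite eqseq_cat ?size_map //.
      move=> /andP[/eqP E1 /eqP E2] xp.
      have {E1 E2} : [seq `[< R z (f (sw w p).1) >] | z <- pts x] =
                     [seq `[< R z (f (sw w' p).1) >] | z <- pts x] by case: xp => ->.
      rewrite -!map_comp => /eq_in_map H; 
      by apply: H; rewrite -enumT mem_enum.
    have eqT x : (x = p.1 \/ x = p.2) -> T (f (sw w p).1) (x i) = T (f (sw w' p).1) (x i).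
      by move=> xp; apply: eq_existsb => j; exact: (eqS x (i, j)).
    have /forallP/(_ i) := gw; have /forallP/(_ i) := gw'.
    have := fx (sw w p).1 i; have := fx (sw w' p).1 i; rewrite /sw /= !ffunE.
    have := eqT p.1 (or_introl erefl); have := eqT p.2 (or_intror erefl).
    rewrite /sw /=; case: (w i); case: (w' i) => // -> -> /negbTE -> //.
  have -> : \sum_w good (sw w p) = #|[pred w | good (sw w p)]|.
    by rewrite -sum1_card [RHS]big_mkcond; apply: eq_bigr => w _; rewrite inE; case: (good _).
  rewrite cardE -(size_map mk); apply: uniq_leq_size.
    rewrite map_inj_in_uniq ?enum_uniq // => w w'; rewrite !mem_enum; exact: inj.
  by move=> m /mapP[w _ ->]; exact: LP.
have total : \sum_(p : {ffun 'I_l -> Q} * {ffun 'I_l -> Q}) good p * 2 ^ l =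
    \sum_(p : {ffun 'I_l -> Q} * {ffun 'I_l -> Q}) \sum_w good (sw w p).
  transitivity (\sum_(w : {ffun 'I_l -> bool})
      \sum_(p : {ffun 'I_l -> Q} * {ffun 'I_l -> Q}) good p).
    by rewrite sum_nat_const card_ffun card_bool card_ord -big_distrl mulnC.
  rewrite [RHS]exchange_big /=; apply: eq_bigr => w _.
  by rewrite (reindex_inj (inv_inj (swK w))).
have low : q ^ l * q ^ l <= 2 * \sum_(p : {ffun 'I_l -> Q} * {ffun 'I_l -> Q}) good p.
  have -> : \sum_(p : {ffun 'I_l -> Q} * {ffun 'I_l -> Q}) good p =
      \sum_x \sum_y good (x, y).
    by rewrite pair_bigA; apply: eq_bigr => -[].
  rewrite big_distrr /= -{1}cQ -sum_nat_const; exact: leq_sum.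
have up : \sum_(p : {ffun 'I_l -> Q} * {ffun 'I_l -> Q}) \sum_w good (sw w p) <=
    q ^ l * q ^ l * (C * (2 * l * b).+1 ^ d).
  by rewrite -{1 2}cQ -card_prod -sum_nat_const; apply: leq_sum => p _; exact: upper.
rewrite -total -big_distrl /= in up.
have qq : 0 < q ^ l * q ^ l by rewrite muln_gt0 expn_gt0 Q0.
rewrite -(leq_pmul2l qq).
move: low up; set s := \sum_p _; move: (q ^ l * q ^ l) (C * _ ^ d) (2 ^ l) => a c t; nia.
Qed.

End DoubleSampling.

(** If every sample missed some heavy set, a choice of such sets would contradict double sampling.
    The size [l * b] depends on [C], [d] and [e] only. *)
Lemma net_exists C d e : 0 < e -> exists N, forall (X U : Type) (R : X -> U -> Prop),
  trb R C d -> forall (Y : finType) (h : Y -> X), 0 < #|Y| ->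
  exists Z : seq Y, size Z <= N /\ forall u,
    #|Y| <= e * #|[pred y | `[< R (h y) u >]]| -> has (fun y => `[< R (h y) u >]) Z.
Proof.
move=> e0; have [l [b [l0 lb lt]]] := net_sizes C d e0.
exists (l * b) => X U R tR Y h Y0; apply/not_notP => nex.
pose Q := {ffun 'I_b -> Y}.
have avoid (x : {ffun 'I_l -> Q}) : exists u, #|Y| <= e * #|[pred y | `[< R (h y) u >]]| /\
    forall i, ~~ [exists j, `[< R (h (x i j)) u >]].
  apply/not_notP => nu; apply: nex.
  exists [seq x ij.1 ij.2 | ij <- enum {: 'I_l * 'I_b}]; split.
    by rewrite size_map -cardE card_prod !card_ord.
  move=> u bigu; rewrite has_map; apply/not_notP => /negP/hasPn nh.
  apply: nu; exists u; split=> // i; apply/negP => /existsP[j]; apply/negP.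
  by apply: (nh (i, j)); rewrite mem_enum.
have [f fP] := choice avoid.
suff : 2 ^ l <= 2 * (C * (2 * l * b).+1 ^ d) by rewrite leqNgt lt.
apply: (@double_sampling X U R C d l b Y h tR f) => [x i|x|]; first by case: (fP x).
  have [big _] := fP x.
  have -> : #|[pred z : Q | ~~ [exists j, `[< R (h (z j)) (f x) >]]]| =
      (#|Y| - #|[pred y | `[< R (h y) (f x) >]]|) ^ b.
    have := @card_ffun_on 'I_b Y [pred y | ~~ `[< R (h y) (f x) >]].
    have := cardC [pred y | `[< R (h y) (f x) >]] => cC.
    rewrite -cC addKn card_ord => <-; apply: eq_card => z; rewrite !inE.
    by apply/existsPn/ffun_onP => H' j; have := H' j; rewrite inE.
  rewrite card_ffun card_ord.
  have : e * (#|Y| - #|[pred y | `[< R (h y) (f x) >]]|) <= e.-1 * #|Y|.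
    rewrite mulnBr leq_subLR; apply: leq_trans (leq_add big (leqnn _)).
    by rewrite -mulSn prednK.
  have mono m n : m <= n -> m ^ b <= n ^ b by case: (b) => // b' mn; rewrite leq_exp2r.
  set a := _ - _ => /mono; rewrite !expnMn => H1.
  have eb : 0 < e ^ b by rewrite expn_gt0 e0.
  rewrite -(leq_pmul2l eb).
  apply: (@leq_trans (2 * l * (e.-1 ^ b * #|Y| ^ b))).
    by rewrite mulnCA leq_mul2l H1 orbT.
  by rewrite mulnA leq_mul2r lb orbT.
by rewrite card_ffun expn_gt0 Y0.
Qed.

(** Multiplicative weights: starting from equal weights, repeatedly take the point supplied for the
    current weights and halve the weight of each set containing it. The total decreases by the
    factor [1 - 1 / (2 e)] each time, whereas a set rarely hit would keep too much weight. *)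
Lemma mult_weights (F : finType) (X : Type) (R : F -> X -> Prop) e : 0 < e -> 0 < #|F| ->
  (forall w : F -> nat, 0 < \sum_c w c ->
     exists x, \sum_c w c <= e * \sum_(c | `[< R c x >]) w c) ->
  exists xs : seq X, 0 < size xs /\
    forall c, size xs <= 4 * e * count (fun x => `[< R c x >]) xs.
Proof.
(* [n = 4 * e * m], with [m] exceeding the number of sets: in [n] steps the total shrinks by
   [2 ^ (2 * m)], of which the number of sets takes back less than [2 ^ m], so each set is hit at
   least [m] times. *)
move=> e0 F0 H; pose E := 2 * e; pose m := #|F|.+1; pose n := E * (2 * m).
have n0 : 0 < n by rewrite /n /E !muln_gt0 e0.
(* The factor [2 ^ n] keeps the halved weights integral. *)
pose w (xs : seq X) c := 2 ^ (n - count (fun x => `[< R c x >]) xs).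
have wp xs : 0 < \sum_c w xs c.
  have [c _] := card_gt0P F0; rewrite (bigD1 c) //= addn_gt0; apply/orP; left.
  by rewrite expn_gt0.
have step k : k <= n -> exists xs : seq X, size xs = k /\
    E ^ k * \sum_c w xs c <= E.-1 ^ k * (#|F| * 2 ^ n).
  elim: k => [|k IH] kn.
    exists [::]; split=> //; rewrite !expn0 !mul1n (eq_bigr (fun=> 2 ^ n)).
      by rewrite sum_nat_const.
    by move=> c _; rewrite /w subn0.
  have [xs [sxs Hxs]] := IH (ltnW kn).
  have [x xP] := H _ (wp xs).
  exists (x :: xs); split; first by rewrite /= sxs.
  have E1 : 2 * \sum_c w (x :: xs) c + \sum_(c | `[< R c x >]) w xs c = 2 * \sum_c w xs c.
    rewrite [X in _ + X]big_mkcond !big_distrr -big_split; apply: eq_bigr => c _ /=.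
    rewrite /w /=; case: asboolP => _; last by rewrite add0n addn0.
    have cn : count (fun x => `[< R c x >]) xs < n.
      by apply: leq_ltn_trans (count_size _ _) _; rewrite sxs.
    by rewrite add1n subnS -expnS prednK ?subn_gt0 // mul2n addnn.
  have E2 : E * \sum_c w (x :: xs) c <= E.-1 * \sum_c w xs c.
    rewrite /E; move: E1 xP; case: (e) e0 => // e' _.
    move: (\sum_c w (x :: xs) c) (\sum_(c | _) _) (\sum_c w xs c) => a b c; nia.
  rewrite expnSr -mulnA; apply: leq_trans (leq_mul (leqnn _) E2) _.
  by rewrite mulnCA expnS -mulnA leq_mul2l Hxs orbT.
have [xs [sxs Hxs]] := step n (leqnn n).
exists xs; rewrite sxs; split=> // c.
have E1 : 1 < E by rewrite /E; case: (e) e0 => // e' _; rewrite mulnS.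
have H1 : 2 ^ (2 * m) * E.-1 ^ n <= E ^ n.
  rewrite /n [E.-1 ^ _]expnM [E ^ _]expnM -expnMn leq_exp2r ?expn_pred_double //.
  exact: ltnW.
have H2 : E ^ n * w xs c <= E.-1 ^ n * (#|F| * 2 ^ n).
  apply: leq_trans Hxs; rewrite leq_mul2l; apply/orP; right.
  by rewrite (bigD1 c) //= leq_addr.
have H3 : 2 ^ (2 * m) * w xs c <= #|F| * 2 ^ n.
  have p0 : 0 < E.-1 ^ n by rewrite expn_gt0 -subn1 subn_gt0 E1.
  rewrite -(leq_pmul2l p0) mulnA (mulnC (E.-1 ^ n)).
  by apply: leq_trans H2; rewrite leq_mul2r H1 orbT.
have H4 : 2 ^ (2 * m) * w xs c < 2 ^ (m + n).
  apply: leq_ltn_trans H3 _; rewrite expnD ltn_mul2r expn_gt0 /=.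
  by apply: (@ltn_trans (2 ^ #|F|)); [exact: ltn_expl|rewrite ltn_exp2l].
rewrite /w -expnD ltn_exp2l // in H4.
set ct := count _ _ in H4 *.
have : m <= ct by lia.
by rewrite /n /E => mc; apply: leq_trans (leq_mul (leqnn (4 * e)) mc); lia.
Qed.

(** The list given by multiplicative weights may be long, but each set meets it in a fixed
    proportion, so a net of its indices suffices, of a size independent of [F]. *)
Lemma pierce C d e : 0 < e -> exists K, forall (F : finType) (X : Type) (R : F -> X -> Prop),
  trb (fun x c => R c x) C d ->
  (forall w : F -> nat, 0 < \sum_c w c ->
     exists x, \sum_c w c <= e * \sum_(c | `[< R c x >]) w c) ->
  exists xs : seq X, size xs <= K /\ forall c, has (fun x => `[< R c x >]) xs.
Proof.
move=> e0; have e40 : 0 < 4 * e by rewrite muln_gt0.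
have [K KP] := net_exists C d e40.
exists K => F X R tR H; case: (posnP #|F|) => [F0|F0].
  by exists [::]; split=> // c; have := card0_eq F0 c.
have [xs [xs0 xsP]] := mult_weights e0 F0 H.
have [|Z [sZ ZP]] := KP _ _ _ tR 'I_(size xs) (tnth (in_tuple xs)).
  by rewrite card_ord.
exists [seq tnth (in_tuple xs) i | i <- Z]; rewrite size_map; split=> // c.
rewrite has_map; apply: ZP; rewrite card_ord; apply: leq_trans (xsP c) _.
rewrite leq_mul2l; apply/orP; right.
rewrite -sum1_count -[X in \sum_(i <- X | _) _](in_tupleE xs) /=.
rewrite -[X in \sum_(i <- X | _) _]/(val (in_tuple xs)) big_tuple.
by rewrite -sum1_card; apply: eq_leq; apply: eq_bigl => i; rewrite inE.
Qed.

(** For given weights, a net for the complements is a list of at most [N0] sets. A point common to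
    these lies in sets of more than half the total weight: otherwise the sets avoiding it would be
    heavy, and the net would contain one of them. *)
Lemma comb C d C' d' : exists N0 K, forall (F : finType) (X : Type) (R : F -> X -> Prop),
  trb (fun x c => R c x) C d -> trb R C' d' ->
  (forall s : seq F, size s <= N0 -> exists x, all (fun c => `[< R c x >]) s) ->
  exists xs : seq X, size xs <= K /\ forall c, has (fun x => `[< R c x >]) xs.
Proof.
have [K KP] := pierce C d (isT : 0 < 2).
have [N0 NP] := net_exists C' d' (isT : 0 < 2).
exists N0, K => F X R tR tR' H; apply: KP => // w wp.
(* Weights are realized by multiplicities: [Y] has [w c] copies of [c]. *)
pose Y := {c : F & 'I_(w c)}.
have cY (P : pred F) : #|[pred y : Y | P (tag y)]| = \sum_(c | P c) w c.
  have := sig_big_dep (op := addn) P (fun c (j : 'I_(w c)) => true) (fun _ _ => 1) => /= E.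
  rewrite -sum1_card; transitivity (\sum_(c | P c) \sum_(j : 'I_(w c)) 1).
    by rewrite E; apply: eq_bigl => y; rewrite inE andbT.
  by apply: eq_bigr => c _; rewrite sum1_card card_ord.
have cT : #|{: Y}| = \sum_c w c.
  by rewrite -(cY predT); apply: eq_card => y.
have [|Z [sZ ZP]] := NP _ _ _ (trb_not tR') Y tag; first by rewrite cT.
have [|x xP] := H [seq tag z | z <- Z]; first by rewrite size_map.
exists x; rewrite -cT -cY.
have := cardC [pred y : Y | `[< R (tag y) x >]].
have : ~~ (#|{: Y}| <= 2 * #|[pred y : Y | `[< ~ R (tag y) x >]]|).
  apply/negP => /ZP /hasP[z zZ /asboolP nR]; move/allP: xP => /(_ (tag z)).
  by rewrite map_f // => /(_ isT) /asboolP.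
have -> : #|[pred y : Y | `[< ~ R (tag y) x >]]| = #|[predC [pred y : Y | `[< R (tag y) x >]]]|.
  by apply: eq_card => y; rewrite !inE asbool_neg.
rewrite -ltnNge; move: #|_| #|_| #|_| => a b c; lia.
Qed.

End Nets.

(** * Traces of definable families *)

Section TraceBounds.
Local Open Scope nat_scope.
Variables (L : language) (M : rcfType) (S : expansion L M) (A0 : set M).
Hypotheses (S_omin : o_minimal S) (S_sat : saturated S) (A00 : A0 0%R).
Local Notation dtype := (dtype S A0).
Local Notation dM := (dM S A0).

Lemma trb_le (X U : Type) (R : X -> U -> Prop) C d C' d' :
  C <= C' -> d <= d' -> trb R C d -> trb R C' d'.
Proof.
move=> CC dd tR F; have [B [sB HB]] := tR F; exists B; split=> //.
by apply: leq_trans sB _; apply: leq_mul => //; rewrite leq_pexp2l.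
Qed.

Lemma trb_ext (X U : Type) (R R' : X -> U -> Prop) C d :
  (forall x u, R x u <-> R' x u) -> trb R C d -> trb R' C d.
Proof.
move=> RR tR F; have [B [sB HB]] := tR F; exists B; split=> // u.
have := HB u; rewrite (eq_map (g := fun f => `[< R' f u >])) // => x.
exact/asbool_equiv_eq/RR.
Qed.

(** Upward closed subsets of a line are nested, so a finite family has a least member: one with the
    fewest members inside it. *)
Lemma upset_min (I : finType) (P : pred I) (V : I -> M -> Prop) i0 :
  (forall i y z, (y <= z)%R -> V i y -> V i z) -> P i0 ->
  exists i, P i /\ forall i', P i' -> forall y, V i y -> V i' y.
Proof.
move=> Vup Pi0.
case: (arg_minnP (fun p => #|[pred x | `[< forall y, V x y -> V p y >]]|) Pi0) => p Pp pmin.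
exists p; split=> // p' Pp'; apply/not_notP => nV.
have {}nV : exists y, V p y /\ ~ V p' y.
  by apply/not_notP => H; apply: nV => y Vy; apply/not_notP => n; apply: H; exists y.
have [y [Vpy nVy]] := nV.
have sub z : V p' z -> V p z.
  move=> Vz; case: (leP y z) => yz; first exact: Vup Vpy.
  by case: nVy; apply: Vup Vz; exact: ltW.
have := pmin p' Pp'; rewrite leqNgt => /negP; apply; apply: proper_card.
apply/fintype.properP; split.
  by apply/fintype.subsetP => x /asboolP H; apply/asboolP => z /H /sub.
by exists p; [apply/asboolP|apply/asboolP => /(_ y Vpy)].
Qed.

(** Write the parameter as [(t, c)]. Among the upward closed sets given by the alternation numbers
    of the members of [F] over [c], take the least one containing [t]. Between its left end and [t]
    all memberships are constant, so the trace at [(t, c)] is read off at that end: it is the trace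
    of [c] for one of the families [Rs j], with one extra index from [F]. Hence each coordinate
    raises the exponent by one. *)
Lemma nip_pow k (T : dtype) A (R : T -> dpow dM k -> Prop) : small (A0 `|` A) ->
  dset A (fun q : dprod T (dpow dM k) => R q.1 q.2) -> exists C d, trb R C d.
Proof.
move=> sA; elim: k T R => [|k IH] T R dR.
  exists 1, 0 => F; exists [:: [seq `[< R f tt >] | f <- F]]; split=> //.
  by case; rewrite mem_head.
pose E (q : dprod T (dpow dM k)) (t : dM) := R q.1 (t, q.2).
have dE : dset A (fun q : dprod (dprod T (dpow dM k)) dM => E q.1 q.2).
  apply: (dset_cmap (f := fun p : dprod (dprod T (dpow dM k)) dM =>
    (p.1.1, (p.2, p.1.2)) : dprod T (dprod dM (dpow dM k))) _ dR).
  by cmap_tac.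
have [r rP] := alt_bound S_omin S_sat sA dE.
pose U j (q : dprod T (dpow dM k)) (y : dM) := ~ alt (E q) j y.
have dU j : dset A (fun q : dprod (dprod T (dpow dM k)) dM => U j q.1 q.2).
  exact/dset_not/dset_alt.
(* [E] holds on an initial part of the upward closed set attached to [ff.2]; this reads its value at
   the left end without assuming that the end belongs to the set. *)
pose Rs j (ff : dprod T T) (c : dpow dM k) := exists t1 : dM, U j (ff.2, c) t1 /\
  forall t' : dM, (t' <= t1)%R -> U j (ff.2, c) t' -> E (ff.1, c) t'.
have dRs j : dset A (fun q : dprod (dprod T T) (dpow dM k) => Rs j q.1 q.2).
  have dUj := dU j; rewrite /Rs; dset_tac.
have [C [d CdP]] : exists C d, forall j, j < r.+1 -> trb (Rs j) C d.
  elim: r.+1 => [|n [C [d IHn]]]; first by exists 0, 0.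
  have [C' [d' H]] := IH _ _ (dRs n); exists (C + C'), (d + d') => j; rewrite ltnS leq_eqVlt.
  move=> /orP[/eqP->|/IHn h]; first exact: trb_le (leq_addl _ _) (leq_addl _ _) H.
  exact: trb_le (leq_addr _ _) (leq_addr _ _) h.
exists (r.+1 * C).+1, d.+1 => -[|x0 F'].
  by exists [:: [::]]; split=> //=; rewrite exp1n muln1.
set F := x0 :: F'; pose m := size F.
have ex (p : 'I_r.+1 * 'I_m) : exists g : seq (seq bool), size g <= C * m.+1 ^ d /\
    forall c, [seq `[< Rs p.1 (f, nth x0 F p.2) c >] | f <- F] \in g.
  have [B [sB HB]] := CdP p.1 (ltn_ord _) [seq (f, nth x0 F p.2) | f <- F].
  exists B; rewrite size_map in sB; split=> // c; have := HB c.
  by rewrite -map_comp.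
have [g gP] := choice ex.
exists (flatten [seq g p | p <- enum {: 'I_r.+1 * 'I_m}]); split.
  rewrite size_flatten sumnE 2!big_map.
  apply: (@leq_trans (\sum_(p <- enum {: 'I_r.+1 * 'I_m}) C * m.+1 ^ d)).
    by apply: leq_sum => p _; case: (gP p).
  rewrite big_const_seq count_predT -cardE card_prod !card_ord iter_addn_0.
  rewrite expnS mulnC -!mulnA [m * _]mulnCA mulnA.
  apply: (@leq_trans (r.+1 * C * (m.+1 * m.+1 ^ d))).
    by rewrite leq_mul2l; apply/orP; right; rewrite leq_mul2r leqnSn orbT.
  by rewrite leq_mul2r leqnSn orbT.
move=> [t c].
have m0 : 0 < m by [].
pose V (p : 'I_r.+1 * 'I_m) (y : M) := U p.1 (nth x0 F p.2, c) y.
have Vup p y z : (y <= z)%R -> V p y -> V p z by move=> yz nV /(alt_le yz).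
have [|[j i] [/asboolP Vt Vmin]] :=
    @upset_min _ [pred p | `[< V p t >]] V (ord_max, Ordinal m0) Vup.
  by apply/asboolP; exact: rP.
suff -> : [seq `[< R f (t, c) >] | f <- F] =
    [seq `[< Rs j (f, nth x0 F i) c >] | f <- F].
  apply/flattenP; exists (g (j, i)); last by case: (gP (j, i)).
  by apply: map_f; rewrite mem_enum.
apply: (@eq_from_nth _ false); rewrite !size_map // => l lm.
rewrite !(nth_map x0) //; set f := nth x0 F l.
have hom t' : (t' <= t)%R -> V (j, i) t' -> (E (f, c) t' <-> E (f, c) t).
  move=> t't Vt'.
  have [||j' /asboolP aj' j'max] := @ex_maxnP (fun j => `[< alt (E (f, c)) j t >]) r.
  - by exists 1; apply/asboolP; exact: alt1.
  - move=> n /asboolP an; rewrite leqNgt; apply/negP => rn; apply: (rP (f, c) t).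
    by apply: alt_leq an; exact: ltnW.
  have nj' : ~ alt (E (f, c)) j'.+1 t.
    by move/asboolP/j'max; rewrite ltnn.
  have j'r : j'.+1 < r.+1.
    rewrite ltnS ltnNge; apply/negP => rj; apply: (rP (f, c) t); exact: alt_leq aj'.
  apply: alt_homog t't aj' _.
  exact: (Vmin (Ordinal j'r, Ordinal lm) (introT (asboolP _) nj') t' Vt').
apply: asbool_equiv_eq; split.
  move=> Rt; exists t; split=> // t' t't Vt'; exact/(hom t' t't Vt').
move=> [t1 [Vt1 H]].
case: (leP t t1) => tt1; first exact: (H t tt1 Vt).
by apply/(hom t1 (ltW tt1) Vt1); exact: H.
Qed.

Lemma nip (T U : dtype) A (R : T -> U -> Prop) : small (A0 `|` A) ->
  dset A (fun q : dprod T U => R q.1 q.2) -> exists C d, trb R C d.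
Proof.
move=> sA dR.
have demb : dfun A (@emb _ _ _ _ U) by exact/dfun_cmap/cmap_emb.
have [|C [d H]] := @nip_pow (ddim U) T A (fun t c => exists u : U, c = emb u /\ R t u) sA.
  by dset_tac.
exists C, d; apply: trb_ext (trb_comp id (@emb _ _ _ _ U) H) => t u; split.
  by move=> [v [/emb_inj ->]].
by move=> Rtu; exists u.
Qed.

End TraceBounds.

(** * Invariant ultrafilters *)

Section InvariantFilters.
Variables (L : language) (M : rcfType) (S : expansion L M) (A0 : set M).
Hypotheses (S_omin : o_minimal S) (S_sat : saturated S) (A00 : A0 0).
Variable A : set M.
Hypothesis sA : small (A0 `|` A).
Local Notation dtype := (dtype S A0).
Local Notation dM := (dM S A0).

Lemma sub_small (B C : set M) : small C -> B `<=` C -> small B.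
Proof.
move=> [CM nMC] /subset_card_le BC; split; first exact: card_le_trans BC CM.
by move=> MB; apply: nMC; exact: card_le_trans MB BC.
Qed.

Definition dall (T : dtype) (P : T -> Prop) := dset [set: M] P.

Lemma dset_dall (T : dtype) B (P : T -> Prop) : dset B P -> dall P.
Proof. by apply: dset_mono. Qed.

Lemma dall_par (T : dtype) (P : T -> Prop) : dall P ->
  exists m (p : dvec S A0 m), dset (range (denc p 0)) P.
Proof.
move=> [m [p [phi [pA PE]]]]; exists m, p, m, p, phi; split=> // i.
by right; exists i.
Qed.

Lemma dall_fiber (T : dtype) (P : T -> Prop) : dall P ->
  exists m (p : dvec S A0 m) (R : dvec S A0 m -> T -> Prop),
    dset A (fun q : dprod (dvec S A0 m) T => R q.1 q.2) /\ forall t, P t <-> R p t.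
Proof.
move=> /dall_par[m [p dP]].
have [|R RP] := @dset_unfiber _ _ _ _ A00 _ _ A p P; last by exists m, p, R.
by apply: dset_mono dP => x; right.
Qed.

Lemma dall_sec (T U : dtype) (R : T -> U -> Prop) t :
  dset A (fun q : dprod T U => R q.1 q.2) -> dall (R t).
Proof.
move=> dR; apply: (dset_fiber (t := t)); first exact: dset_dall dR.
by apply: (@dset_mono _ _ _ _ T (A `|` range (denc t 0))); [|exact: dpt_addpar].
Qed.

(** A filter of sets definable with arbitrary parameters, that is, a partial global type. *)
Record dfilter (T : dtype) (F : (T -> Prop) -> Prop) : Prop := DFilter {
  dfilter_def : forall P, F P -> dall P;
  dfilterS : forall P Q : T -> Prop, F P -> dall Q -> (forall t, P t -> Q t) -> F Q;
  dfilterI : forall P Q : T -> Prop, F P -> F Q -> F (fun t => P t /\ Q t);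
  dfilterT : F (fun _ => True);
  dfilter_ex : forall P : T -> Prop, F P -> exists t, P t }.

(** Invariance under automorphisms fixing [A], expressed by types: whether a fibre belongs to [F]
    depends only on the type of its parameter. *)
Definition invariant_filter (T : dtype) (F : (T -> Prop) -> Prop) :=
  forall (D : dtype) (R : D -> T -> Prop), dset A (fun q : dprod D T => R q.1 q.2) ->
    forall d d', eqtp A d d' -> F (R d) -> F (R d').

Definition ultra (T : dtype) (F : (T -> Prop) -> Prop) :=
  forall P, dall P -> F P \/ F (fun t => ~ P t).

Section Step.
Variables (k : nat) (F : (dprod dM (dpow dM k) -> Prop) -> Prop).
Hypotheses (fF : dfilter F) (iF : invariant_filter F).
Local Notation T := (dpow dM k).
Variable q : (T -> Prop) -> Prop.
Hypotheses (fq : dfilter q) (iq : invariant_filter q) (uq : ultra q).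
Hypothesis qF : forall P, F P -> q (fun x => exists y, P (y, x)).

(** A fibrewise upward closed set is good if it meets every member of [F] over [q]-almost every
    point. Adding all good sets to [F] pushes the new coordinate as far to the right as [F]
    permits. *)
Let good (U : dprod dM T -> Prop) := [/\ dall U,
  forall x y z, y <= z -> U (y, x) -> U (z, x) &
  forall P, F P -> q (fun x => exists y, P (y, x) /\ U (y, x))].

Let q1 (E : dprod dM T -> Prop) := dall E /\ exists P U, [/\ F P, good U &
  q (fun x => forall y, P (y, x) -> U (y, x) -> E (y, x))].

Let dall_pair (E : dprod dM T -> Prop) : dall E ->
  dset setT (fun p : dprod T dM => E (p.2, p.1)).
Proof.
by apply: (dset_cmap (f := fun p : dprod T dM => (p.2, p.1) : dprod dM T)); cmap_tac.
Qed.

Let d_all (P U E : dprod dM T -> Prop) : dall P -> dall U -> dall E ->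
  dall (fun x : T => forall y : dM, P (y, x) -> U (y, x) -> E (y, x)).
Proof. by rewrite /dall => dP dU dE; dset_tac. Qed.

Let d_ex (P U : dprod dM T -> Prop) : dall P -> dall U ->
  dall (fun x : T => exists y : dM, P (y, x) /\ U (y, x)).
Proof. by rewrite /dall => dP dU; dset_tac. Qed.

Let goodT : good (fun _ => True).
Proof.
split=> // [|P FP]; first exact: dset_true.
apply: (dfilterS fq (qF FP)); last by move=> x [y Py]; exists y.
by apply: d_ex (dset_true _ _); exact: dfilter_def FP.
Qed.

(** Over each [x] the two fibres are nested, and [q] decides which is the smaller one. *)
Let goodI U V : good U -> good V -> good (fun z => U z /\ V z).
Proof.
move=> [dU Uup gU] [dV Vup gV]; split; first exact: dset_and.
  by move=> x y z yz [Uy Vy]; split; [exact: Uup Uy|exact: Vup Vy].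
move=> P FP; have dP := dfilter_def fF FP.
have dUV : dall (fun x : T => exists y : dM, P (y, x) /\ (U (y, x) /\ V (y, x))).
  by apply: (d_ex (U := fun z => U z /\ V z)) => //; exact: dset_and.
have dc : dall (fun x : T => forall y : dM, U (y, x) -> V (y, x)).
  by move: (dU) (dV); rewrite /dall => dU' dV'; dset_tac.
case: (uq dc) => qc.
  apply: (dfilterS fq (dfilterI fq qc (gU P FP)) dUV).
  by move=> x [UV [y [Py Uy]]]; exists y; do !split=> //; exact: UV.
apply: (dfilterS fq (dfilterI fq qc (gV P FP)) dUV) => x [nUV [y [Py Vy]]].
exists y; do !split=> //; apply/not_notP => nUy; apply: nUV => z Uz.
case: (leP y z) => yz; first exact: Vup Vy.
by case: nUy; apply: Uup Uz; exact: ltW.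
Qed.

Lemma q1_filter : dfilter q1.
Proof.
split.
- by move=> P [].
- move=> P Q [dP [P1 [U [FP1 gU qP]]]] dQ PQ; split=> //; exists P1, U; split=> //.
  apply: (dfilterS fq qP); last by move=> x H y P1y Uy; apply: PQ; exact: H.
  by apply: d_all => //; [exact: dfilter_def FP1|case: gU].
- move=> P Q [dP [P1 [U [FP1 gU qP]]]] [dQ [P2 [V [FP2 gV qQ]]]].
  split; first exact: dset_and.
  exists (fun z => P1 z /\ P2 z), (fun z => U z /\ V z); split.
  + exact: dfilterI.
  + exact: goodI.
  + apply: (dfilterS fq (dfilterI fq qP qQ)).
      apply: (d_all (P := fun z => P1 z /\ P2 z) (U := fun z => U z /\ V z)
        (E := fun z => P z /\ Q z)); try exact: dset_and.
        by apply: dset_and; [exact: dfilter_def FP1|exact: dfilter_def FP2].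
      by apply: dset_and; [case: gU|case: gV].
    by move=> x [H1 H2] y [P1y P2y] [Uy Vy]; split; [exact: H1|exact: H2].
- split; first exact: dset_true.
  exists (fun _ => True), (fun _ => True); split => //; first exact: dfilterT.
  apply: (dfilterS fq (dfilterT fq)) => //.
  by apply: (d_all (P := fun _ => True) (U := fun _ => True) (E := fun _ => True));
    exact: dset_true.
- move=> P [dP [P1 [U [FP1 [dU _ gU] qP]]]].
  have [x [H [y [P1y Uy]]]] := dfilter_ex fq (dfilterI fq qP (gU _ FP1)).
  by exists (y, x); exact: H.
Qed.

Lemma q1_sub P : F P -> q1 P.
Proof.
move=> FP; split; first exact: dfilter_def FP.
exists P, (fun _ => True); split=> //.
apply: (dfilterS fq (dfilterT fq)) => //.
by apply: (d_all (U := fun _ => True));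
  [exact: dfilter_def FP|exact: dset_true|exact: dfilter_def FP].
Qed.

(** When the parameter [d] is replaced by a conjugate, the parameters of the witnesses [P] and [U]
    are conjugated along with it. *)
Lemma q1_inv : invariant_filter q1.
Proof.
move=> D R dR d d' dd' [_ [P [U [FP [dU Uup gU] qR]]]].
split; first exact: dall_sec dR.
have [m [p [P1 [dP1 P1E]]]] := dall_fiber (dfilter_def fF FP).
have [n [u [U1 [dU1 U1E]]]] := dall_fiber dU.
pose D1 := dprod (dvec S A0 m) (dvec S A0 n).
have [[p' u'] /= tp] := eqtp_ext S_sat ((p, u) : D1) sA dd'.
have pp' : eqtp A p p'.
  by apply: (eqtp_fun (f := fun z : dprod D D1 => z.2.1) _ tp); dfun_tac.
have uu' : eqtp A u u'.
  by apply: (eqtp_fun (f := fun z : dprod D D1 => z.2.2) _ tp); dfun_tac.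
exists (P1 p'), (U1 u'); split.
- apply: (iF dP1 pp'); apply: (dfilterS fF FP); first exact: dall_sec dP1.
  by move=> z /P1E.
- split; first exact: dall_sec dU1.
    pose W (v : dvec S A0 n) := forall (x : T) (y z : dM), y <= z -> U1 v (y, x) -> U1 v (z, x).
    have dW : dset A W by rewrite /W; dset_tac.
    by apply: (uu' _ dW) => x y z yz /U1E Uy; apply/U1E; exact: Uup Uy.
  move=> P2 FP2; have [l [e [P3 [dP3 P3E]]]] := dall_fiber (dfilter_def fF FP2).
  (* Goodness is known for [U] only, so the parameter of [P2] is moved back along the conjugation
     from [u'] to [u]. *)
  have [e' tp2] := eqtp_ext S_sat e sA (eqtp_sym uu').
  pose W (z : dprod (dvec S A0 n) (dvec S A0 l)) (x : T) :=
    exists y : dM, P3 z.2 (y, x) /\ U1 z.1 (y, x).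
  have dW : dset A (fun z : dprod (dprod (dvec S A0 n) (dvec S A0 l)) T => W z.1 z.2).
    by rewrite /W; dset_tac.
  apply: (dfilterS fq (P := W (u', e))).
  + apply: (iq dW (eqtp_sym tp2)).
    apply: (dfilterS fq (P := fun x => exists y, P3 e' (y, x) /\ U (y, x))).
    * apply: gU; apply: (iF dP3 (d := e)).
        by apply: (eqtp_fun (f := fun z : dprod (dvec S A0 n) (dvec S A0 l) => z.2) _ tp2); dfun_tac.
      apply: (dfilterS fF FP2); first exact: dall_sec dP3.
      by move=> z /P3E.
    * exact: dall_sec dW.
    * by move=> x [y [P3y Uy]]; exists y; split=> //; exact/U1E.
  + by apply: d_ex; [exact: dfilter_def FP2|exact: dall_sec dU1].
  + by move=> x [y [/P3E P2y U1y]]; exists y.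
- pose W (z : dprod D D1) (x : T) :=
    forall y : dM, P1 z.2.1 (y, x) -> U1 z.2.2 (y, x) -> R z.1 (y, x).
  have dW : dset A (fun z : dprod (dprod D D1) T => W z.1 z.2) by rewrite /W; dset_tac.
  apply: (iq dW tp); apply: (dfilterS fq qR); first exact: dall_sec dW.
  by move=> x H y /P1E Py /U1E Uy; exact: H.
Qed.

(** Let [j] be the last index for which the set [V j], where the alternation number is below [j], is
    not good. Then almost everywhere some member of [F] has alternation numbers at least [j], while
    [V j.+1] is good; on their intersection the number is exactly [j], so [E] is constant on
    fibres. *)
Lemma q1_ultra : ultra q1.
Proof.
move=> E dE.
pose E1 (x : T) (y : dM) := E (y, x).
have dE1 : dset setT (fun p : dprod T dM => E1 p.1 p.2) by exact: dall_pair.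
have [m [p dEp]] := dall_par dE.
have dE1p : dset (range (denc p 0)) (fun z : dprod T dM => E1 z.1 z.2).
  apply: (dset_cmap (f := fun p : dprod T dM => (p.2, p.1) : dprod dM T) _ dEp).
  by cmap_tac.
have sp : small (A0 `|` range (denc p 0)).
  have sA' : small (A0 `|` set0).
    by apply: (sub_small sA); rewrite setU0 => x; left.
  by have := small_par p sA'; rewrite set0U.
have [r rP] := alt_bound S_omin S_sat sp dE1p.
pose V j (z : dprod dM T) := ~ alt (E1 z.2) j z.1.
have dV j : dall (V j).
  have := dset_alt j dE1.
  move=> /dset_not; apply: (dset_cmap (f := fun z : dprod dM T => (z.2, z.1) : dprod T dM)).
  by cmap_tac.
have Vup j x y z : y <= z -> V j (y, x) -> V j (z, x) by move=> yz nV /(alt_le yz).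
have [||j /asboolP nVj jmax] := @ex_maxnP (fun j => `[< ~ good (V j) >]) r.
- exists 1%N; apply/asboolP => -[_ _ /(_ _ (dfilterT fF)) H].
  by have [x [y [_]]] := dfilter_ex fq H; apply; exact: alt1.
- move=> n /asboolP nV; rewrite leqNgt; apply/negP => rn; apply: nV.
  have [dT _ gT] := goodT; split; [exact: dV|exact: Vup|move=> P FP].
  apply: (dfilterS fq (gT P FP)).
    by apply: d_ex => //; exact: dfilter_def FP.
  move=> x [y [Py _]]; exists y; split=> // an; apply: (rP x y).
  by apply: alt_leq an; exact: ltnW.
have gV : good (V j.+1).
  by apply/not_notP => /asboolP/jmax; rewrite ltnn.
have [P [FP qP]] : exists P, F P /\ q (fun x => ~ exists y, P (y, x) /\ V j (y, x)).
  apply/not_notP => H; apply: nVj; split; [exact: dV|exact: Vup|move=> P FP].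
  have dx := d_ex (dfilter_def fF FP) (dV j).
  case: (uq dx) => // qn; case: H; by exists P.
have dP := dfilter_def fF FP.
have hom x y y' : (~ exists y, P (y, x) /\ V j (y, x)) -> P (y, x) -> P (y', x) ->
    V j.+1 (y, x) -> V j.+1 (y', x) -> E (y, x) <-> E (y', x).
  move=> nx Py Py' Vy Vy'.
  have a z : P (z, x) -> alt (E1 x) j z.
    by move=> Pz; apply/not_notP => nz; apply: nx; exists z.
  case: (leP y y') => yy'; first exact: (alt_homog yy' (a _ Py') Vy).
  by have [h1 h2] := alt_homog (ltW yy') (a _ Py) Vy'; split.
have dc := d_all dP (dV j.+1) dE.
case: (uq dc) => qc; [left|right].
  by split=> //; exists P, (V j.+1).
have dnE : dall (fun z => ~ E z) by exact: dset_not.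
split=> //; exists P, (V j.+1); split=> //.
apply: (dfilterS fq (dfilterI fq qP qc) (d_all dP (dV j.+1) dnE)).
move=> x [nx nc] y Py Vy Ey; apply: nc => y' Py' Vy'.
by apply/(hom x y y' nx Py Py' Vy Vy').
Qed.

End Step.

(** The projection of [F] to the last [k] coordinates is extended by induction, and the first
    coordinate is then adjoined above it. *)
Lemma invariant_ultra_pow k (F : (dpow dM k -> Prop) -> Prop) :
  dfilter F -> invariant_filter F ->
  exists q, [/\ dfilter q, invariant_filter q, ultra q & forall P, F P -> q P].
Proof.
elim: k F => [|k IH] F fF iF.
  exists F; split=> // P dP; case: (pselect (P tt)) => Ptt; [left|right].
    by apply: (dfilterS fF (dfilterT fF)) => // -[].
  by apply: (dfilterS fF (dfilterT fF)) => // [|[]//]; exact: dset_not.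
pose T := dpow dM k.
pose F' (P : T -> Prop) := dall P /\ F (fun z : dprod dM T => P z.2).
have fF' : dfilter F'.
  split.
  - by move=> P [].
  - move=> P Q [dP FP] dQ PQ; split=> //; apply: (dfilterS fF FP).
      by move: dQ; rewrite /dall => dQ; apply: (dset_cmap (cmap_snd0 dM T) dQ).
    by move=> z; exact: PQ.
  - by move=> P Q [dP FP] [dQ FQ]; split; [exact: dset_and|exact: (dfilterI fF FP FQ)].
  - by split; [exact: dset_true|exact: dfilterT fF].
  - by move=> P [_ /(dfilter_ex fF)[z Pz]]; exists z.2.
have iF' : invariant_filter F'.
  move=> D R dR d d' dd' [dRd FR]; split; first exact: dall_sec dR.
  apply: (iF D (fun d z => R d z.2) _ d d' dd' FR).
  by move: dR => dR; dset_tac.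
have [q [fq iq uq qF']] := IH F' fF' iF'.
have qF P : F P -> q (fun x => exists y, P (y, x)).
  move=> FP; apply: qF'; have dP := dfilter_def fF FP.
  have dx : dall (fun x : T => exists y : dM, P (y, x)).
    by move: dP; rewrite /dall => dP; dset_tac.
  split=> //; apply: (dfilterS fF FP); last by move=> [y x] Pz; exists y.
  by move: dx; rewrite /dall => dx; apply: (dset_cmap (cmap_snd0 dM T) dx).
eexists; split; [exact: (q1_filter fF fq uq qF)|exact: q1_inv|exact: q1_ultra|].
by move=> P FP; exact: (q1_sub fF fq qF FP).
Qed.

Lemma invariant_ultra (T : dtype) (F : (T -> Prop) -> Prop) :
  dfilter F -> invariant_filter F ->
  exists q, [/\ dfilter q, invariant_filter q, ultra q & forall P, F P -> q P].
Proof.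
move=> fF iF; pose V := dpow dM (ddim T); pose em : T -> V := @emb _ _ _ _ T.
have dem B : dfun B em by exact/dfun_cmap/cmap_emb.
pose F' (P : V -> Prop) := dall P /\ F (fun t => P (em t)).
have dpre B (P : V -> Prop) : dset B P -> dset B (fun t => P (em t)).
  by move=> dP; exact: dset_comp dP (dem B).
have fF' : dfilter F'.
  split.
  - by move=> P [].
  - move=> P Q [dP FP] dQ PQ; split=> //; apply: (dfilterS fF FP); first exact: dpre.
    by move=> z; exact: PQ.
  - by move=> P Q [dP FP] [dQ FQ]; split; [exact: dset_and|exact: (dfilterI fF FP FQ)].
  - by split; [exact: dset_true|exact: dfilterT fF].
  - by move=> P [_ /(dfilter_ex fF)[z Pz]]; exists (em z).
have iF' : invariant_filter F'.
  move=> D R dR d d' dd' [dRd FR]; split; first exact: dall_sec dR.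
  apply: (iF D (fun d z => R d (em z)) _ d d' dd' FR).
  by have demA := dem A; dset_tac.
have [q [fq iq uq qF']] := invariant_ultra_pow fF' iF'.
have dim B (P : T -> Prop) : dset B P -> dset B (fun c => exists t, c = em t /\ P t).
  by have demB := dem B => dP; dset_tac.
have qran : q (fun c => exists t, c = em t /\ True).
  apply: qF'; split; first by apply: (dim _ (fun _ => True)); exact: dset_true.
  apply: (dfilterS fF (dfilterT fF)) => [|t _]; last by exists t.
  by apply: (dpre _ (fun c => exists t, c = em t /\ True)); apply: (dim _ (fun _ => True));
    exact: dset_true.
exists (fun P => dall P /\ q (fun c => exists t, c = em t /\ P t)); split.
- split.
  + by move=> P [].
  + move=> P Q [dP qP] dQ PQ; split=> //; apply: (dfilterS fq qP); first exact: dim.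
    by move=> c [t [-> Pt]]; exists t; split=> //; exact: PQ.
  + move=> P Q [dP qP] [dQ qQ]; split; first exact: dset_and.
    apply: (dfilterS fq (dfilterI fq qP qQ)).
      by apply: (dim _ (fun t => P t /\ Q t)); exact: dset_and.
    by move=> c [[t [-> Pt]] [t' [/emb_inj <- Qt]]]; exists t.
  + by split=> //; exact: dset_true.
  + by move=> P [_ /(dfilter_ex fq)[c [t [_ Pt]]]]; exists t.
- move=> D R dR d d' dd' [_ qR]; split; first exact: dall_sec dR.
  apply: (iq D (fun d c => exists t, c = em t /\ R d t) _ d d' dd' qR).
  by have demA := dem A; dset_tac.
- move=> P dP; case: (uq _ (dim _ _ dP)) => qP; [by left|right; split].
    exact: dset_not.
  apply: (dfilterS fq (dfilterI fq qP qran)).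
    by apply: (dim _ (fun t => ~ P t)); exact: dset_not.
  by move=> c [nc [t [ct _]]]; exists t; split=> // Pt; apply: nc; exists t.
- move=> P FP; have dP := dfilter_def fF FP; split=> //; apply: qF'; split; first exact: dim.
  apply: (dfilterS fF FP) => [|t Pt]; last by exists t.
  by apply: (dpre _ (fun c => exists t, c = em t /\ P t)); exact: dim.
Qed.

End InvariantFilters.

(** * Limits and directed families *)

Section Piercing.
Variables (L : language) (M : rcfType) (S : expansion L M) (A0 : set M).
Hypotheses (S_omin : o_minimal S) (S_sat : saturated S) (A00 : A0 0).
Hypothesis sA0 : small A0.
Local Notation dtype := (dtype S A0).
Local Notation dM := (dM S A0).

Lemma small_dpar (T : dtype) (t : T) : small (A0 `|` range (denc t 0)).
Proof. by apply: small_setU_finite => //; exact: finite_range_row. Qed.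

Lemma dall_choice (T U : dtype) (R : T -> U -> Prop) :
  dall (fun q : dprod T U => R q.1 q.2) -> (forall t, exists u, R t u) ->
  exists f : T -> U, dfun [set: M] f /\ forall t, R t (f t).
Proof.
move=> /dall_par[m [p dR]] Rex.
have [f [df fP]] := dchoice S_omin S_sat A00 (small_dpar p) dR Rex.
by exists f; split=> //; apply: dfun_mono df.
Qed.

(** Closed sets are tested by definable curves only, so the topology is abstracted to a relation
    between a curve, taken at [0] from the right, and its limits; existence of limits is definable
    compactness. This form passes to powers coordinatewise. *)
Record ltype := LType {
  ldt :> dtype;
  lim0 : (dM -> ldt) -> ldt -> Prop;
  lim0_ex : forall s : dM -> ldt, dfun [set: M] s -> exists w, lim0 s w }.

Definition cclosed (O : ltype) (Z : O -> Prop) := forall (s : dM -> O) w,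
  dfun [set: M] s -> lim0 s w -> (exists2 b, 0 < b & forall u, 0 < u < b -> Z (s u)) -> Z w.

Lemma cclosed_all (O : ltype) (I : Type) (Z : I -> O -> Prop) :
  (forall i, cclosed (Z i)) -> cclosed (fun w => forall i, Z i w).
Proof.
move=> cZ s w ds sw [b b0 H] i; apply: (cZ i s w ds sw); exists b => // u ub.
exact: H.
Qed.

Lemma cclosed_imp (O : ltype) (P : Prop) (Z : O -> Prop) :
  cclosed Z -> cclosed (fun w => P -> Z w).
Proof.
by move=> cZ s w ds sw [b b0 H] p; apply: (cZ s w ds sw); exists b => // u /H; apply.
Qed.

Lemma cclosed_and (O : ltype) (Z Z' : O -> Prop) :
  cclosed Z -> cclosed Z' -> cclosed (fun w => Z w /\ Z' w).
Proof.
move=> cZ cZ' s w ds sw [b b0 H]; split.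
  by apply: (cZ s w ds sw); exists b => // u /H[].
by apply: (cZ' s w ds sw); exists b => // u /H[].
Qed.

Lemma dfun_oppinv A : dfun A (fun s : dM => - s^-1 : dM).
Proof.
have d0 := dpt_M0 S A0 A; have d1 := dpt_M1 S A0 A.
have : dset A (fun p : dprod dM dM => (p.1 = 0 /\ p.2 = 0) \/ (~ p.1 = 0 /\ p.2 * p.1 = - 1)).
  by dset_tac.
apply: dset_ext => -[x y] /=; split.
  case=> [[-> ->]|[/eqP x0 yx]]; first by rewrite invr0 oppr0.
  by rewrite -[y](mulfK x0) yx mulN1r.
case: (eqVneq x 0) => [->|x0 ->]; first by rewrite invr0 oppr0; left.
by right; split; [exact/eqP|rewrite mulNr mulVf].
Qed.

(** The map [phi] approaches the left end of [I] as its argument decreases to [0]: it is [p + s] for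
    a finite end [p] and [- s^-1] otherwise. Its values are eventually in [I] because a definable
    germ is constant. *)
Lemma left_end (I : dM -> Prop) i0 : dall I -> I i0 ->
  (forall u, I u -> exists2 v, I v & v < u) ->
  exists phi : dM -> dM, dfun [set: M] phi /\ forall u, I u ->
    exists2 s0, 0 < s0 & forall s, 0 < s < s0 -> I (phi s) /\ phi s < u.
Proof.
move=> dI Ii0 nomin.
pose U (y : dM) := forall u : dM, I u -> y < u.
have dU : dset setT U by move: dI; rewrite /dall /U => dI; dset_tac.
have nU y : ~ U y -> exists2 u, I u & u <= y.
  move=> n; apply/not_notP => H; apply: n => u Iu; rewrite ltNge; apply/negP => uy.
  by apply: H; exists u.
case: (pselect (exists y, U y)) => [[y0 Uy0]|nex]; last first.
  exists (fun s => - s^-1); have dphi := dfun_oppinv setT; split=> //.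
  have [b b0 [H|H]] := dset_eventually S_omin 0 (dset_comp dI dphi : dset _ (_ : dM -> Prop)).
    move=> u Iu; exists (Num.min b (`|u| + 1)^-1).
      by rewrite lt_min b0 invr_gt0 ltr_wpDl.
    move=> s /andP[s0]; rewrite lt_min => /andP[sb su]; split; first by apply: H; rewrite s0.
    rewrite ltrNl; apply: (@le_lt_trans _ _ `|u|); first by rewrite ler_normr lexx orbT.
    have : `|u| + 1 < s^-1 by rewrite -[X in X < _]invrK ltf_pV2 ?posrE // invr_gt0 ltr_wpDl.
    by apply: lt_trans; rewrite ltrDl.
  exfalso; have [|u Iu ub] := nU (- b^-1 - 1); first by move=> h; apply: nex; exists (- b^-1 - 1).
  have bi : 0 < b^-1 by rewrite invr_gt0.
  have u0 : 0 < - u by lra.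
  apply: (H (- u)^-1); last by rewrite invrK opprK.
  rewrite invr_gt0 u0 /= -[X in _ < X]invrK ltf_pV2 ?posrE //; lra.
have [|||p [lp gp]] := dset_cut S_omin (y0 := y0) (z0 := i0) dU => //.
- by move=> y z yz Uz u /Uz; exact: le_lt_trans.
- by move=> /(_ _ Ii0); rewrite ltxx.
have pI u : I u -> p < u.
  move=> /nomin[v Iv vu]; apply: le_lt_trans vu; rewrite leNgt; apply/negP => /lp /(_ _ Iv).
  by rewrite ltxx.
exists (fun s => p + s).
have dp : dset setT (fun x : dM => x = p).
  by apply: (@dset_mono _ _ _ _ dM (set0 `|` range (denc (p : dM) 0))) => //; exact: dpt_addpar.
have dphi : dfun setT (fun s : dM => p + s : dM) by dfun_tac.
split=> //.
have [b b0 [H|H]] := dset_eventually S_omin 0 (dset_comp dI dphi : dset _ (_ : dM -> Prop)).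
  move=> u Iu; exists (Num.min b (u - p)); first by rewrite lt_min b0 subr_gt0 pI.
  move=> s /andP[s0]; rewrite lt_min => /andP[sb su]; split; first by apply: H; rewrite s0.
  by rewrite -ltrBrDl.
exfalso; have [|u Iu ub] := nU (p + b / 2); first by apply: gp; rewrite ltrDl divr_gt0.
apply: (H (u - p)); last by rewrite addrC subrK.
rewrite subr_gt0 pI //=; lra.
Qed.

(** Definable choice gives a curve of points running towards the left end of [I], where the sets are
    smallest; a limit of the curve lies in all of them. If [I] has a minimum, its member is
    contained in all others. *)
Lemma dir_left (O : ltype) (I : dM -> Prop) (Y : dM -> O -> Prop) i0 :
  dall I -> I i0 -> dall (fun q : dprod dM O => Y q.1 q.2) ->
  (forall u, I u -> cclosed (Y u)) ->
  (forall u v w, I u -> I v -> u <= v -> Y u w -> Y v w) ->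
  (forall u, I u -> exists w, Y u w) ->
  exists w, forall u, I u -> Y u w.
Proof.
move=> dI Ii0 dY cY Ymono Yex.
case: (pselect (exists2 u0, I u0 & forall v, I v -> u0 <= v)) => [[u0 Iu0 u0min]|nomin].
  have [w Yw] := Yex u0 Iu0; exists w => u Iu; exact: (Ymono u0 u w Iu0 Iu (u0min _ Iu) Yw).
have {}nomin u : I u -> exists2 v, I v & v < u.
  move=> Iu; apply/not_notP => n; apply: nomin; exists u => // v Iv.
  by rewrite leNgt; apply/negP => vu; apply: n; exists v.
have [phi [dphi phiP]] := left_end dI Ii0 nomin.
have [w0 _] := Yex i0 Ii0.
have [||f [df fP]] := @dall_choice dM O (fun u w => I u -> Y u w).
- by move: dI dY; rewrite /dall => dI dY; dset_tac.
- by move=> u; case: (pselect (I u)) => [/Yex[w Yw]|nI]; [exists w|exists w0].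
have dfp : dfun setT (fun s => f (phi s)) by exact: dfun_comp df dphi.
have [w lw] := lim0_ex dfp.
exists w => u Iu; apply: (cY u Iu _ w dfp lw).
have [s0 s00 H] := phiP u Iu; exists s0 => // s /H[Ip pu].
exact: (Ymono _ u _ Ip Iu (ltW pu) (fP _ Ip)).
Qed.

Lemma dir_right (O : ltype) (I : dM -> Prop) (Y : dM -> O -> Prop) i0 :
  dall I -> I i0 -> dall (fun q : dprod dM O => Y q.1 q.2) ->
  (forall u, I u -> cclosed (Y u)) ->
  (forall u v w, I u -> I v -> u <= v -> Y v w -> Y u w) ->
  (forall u, I u -> exists w, Y u w) ->
  exists w, forall u, I u -> Y u w.
Proof.
move=> dI Ii0 dY cY Ymono Yex.
have [||||||w wP] := @dir_left O (fun u => I (- u)) (fun u => Y (- u)) (- i0).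
- by move: dI; rewrite /dall => dI; dset_tac.
- by rewrite opprK.
- by move: dY; rewrite /dall => dY; dset_tac.
- by move=> u Iu; exact: cY.
- by move=> u v w Iu Iv uv Yu; apply: Ymono Yu => //; rewrite lerN2.
- by move=> u Iu; exact: Yex.
by exists w => u Iu; rewrite -[u]opprK; apply: wP; rewrite opprK.
Qed.

(** The left end of the segment is moved with the right end fixed, then the right end; each time the
    closed sets form a nested definable family. *)
Lemma dir_interval (O : ltype) (Y : O -> Prop) (I : dM -> Prop) (E : dM -> O -> Prop) i0 :
  dall Y -> cclosed Y -> dall I -> I i0 -> dall (fun q : dprod dM O => E q.1 q.2) ->
  (forall u, cclosed (E u)) ->
  (forall s s', I s -> I s' -> s <= s' ->
     exists w, Y w /\ forall t, s <= t -> t <= s' -> E t w) ->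
  exists w, Y w /\ forall s s' t, I s -> I s' -> s <= t -> t <= s' -> E t w.
Proof.
move=> dY cY dI Ii0 dE cE H.
have cl (P : dM -> Prop) : cclosed (fun w => Y w /\ forall t, P t -> E t w).
  by apply: cclosed_and => //; apply: cclosed_all => t; exact: cclosed_imp.
have H1 s' : I s' -> exists w, Y w /\ forall t, (exists s, I s /\ s <= t) /\ t <= s' -> E t w.
  move=> Is'.
  have ds' : dset setT (fun x : dM => x = s').
    by apply: (@dset_mono _ _ _ _ dM (set0 `|` range (denc (s' : dM) 0))) => //; exact: dpt_addpar.
  have [||||||w wP] := @dir_left O (fun s => I s /\ s <= s')
    (fun s w => Y w /\ forall t : dM, s <= t /\ t <= s' -> E t w) s'.
  - by move: dI; rewrite /dall => dI; dset_tac.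
  - by [].
  - by move: dI dY dE; rewrite /dall => dI dY dE; dset_tac.
  - by move=> u _; exact: cl.
  - move=> u v w _ _ uv [Yw Hw]; split=> // t [vt ts]; apply: Hw; split=> //.
    exact: le_trans uv vt.
  - by move=> u [Iu us']; have [w [Yw Hw]] := H u s' Iu Is' us'; exists w; split=> // t [h1 h2]; exact: Hw.
  exists w; split; first by case: (wP s').
  move=> t [[s [Is st]] ts']; case: (wP s) => [|_]; last by apply.
  by split=> //; exact: le_trans st ts'.
have [||||||w wP] := @dir_right O I
    (fun s' w => Y w /\ forall t : dM, (exists s : dM, I s /\ s <= t) /\ t <= s' -> E t w) i0.
- by [].
- by [].
- by move: dI dY dE; rewrite /dall => dI dY dE; dset_tac.
- by move=> u _; exact: cl.
- move=> u v w _ _ uv [Yw Hw]; split=> // t [st tu]; apply: Hw; split=> //.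
  exact: le_trans tu uv.
- exact: H1.
exists w; split; first by case: (wP i0).
by move=> s s' t Is Is' st ts'; case: (wP s' Is') => _; apply; split=> //; exists s.
Qed.

(** Conjunctions and disjunctions run over tuples rather than lists because tuples of a fixed length
    form a coded type. *)
Fixpoint allp (T : dtype) n (Q : T -> Prop) : dpow T n -> Prop :=
  if n is n'.+1 then fun z : dprod T (dpow T n') => Q z.1 /\ allp Q z.2 else fun _ => True.

Fixpoint exp (T : dtype) n (Q : T -> Prop) : dpow T n -> Prop :=
  if n is n'.+1 then fun z : dprod T (dpow T n') => Q z.1 \/ exp Q z.2 else fun _ => False.

Lemma dset_allp (T U : dtype) n A (Q : U -> T -> Prop) :
  dset A (fun q : dprod U T => Q q.1 q.2) ->
  dset A (fun q : dprod U (dpow T n) => allp (Q q.1) q.2).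
Proof.
move=> dQ; elim: n => [|n IH] /=; first exact: dset_true.
apply: dset_and.
  apply: (dset_cmap (f := fun q : dprod U (dprod T (dpow T n)) => (q.1, q.2.1) : dprod U T) _ dQ).
  by cmap_tac.
apply: (dset_cmap (f := fun q : dprod U (dprod T (dpow T n)) => (q.1, q.2.2) :
  dprod U (dpow T n)) _ IH).
by cmap_tac.
Qed.

Lemma dset_exp (T U : dtype) n A (Q : U -> T -> Prop) :
  dset A (fun q : dprod U T => Q q.1 q.2) ->
  dset A (fun q : dprod U (dpow T n) => exp (Q q.1) q.2).
Proof.
move=> dQ; elim: n => [|n IH] /=; first exact: dset_false.
apply: dset_or.
  apply: (dset_cmap (f := fun q : dprod U (dprod T (dpow T n)) => (q.1, q.2.1) : dprod U T) _ dQ).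
  by cmap_tac.
apply: (dset_cmap (f := fun q : dprod U (dprod T (dpow T n)) => (q.1, q.2.2) :
  dprod U (dpow T n)) _ IH).
by cmap_tac.
Qed.

Lemma allp_imp (T : dtype) n (Q Q' : T -> Prop) (z : dpow T n) :
  (forall t, Q t -> Q' t) -> allp Q z -> allp Q' z.
Proof. by move=> QQ; elim: n z => //= n IH [t z] [/QQ Qt /IH]. Qed.

Lemma allp_all (T : dtype) n (I : Type) (Q : I -> T -> Prop) (z : dpow T n) :
  (forall i, allp (Q i) z) -> allp (fun t => forall i, Q i t) z.
Proof.
elim: n z => //= n IH [t z] H; split=> [i|]; first by case: (H i).
by apply: IH => i; case: (H i).
Qed.

Lemma allp_ord (T : dtype) n (z : dpow T n) :
  exists h : 'I_n -> T, forall Q, allp Q z <-> forall i, Q (h i).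
Proof.
elim: n z => [|n IH] /= z; first by exists (fun i : 'I_0 => match i with Ordinal m lt =>
  match (notF lt) with end end) => Q; split=> // _ [].
case: z => t z; have [h hP] := IH z.
exists (fun i => if unlift ord0 i is Some j then h j else t) => Q; split=> /=.
  by move=> [Qt /hP Qz] i; case: unliftP.
move=> H; split; first by have := H ord0; rewrite unlift_none.
by apply/hP => i; have := H (lift ord0 i); rewrite liftK.
Qed.

Lemma allp_seq (T : dtype) (s : seq T) : exists z : dpow T (size s),
  forall Q, allp Q z <-> all (fun t => `[< Q t >]) s.
Proof.
elim: s => [|t s [z zP]]; first by exists tt.
exists (t, z) => Q /=; split.
  by move=> [Qt /zP ->]; rewrite andbT; apply/asboolP.
by move=> /andP[/asboolP Qt /zP].
Qed.

Lemma allp_cat (T : dtype) n m (z : dpow T n) (z' : dpow T m) :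
  exists z2 : dpow T (n + m), forall Q, allp Q z2 <-> allp Q z /\ allp Q z'.
Proof.
elim: n z => [|n IH] /= z; first by exists z' => Q; split=> // -[].
case: z => t z; have [z2 z2P] := IH z.
by exists (t, z2) => Q /=; rewrite z2P; tauto.
Qed.

Lemma allp_eqtp (T : dtype) n A (Q : T -> Prop) (z z' : dpow T n) :
  (forall t t', eqtp A t t' -> Q t -> Q t') -> eqtp A z z' -> allp Q z -> allp Q z'.
Proof.
move=> QQ; elim: n z z' => //= n IH [t z] [t' z'] zz' [Qt Qz]; split.
  apply: QQ Qt; apply: (eqtp_fun (f := fun z : dprod T (dpow T n) => z.1) _ zz'); dfun_tac.
apply: IH Qz; apply: (eqtp_fun (f := fun z : dprod T (dpow T n) => z.2) _ zz'); dfun_tac.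
Qed.

Fixpoint lim_pow (O : ltype) n : (dM -> dpow O n) -> dpow O n -> Prop :=
  if n is n'.+1 then fun (s : dM -> dprod O (dpow O n')) (w : dprod O (dpow O n')) =>
    lim0 (fun u => (s u).1) w.1 /\ lim_pow (fun u => (s u).2) w.2
  else fun _ _ => True.

Fact lim_pow_ex (O : ltype) n (s : dM -> dpow O n) : dfun [set: M] s ->
  exists w, lim_pow s w.
Proof.
elim: n s => [|n IH] s ds; first by exists tt.
have [w1 H1] := lim0_ex (dfun_fst (T := O) (U := dpow O n) ds).
have [w2 H2] := IH _ (dfun_snd (T := O) (U := dpow O n) ds).
by exists (w1, w2).
Qed.

Definition lpow (O : ltype) n := LType (@lim_pow_ex O n).

(** The first entry of a definable curve of tuples is eventually in [Z] or eventually outside it; in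
    the latter case the remaining entries take over. *)
Lemma cclosed_exp (O : ltype) n (Z : O -> Prop) : dall Z -> cclosed Z ->
  cclosed (O := lpow O n) (exp Z).
Proof.
move=> dZ cZ; elim: n => [|n IH] s w ds.
  by move=> _ [b b0 H]; have [h1 h2] := midf_lt b0; apply: (H ((0 + b) / 2)); rewrite h1.
move=> /= [l1 l2] [b b0 H].
have ds1 := dfun_fst (T := O) (U := dpow O n) ds.
have ds2 := dfun_snd (T := O) (U := dpow O n) ds.
have dE : dset setT (fun u : dM => Z (s u).1) by exact: dset_comp dZ ds1.
have [b1 b10 [H1|H1]] := dset_eventually S_omin 0 dE.
  by left; apply: (cZ _ _ ds1 l1); exists b1.
right; apply: (IH _ _ ds2 l2); exists (Num.min b b1); first by rewrite lt_min b0.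
move=> u /andP[u0]; rewrite lt_min => /andP[ub ub1].
have [|Zu|//] := H u; first by rewrite u0.
by case: (H1 u) => //; rewrite u0.
Qed.

(** Shorter lists are padded by repetition, hence must be nonempty. *)
Lemma exp_seq (T : dtype) (s : seq T) n : (size s <= n)%N -> (0 < size s)%N ->
  exists z : dpow T n, forall Q, has (fun t => `[< Q t >]) s -> exp Q z.
Proof.
case: s => // t s sn _; elim: n t s sn => // n IH t [|t' s] /= sn.
  have [z _] : exists z : dpow T n, True.
    by elim: n {IH sn} => [|n [z _]]; [exists tt|exists (t, z)].
  by exists (t, z) => Q /=; rewrite orbF => /asboolP; left.
have [z zP] := IH t' s sn.
exists (t, z) => Q /= /orP[/asboolP|H]; [by left|right; exact: zP].
Qed.

Lemma exp_ex (T : dtype) n (Q : T -> Prop) (z : dpow T n) : exp Q z ->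
  exists f : dpow T n -> T, cmap f /\ Q (f z).
Proof.
elim: n z => //= n IH [t z] /= [Qt|/IH[f [cf Qf]]].
  by exists (fun z => z.1); split=> //; exact: cmap_fst0.
exists (fun z => f z.2); split=> //.
by apply: (@cmap_comp _ _ _ _ _ _ _ (fun z : dprod T (dpow T n) => z.2) f) => //; exact: cmap_snd0.
Qed.

End Piercing.

(** * Conjugates of a closed set *)

Lemma all_has_ex (T : Type) (P Q : pred T) s : all P s -> has Q s -> exists x, P x /\ Q x.
Proof.
by elim: s => //= x s IH /andP[Px /IH H] /orP[Qx|/H //]; exists x.
Qed.

(** Only finitely many traces on [F] are realized, so finitely many points realize them all. *)
Lemma trb_fin (X U : Type) (R : X -> U -> Prop) C d :
  (forall (F : seq X) (us : seq U), exists B : seq (seq bool),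
     (size B <= C * (size F).+1 ^ d)%N /\
     all (fun u => [seq `[< R f u >] | f <- F] \in B) us) -> trb R C d.
Proof.
move=> H F.
pose real (m : (size F).-tuple bool) := `[< exists u, [seq `[< R f u >] | f <- F] = m >].
have [us usP] : exists us : seq U, forall m : (size F).-tuple bool,
    m \in enum real -> has (fun u => [seq `[< R f u >] | f <- F] == m) us.
  have : forall m, m \in enum real -> real m by move=> m; rewrite mem_enum.
  elim: (enum real) => [|m s IH] sP; first by exists [::].
  have [|us usP] := IH; first by move=> x xs; apply: sP; rewrite inE xs orbT.
  have /asboolP[u um] := sP m (mem_head _ _).
  exists (u :: us) => x; rewrite inE /= => /orP[/eqP->|/usP ->]; last by rewrite orbT.
  by rewrite um eqxx.
have [B [sB BP]] := H F us.
exists [seq val m | m <- enum real]; split; last first.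
  move=> u; have sz : size [seq `[< R f u >] | f <- F] == size F by rewrite size_map.
  apply/mapP; exists (Tuple sz) => //; rewrite mem_enum; apply/asboolP; by exists u.
apply: leq_trans sB; apply: uniq_leq_size.
  by rewrite (map_inj_uniq val_inj) enum_uniq.
by move=> _ /mapP[m /usP/(all_has_ex BP)[u [uB /eqP um]] ->]; move: uB; rewrite um.
Qed.

Section PeterzilPillay.
Variables (L : language) (M : rcfType) (S : expansion L M) (A0 : set M).
Hypotheses (S_omin : o_minimal S) (S_sat : saturated S) (A00 : A0 0).
Hypothesis sA0 : small A0.
Variable A : set M.
Hypothesis sA : small (A0 `|` A).
Local Notation dtype := (dtype S A0).
Local Notation dM := (dM S A0).
Local Notation ltype := (ltype S A0).

Section Step.
Variables (O : ltype) (D : dtype).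
Local Notation P := (dprod D (dprod dM dM)).
Variable Z : dprod dM D -> O -> Prop.
Hypothesis dZ : dset A (fun q : dprod (dprod dM D) O => Z q.1 q.2).
Hypothesis cZ : forall c, cclosed (Z c).

(** The intersection of the sets [Z (t, c)] over the convex hull of the fibre of [B]; [segset] does
    the same over one segment. *)
Definition hullset (B : dprod dM D -> Prop) (c : D) (w : O) :=
  forall s s' t : dM, B (s, c) -> B (s', c) -> s <= t -> t <= s' -> Z (t, c) w.

Definition segset (p : P) (w : O) := forall t : dM, p.2.1 <= t -> t <= p.2.2 -> Z (t, p.1) w.

Lemma dset_hull B : dset A B -> dset A (fun q : dprod D O => hullset B q.1 q.2).
Proof. by move=> dB; rewrite /hullset; dset_tac. Qed.

Lemma dset_seg : dset A (fun q : dprod P O => segset q.1 q.2).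
Proof. by rewrite /segset; dset_tac. Qed.

Lemma cclosed_hull B c : cclosed (hullset B c).
Proof. by rewrite /hullset; do 3!apply: cclosed_all => ?; do 4!apply: cclosed_imp; exact: cZ. Qed.

Lemma cclosed_seg p : cclosed (segset p).
Proof. by rewrite /segset; apply: cclosed_all => ?; do 2!apply: cclosed_imp; exact: cZ. Qed.

Lemma cclosed_allp (T : dtype) n (Q : T -> O -> Prop) (z : dpow T n) :
  (forall t, cclosed (Q t)) -> cclosed (fun w => allp (Q^~ w) z).
Proof.
move=> cQ; elim: n z => [|n IH] /= z; first by move=> s w.
by apply: cclosed_and.
Qed.

Definition seg_in (B : dprod dM D -> Prop) (p : P) :=
  [/\ B (p.2.1, p.1), B (p.2.2, p.1) & p.2.1 <= p.2.2].

(** A hull is the directed intersection of the segments with ends in [B], so by [dir_interval] an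
    empty intersection of closed sets is already empty for one segment. The tuple is treated entry
    by entry, and the segments found are absorbed into [Y]. *)
Lemma hull_seg n B (cs : dpow D n) (Y : O -> Prop) : dset A B -> dall Y -> cclosed Y ->
  allp (fun c => exists s, B (s, c)) cs -> ~ (exists w, Y w /\ allp (hullset B ^~ w) cs) ->
  exists z : dpow P n, allp (seg_in B) z /\ ~ (exists w, Y w /\ allp (segset^~ w) z).
Proof.
move=> dB; elim: n cs Y => [|n IH] cs Y dY cY Bcs nY; first by exists tt; split.
case: cs Bcs nY => c cs /= [[s0 Bs0] Bcs] nY.
have dB' : dset setT B by apply: dset_mono dB.
have dZ' : dset setT (fun q : dprod (dprod dM D) O => Z q.1 q.2) by apply: dset_mono dZ.
have dcs : dset setT (fun x : dpow D n => x = cs).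
  by apply: (@dset_mono _ _ _ _ _ (set0 `|` range (denc cs 0))) => //; exact: dpt_addpar.
have dc : dset setT (fun x : D => x = c).
  by apply: (@dset_mono _ _ _ _ _ (set0 `|` range (denc c 0))) => //; exact: dpt_addpar.
have [s [s' [Bs Bs' ss' nw]]] : exists s s', [/\ B (s, c), B (s', c), s <= s' &
    ~ exists w, (Y w /\ allp (hullset B ^~ w) cs) /\ segset (c, (s, s')) w].
  apply/not_notP => H; apply: nY.
  have [|||||||w [[Yw csw] Hw]] := @dir_interval _ _ _ _ S_omin S_sat A00 sA0 O
    (fun w => Y w /\ allp (hullset B ^~ w) cs) (fun s => B (s, c)) (fun t => Z (t, c)) s0.
  - apply: dset_and => //.
    have dh := dset_allp n (Q := fun w c => hullset B c w)
      (dset_cmap (f := fun q : dprod O D => (q.2, q.1) : dprod D O)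
         (cmap_pair (cmap_snd0 _ _) (cmap_fst0 _ _)) (dset_mono (@subsetT _ A) (dset_hull dB))).
    by apply: (dset_comp2 (R := fun w cs => allp (hullset B ^~ w) cs) dh); dfun_tac.
  - by apply: cclosed_and => //; apply: cclosed_allp => ?; exact: cclosed_hull.
  - by rewrite /dall; dset_tac.
  - by [].
  - by rewrite /dall; dset_tac.
  - by [].
  - move=> s s' Bs Bs' ss'; apply/not_notP => n1; apply: H; exists s, s'; split=> //.
  by exists w; split=> //; split=> // s s' t Bs Bs' st ts'; exact: (Hw s s').
have [||||z [Bz nz]] := IH cs (fun w => Y w /\ segset (c, (s, s')) w).
- apply: dset_and => //.
  have ds := dset_mono (@subsetT _ A) dset_seg.
  apply: (dset_fiber (T := P) (t := (c, (s, s'))) ds).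
  by apply: (@dset_mono _ _ _ _ P (set0 `|` range (denc ((c, (s, s')) : P) 0))) => //; exact: dpt_addpar.
- by apply: cclosed_and => //; exact: cclosed_seg.
- by [].
- by move=> [w [[Yw sw] cw]]; apply: nw; exists w.
exists ((c, (s, s')), z); split=> //.
by move=> [w [Yw /= [sw zw]]]; apply: nz; exists w.
Qed.

Variable c0 : dprod dM D.

Section Alpha.
Variable q : (O -> Prop) -> Prop.
Hypotheses (fq : dfilter q) (iq : invariant_filter A q) (uq : ultra q).
Hypothesis qZ : forall c, eqtp A c0 c -> q (Z c).

(** If [segset] fails almost surely, conjugation carries the segment from [s] to [s'] to one from
    [s'] to a further point, and so on. By invariance all these segments fail, whereas their ends
    succeed, so a typical point alternates too often along the line. *)
Lemma q_seg p : eqtp A c0 (p.2.1, p.1) -> eqtp A c0 (p.2.2, p.1) -> p.2.1 <= p.2.2 ->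
  q (segset p).
Proof.
case: p => c [s s'] /= es es'; rewrite le_eqVlt => /orP[/eqP ss'|ss'].
  apply: (dfilterS fq (qZ es)); first exact: (dall_sec _ dset_seg).
  move=> w Zw t /= h1 h2; have -> // : t = s by apply/le_anti; rewrite h1 ss' h2.
have [//|nq] := uq (dall_sec (c, (s, s')) dset_seg).
pose E (xc : dprod O D) (t : dM) := Z (t, xc.2) xc.1.
have dE : dset A (fun z : dprod (dprod O D) dM => E z.1 z.2) by rewrite /E; dset_tac.
have [r rP] := alt_bound S_omin S_sat sA dE.
suff [Q [qQ QP]] : exists Q, q Q /\ forall x, Q x -> altf (E (x, c)) true r.*2 s.
  have [x Qx] := dfilter_ex fq qQ; exfalso; apply: (rP (x, c) s).
  by apply: (alt_leq (j := r.*2)); [rewrite -addnn leq_addr|left; exact: QP].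
elim: r {rP} s s' es es' ss' nq => [|r IH] s s' es es' ss' nq.
  by exists (fun _ => True); split=> //; exact: dfilterT.
have [s2 tp] := eqtp_ext S_sat (s' : dM) sA (eqtp_trans (eqtp_sym es) es').
pose W := dprod (dprod dM D) dM.
have es2 : eqtp A c0 (s2, c).
  apply: (eqtp_trans es').
  by apply: (eqtp_fun (f := fun z : W => (z.2, z.1.2) : dprod dM D) _ tp); dfun_tac.
have ss2 : s' < s2.
  apply: (tp (fun z : W => z.1.1 < z.2)) => //; by dset_tac.
have nq2 : q (fun t => ~ segset (c, (s', s2)) t).
  apply: (iq (D := W) (R := fun z w => ~ segset (z.1.2, (z.1.1, z.2)) w) _ tp nq).
  by have ds := dset_seg; dset_tac.
have [Q [qQ QP]] := IH s' s2 es' es2 ss2 nq2.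
exists (fun x => (Z (s, c) x /\ ~ segset (c, (s, s')) x) /\ Q x); split.
  by apply: (dfilterI fq) => //; apply: (dfilterI fq) => //; exact: qZ.
move=> x [[Zx nsx] Qx]; rewrite doubleS /=.
have [t [st ts' nZ]] : exists t, [/\ s <= t, t <= s' & ~ Z (t, c) x].
  apply/not_notP => n; apply: nsx => t h1 h2; apply/not_notP => nZ; apply: n; by exists t.
exists s; split=> //; exists t; split=> //.
exact: altf_le ts' (QP x Qx).
Qed.

End Alpha.

Hypothesis fip : forall n (z : dpow (dprod dM D) n), allp (eqtp A c0) z ->
  exists w, allp (Z^~ w) z.

(** The sets [Z c] for the conjugates [c] of [c0] generate a filter, which is invariant because
    conjugates of conjugates are conjugates. *)
Lemma conj_filter : exists q, [/\ dfilter q, invariant_filter A q, ultra q &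
  forall c, eqtp A c0 c -> q (Z c)].
Proof.
pose F (Q : O -> Prop) := dall Q /\ exists n (z : dpow (dprod dM D) n),
  allp (eqtp A c0) z /\ forall w, allp (Z^~ w) z -> Q w.
have fF : dfilter F.
  split.
  - by move=> Q [].
  - move=> Q Q' [dQ [n [z [ez zQ]]]] dQ' QQ'; split=> //; exists n, z; split=> // w /zQ.
    exact: QQ'.
  - move=> Q Q' [dQ [n [z [ez zQ]]]] [dQ' [n' [z' [ez' zQ']]]].
    split; first exact: dset_and.
    have [z2 z2P] := allp_cat z z'; exists (n + n')%N, z2; split; first exact/z2P.
    by move=> w /z2P[/zQ ? /zQ'].
  - by split; [exact: dset_true|exists 0%N, tt].
  - by move=> Q [_ [n [z [/fip[w Zw] zQ]]]]; exists w; exact: zQ.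
have iF : invariant_filter A F.
  move=> E R dR d d' dd' [_ [n [z [ez zR]]]]; split; first exact: dall_sec dR.
  have [z' tp] := eqtp_ext S_sat z sA dd'.
  exists n, z'; split.
    apply: (@allp_eqtp _ _ _ _ _ n A _ z z') ez; first by move=> t t' tt' et; exact: eqtp_trans et tt'.
    by apply: (eqtp_fun (f := fun y : dprod E (dpow (dprod dM D) n) => y.2) _ tp); dfun_tac.
  pose W (y : dprod E (dpow (dprod dM D) n)) := forall w : O, allp (Z^~ w) y.2 -> R y.1 w.
  have dW : dset A W.
    have dZ' := dset_allp n (Q := fun w c => Z c w)
      (dset_cmap (f := fun q : dprod O (dprod dM D) => (q.2, q.1) : dprod (dprod dM D) O)
         (cmap_pair (cmap_snd0 _ _) (cmap_fst0 _ _)) dZ).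
    apply: (dset_all (U := O)); apply: dset_imp; last by dset_tac.
    apply: (dset_comp2 (R := fun w z => allp (Z^~ w) z)
      (f := fun p : dprod (dprod E (dpow (dprod dM D) n)) O => p.2)
      (g := fun p => p.1.2) dZ'); apply: dfun_cmap.
      exact: cmap_snd0.
    by apply: cmap_snd; exact: cmap_fst0.
  exact: (tp W dW zR).
have [q [fq iq uq qF]] := invariant_ultra S_omin S_sat A00 sA fF iF.
exists q; split=> // c ec; apply: qF; split; first exact: dall_sec dZ.
by exists 1%N, (c, tt); split=> // w [].
Qed.

(** If every [B] failed, saturation would give one tuple of [n] segments without common point whose
    ends lie in all the sets [B] at once, that is, are conjugate to [c0]. But each such segment
    belongs to the invariant ultrafilter. *)
Lemma hull_meet n : exists B, [/\ dset A B, B c0 &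
  forall cs : dpow D n, allp (eqtp A c0.2) cs -> exists w, allp (hullset B ^~ w) cs].
Proof.
apply/not_notP => nB.
have bad B : dset A B -> B c0 -> exists z : dpow P n,
    allp (seg_in B) z /\ ~ (exists w, allp (segset^~ w) z).
  move=> dB Bc0.
  have [cs [ecs ncs]] : exists cs : dpow D n, allp (eqtp A c0.2) cs /\
      ~ exists w, allp (hullset B ^~ w) cs.
    apply/not_notP => H; apply: nB; exists B; split=> // cs ecs.
    by apply/not_notP => n1; apply: H; exists cs.
  have [||||z [Bz nz]] := @hull_seg n B cs (fun _ => True) dB.
  - exact: dset_true.
  - by move=> s w.
  - apply: allp_imp ecs => c ec.
    apply: (ec (fun c => exists s : dM, B (s, c))); first by dset_tac.
    by exists c0.1; case: (c0) Bc0.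
  - by move=> [w [_ Hw]]; apply: ncs; exists w.
  by exists z; split=> // -[w Hw]; apply: nz; exists w.
pose EB B (z : dpow P n) := allp (seg_in B) z /\ ~ (exists w, allp (segset^~ w) z).
have dEB B : dset A B -> dset A (EB B).
  move=> dB; apply: dset_and.
    have dsB : dset A (fun q : dprod (dunit S A0) P => seg_in B q.2).
      apply: (dset_ext (P := fun q : dprod (dunit S A0) P =>
        B (q.2.2.1, q.2.1) /\ (B (q.2.2.2, q.2.1) /\ q.2.2.1 <= q.2.2.2))).
        by move=> z; split=> [[h1 [h2 h3]]|[]].
      by dset_tac.
    have dA := dset_allp n (Q := fun _ => seg_in B) dsB.
    apply: (dset_comp2 (R := fun (_ : dunit S A0) z => allp (seg_in B) z) (f := fun _ => tt) dA).
      by apply: dfun_cst; apply: dset_ext (dset_true _ _) => -[].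
    exact/dfun_cmap/cmap_id.
  apply: dset_not; apply: (dset_ex (U := O)).
  have dZ' := dset_allp n (Q := fun w c => segset c w)
      (dset_cmap (f := fun q : dprod O P => (q.2, q.1) : dprod P O)
         (cmap_pair (cmap_snd0 _ _) (cmap_fst0 _ _)) dset_seg).
  apply: (dset_comp2 (R := fun w z => allp (segset^~ w) z)
    (f := fun p : dprod (dpow P n) O => p.2) (g := fun p => p.1) dZ'); apply: dfun_cmap.
    exact: cmap_snd0.
  exact: cmap_fst0.
have [|s sP|z zP] := @dsat _ _ _ _ S_sat (dpow P n) A
    [set Q | exists B, [/\ dset A B, B c0 & Q = EB B]] sA.
- by move=> Q [B [dB _ ->]]; exact: dEB.
- have [B [dB Bc0 BP]] : exists B, [/\ dset A B, B c0 & forall Q, Q \in s -> forall z, EB B z -> Q z].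
    elim: s sP => [|Q s IH] sP.
      by exists (fun _ => True); split=> //; exact: dset_true.
    have [|B [dB Bc0 BP]] := IH; first by move=> R Rs; apply: sP; rewrite inE Rs orbT.
    have [B' [dB' B'c0 QE]] := sP Q (mem_head _ _).
    exists (fun c => B c /\ B' c); split=> //; first exact: dset_and.
    move=> R; rewrite inE => /orP[/eqP->|/BP H] z [az nz]; last first.
      by apply: H; split=> //; apply: allp_imp az => p [[? _] [? _] ?]; split.
    by rewrite QE; split=> //; apply: allp_imp az => p [[_ ?] [_ ?] ?]; split.
  have [z Ez] := bad B dB Bc0; exists z => Q Qs; exact: BP Ez.
have zB B : dset A B /\ B c0 -> allp (seg_in B) z.
  by move=> [dB Bc0]; case: (zP (EB B)) => //; exists B.
have [q [fq iq uq qZ]] := conj_filter.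
have [_ nz] : EB (fun _ => True) z by apply: zP; exists (fun _ => True); split=> //; exact: dset_true.
apply: nz.
have {}zB : allp (fun p => forall B : {B | dset A B /\ B c0}, seg_in (sval B) p) z.
  by apply: allp_all => -[B BP]; exact: zB.
have zq : allp (fun p => q (segset p)) z.
  apply: allp_imp zB => p pB; apply: (q_seg fq iq uq qZ).
  - by move=> Q dQ Qc0; case: (pB (exist _ Q (conj dQ Qc0))).
  - by move=> Q dQ Qc0; case: (pB (exist _ Q (conj dQ Qc0))).
  - by case: (pB (exist _ (fun _ => True) (conj (dset_true _ _) I))).
suff : q (fun w => allp (segset^~ w) z) by move/(dfilter_ex fq).
elim: n z {zB zP dEB EB bad nB} zq => [|n IH] /= z; first by move=> _; exact: dfilterT.
by move=> [q1 /IH q2]; exact: (dfilterI fq q1 q2).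
Qed.

End Step.
End PeterzilPillay.

(** * Definable points of closed sets *)

Section PeterzilPillayTheorem.
Variables (L : language) (M : rcfType) (S : expansion L M) (A0 : set M).
Hypotheses (S_omin : o_minimal S) (S_sat : saturated S) (A00 : A0 0).
Hypothesis sA0 : small A0.
Variable A : set M.
Hypothesis sA : small (A0 `|` A).
Local Notation dtype := (dtype S A0).
Local Notation dM := (dM S A0).
Local Notation ltype := (ltype S A0).

(** On finitely many points a hull cannot be told from a sufficiently long segment. *)
Lemma seg_approx (O : ltype) (D : dtype) (Z : dprod dM D -> O -> Prop)
    (B : dprod dM D -> Prop) c s0 (xs : seq O) : B (s0, c) ->
  exists p : dprod dM dM, seg_in B (c, p) /\
    all (fun x => `[< segset Z (c, p) x >] == `[< hullset Z B c x >]) xs.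
Proof.
move=> Bs0; elim: xs => [|x xs [[s s'] [[/= Bs Bs' ss'] sP]]].
  by exists (s0, s0); split.
have hs u u' y : B (u, c) -> B (u', c) -> hullset Z B c y -> segset Z (c, (u, u')) y.
  by move=> Bu Bu' H t h1 h2; exact: (H u u').
case: (pselect (hullset Z B c x)) => [Hx|nHx].
  exists (s, s'); split=> //=; rewrite sP andbT; apply/eqP/asbool_equiv_eq.
  by split=> // _; exact: hs.
have [s1 [s1' [t [Bs1 Bs1' s1t ts1' nZ]]]] : exists s1 s1' t,
    [/\ B (s1, c), B (s1', c), s1 <= t, t <= s1' & ~ Z (t, c) x].
  apply/not_notP => n; apply: nHx => s1 s1' t h1 h2 h3 h4; apply/not_notP => nZ; apply: n.
  by exists s1, s1', t.
have Bmin : B (Num.min s s1, c) by case: (leP s s1).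
have Bmax : B (Num.max s' s1', c) by case: (leP s' s1').
exists (Num.min s s1, Num.max s' s1'); split.
  by split=> //=; rewrite ge_min !le_max ss'.
apply/andP; split.
  apply/eqP/asbool_equiv_eq; split=> // H; exfalso; apply: nZ; apply: H => /=.
    by rewrite ge_min s1t orbT.
  by rewrite le_max ts1' orbT.
apply: sub_all sP => y /eqP yE; apply/eqP; apply: asbool_equiv_eq; split; last exact: hs.
move=> H; apply/asboolP; rewrite -yE; apply/asboolP => u /= su us'; apply: H => /=.
  by rewrite ge_min su.
by rewrite le_max us'.
Qed.

(** [B] will be chosen after the constants, so trace bounds for its hulls must not depend on it;
    they are inherited from the segments, which form one fixed family. *)
Lemma hull_trb (O : ltype) (D : dtype) (Z : dprod dM D -> O -> Prop)
    (B : dprod dM D -> Prop) n (h : 'I_n -> D) C d C' d' :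
  (forall i, exists s, B (s, h i)) ->
  trb (fun w p => segset Z p w) C d -> trb (segset Z) C' d' ->
  trb (fun w i => hullset Z B (h i) w) C d /\ trb (fun i w => hullset Z B (h i) w) C' d'.
Proof.
move=> Bh t1 t2.
have appr (xs : seq O) : exists g : 'I_n -> dprod dM dM, forall i,
    all (fun x => `[< segset Z (h i, g i) x >] == `[< hullset Z B (h i) x >]) xs.
  have ex i : exists p : dprod dM dM,
      all (fun x => `[< segset Z (h i, p) x >] == `[< hullset Z B (h i) x >]) xs.
    by have [s0 Bs0] := Bh i; have [p [_ pP]] := seg_approx Z xs Bs0; exists p.
  by have [g gP] := choice ex; exists g.
split; apply: trb_fin => F us.
- have [g gP] := appr F; have [E [sE EP]] := t1 F; exists E; split=> //.
  apply/allP => i _; have := EP (h i, g i).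
  have -> // : [seq `[< segset Z (h i, g i) f >] | f <- F] = [seq `[< hullset Z B (h i) f >] | f <- F].
  have := gP i; move: {gP EP sE} (g i) => gi.
  by elim: F => //= x F IH /andP[/eqP -> /IH ->].
- have [g gP] := appr us; have [E [sE EP]] := t2 [seq (h i, g i) | i <- F].
  rewrite size_map in sE; exists E; split=> //.
  suff : all (fun u => [seq `[< segset Z (h i, g i) u >] | i <- F] ==
                       [seq `[< hullset Z B (h i) u >] | i <- F]) us.
    by apply: sub_all => u /eqP <-; have := EP u; rewrite -map_comp.
  elim: F {sE EP} => [|i F IH]; first by elim: us {gP}.
  have := gP i; move: IH => /[swap]; elim: {gP} us => //= u us' IHu /andP[/eqP E1 H1] /andP[/eqP E2 H2].
  by rewrite E1 E2 eqxx IHu.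
Qed.

(** The induction removes the first parameter. [Z' c] consists of tuples with an entry in the hull
    over [B]; conjugates of [c0.2] have hulls meeting [N0] at a time, hence by [comb] any finite
    number of them is pierced by [K] points, which make up a tuple common to their sets [Z']. A
    definable tuple in [Z' c0.2] has an entry in [Z c0], and its entries are definable. *)
Theorem peterzil_pillay k (O : ltype) (Z : dpow dM k -> O -> Prop) :
  dset A (fun q : dprod (dpow dM k) O => Z q.1 q.2) -> (forall c, cclosed (Z c)) ->
  forall c0, (forall n (z : dpow (dpow dM k) n), allp (eqtp A c0) z ->
    exists w, allp (Z^~ w) z) ->
  exists2 w, Z c0 w & dset A (fun x : O => x = w).
Proof.
elim: k O Z => [|k IH] O Z dZ cZ c0 fip.
  have [w [Zw _]] := fip 1%N (c0, tt) (conj (@eqtp_refl _ _ _ _ _ _ _) I).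
  apply: (dpoint S_omin); last by exists w.
  apply: dset_fiber dZ _; apply: dset_ext (dset_true _ _) => -[]; by case: c0 {fip Zw}.
pose D := dpow dM k.
have ds := dset_seg (D := D) dZ.
have [C' [d' tr']] := nip S_omin S_sat sA ds.
have [C [d tr]] : exists C d, trb (fun w p => segset Z p w) C d.
  apply: (@nip _ _ _ _ S_omin S_sat O _ A (fun w p => segset Z p w) sA).
  by apply: (dset_cmap (f := fun q : dprod O (dprod D (dprod dM dM)) => (q.2, q.1) :
    dprod (dprod D (dprod dM dM)) O) _ ds); cmap_tac.
have [N0 [K combP]] := comb C d C' d'.
have [B [dB Bc0 BP]] := hull_meet S_omin S_sat A00 sA0 sA dZ cZ fip N0.
have [w0 _] := fip 0%N tt I.
pose Z' (c : D) (y : lpow O K.+1) := exp (hullset Z B c) y.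
have dZ' : dset A (fun q : dprod D (lpow O K.+1) => Z' q.1 q.2).
  exact: dset_exp (dset_hull dZ dB).
have dhull c : dall (hullset Z B c) by exact: dall_sec (dset_hull dZ dB).
have cZ' c : cclosed (Z' c).
  by apply: cclosed_exp => //; exact: cclosed_hull.
have [|y Zy dy] := IH _ Z' dZ' cZ' c0.2; last first.
  have [f [cf Hf]] := exp_ex Zy.
  exists (f y); last by apply: (dpt_fun _ dy); exact: dfun_cmap.
  case: (c0) Bc0 Hf => t c Bc0 Hf; exact: (Hf t t t).
move=> n z ez; have [h hP] := allp_ord z.
have eh : forall i, eqtp A c0.2 (h i) by exact/hP.
have Bh i : exists s, B (s, h i).
  apply: (eh i (fun c => exists s : dM, B (s, c))); first by dset_tac.
  by exists c0.1; case: (c0) Bc0.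
have [t1 t2] := hull_trb Bh tr tr'.
have [|xs [sxs xsP]] := combP 'I_n O (fun i w => hullset Z B (h i) w) t1 t2.
  move=> s sN.
  have [cs [sz csE csP]] : exists cs : seq D, [/\ size cs = N0, all (fun c => `[< eqtp A c0.2 c >]) cs &
      forall Q : D -> Prop, all (fun c => `[< Q c >]) cs -> all (fun i => `[< Q (h i) >]) s].
    (* The list is filled up with [c0.2], since [BP] speaks of exactly [N0] conjugates. *)
    exists ([seq h i | i <- s] ++ nseq (N0 - size s) c0.2); split.
    - by rewrite size_cat size_map size_nseq subnKC.
    - rewrite all_cat; apply/andP; split.
        by rewrite all_map; apply/allP => i _; apply/asboolP.
      by rewrite all_nseq; apply/orP; right; apply/asboolP; exact: eqtp_refl.
    - by move=> Q; rewrite all_cat all_map => /andP[].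
  have [z' z'P] : exists z' : dpow D N0, forall Q, allp Q z' <-> all (fun t => `[< Q t >]) cs.
    by rewrite -sz; exact: allp_seq.
  have [|w wP] := BP z'; first exact/z'P.
  by exists w; apply: (csP (hullset (D := D) Z B ^~ w)); apply/z'P.
have [||y yP] := @exp_seq _ _ _ _ O (if xs is [::] then [:: w0] else xs) K.+1.
- by case: (xs) sxs => //= *; exact: leqW.
- by case: (xs).
exists y; apply/hP => i; apply: yP; have := xsP i; by case: (xs).
Qed.

Corollary peterzil_pillay_dtype (T : dtype) (O : ltype) (Z : T -> O -> Prop) :
  dset A (fun q : dprod T O => Z q.1 q.2) -> (forall c, cclosed (Z c)) ->
  (forall n (z : dpow T n), exists w, allp (Z^~ w) z) ->
  forall c, exists2 w, Z c w & dset A (fun x : O => x = w).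
Proof.
move=> dZ cZ fip c.
have demb : dfun A (@emb _ _ _ _ T) by exact/dfun_cmap/cmap_emb.
have [|||w H dw] := @peterzil_pillay (ddim T) O
    (fun v w => forall t : T, v = emb t -> Z t w) _ _ (emb c).
- by dset_tac.
- by move=> v; apply: cclosed_all => t; exact: cclosed_imp.
(* Entries of [z] outside the image of [emb] impose no condition and are dropped. *)
- move=> n z _; suff [z' zz'] : exists m, exists z' : dpow T m, forall w,
      allp (Z^~ w) z' -> allp (fun v => forall t : T, v = emb t -> Z t w) z.
    by have [z2 H] := zz'; have [w wz] := fip _ z2; exists w; exact: H.
  elim: n z => [|n IH] /= z; first by exists 0%N, tt.
  case: z => v z; have [m [z' H]] := IH z.
  case: (pselect (exists t : T, v = emb t)) => [[t vt]|nv].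
    exists m.+1, (t, z') => w [/= Zt /H ?]; split=> //= t'; rewrite vt => /emb_inj <-; exact: Zt.
  by exists m, z' => w /H Hz; split=> //= t vt; case: nv; exists t.
by exists w => //; exact: H.
Qed.

End PeterzilPillayTheorem.

(** * Boxes *)

Section Boxes.
Variables (L : language) (M : rcfType) (S : expansion L M) (A0 : set M).
Hypotheses (S_omin : o_minimal S) (S_sat : saturated S).
Hypothesis sA0 : small A0.
Local Notation dtype := (dtype S A0).
Local Notation dM := (dM S A0).
Local Notation dvec := (dvec S A0).

Lemma dpt_all (T : dtype) (t : T) : dset [set: M] (fun x : T => x = t).
Proof.
by apply: (@dset_mono _ _ _ _ T (set0 `|` range (denc t 0))) => //; exact: dpt_addpar.
Qed.

Definition homog (T : Type) (Q : T -> Prop) (W : T -> Prop) :=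
  (forall y, W y -> Q y) \/ (forall y, W y -> ~ Q y).

Lemma homog_sub (T : Type) (Q W W' : T -> Prop) :
  (forall y, W' y -> W y) -> homog Q W -> homog Q W'.
Proof. by move=> WW [H|H]; [left|right] => y /WW /H. Qed.

(** The intervals are successive left halves. If [E t] is not constant on one of them, both values
    occur there and lengthen any alternation found further right; as alternations are bounded, one
    of the intervals is homogeneous. *)
Lemma hom_interval (T : dtype) (E : T -> dM -> Prop) (a b : M) : a < b ->
  dall (fun q : dprod T dM => E q.1 q.2) ->
  exists s : seq (M * M), all (fun p => [&& a <= p.1, p.1 < p.2 & p.2 <= b]) s /\
    forall t, has (fun p => `[< homog (E t) (fun y => p.1 < y < p.2) >]) s.
Proof.
move=> ab dE; have [m [p dEp]] := dall_par dE.
have [r rP] := alt_bound S_omin S_sat (small_dpar sA0 p) dEp.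
suff [s [sP H]] : exists s : seq (M * M), all (fun p => [&& a <= p.1, p.1 < p.2 & p.2 <= b]) s /\
    forall F : M -> Prop, has (fun p => `[< homog F (fun y => p.1 < y < p.2) >]) s \/
      forall c, altf F c r a.
  exists s; split=> // t; case: (H (E t)) => // aE.
  by exfalso; apply: (rP t a); left; exact: aE.
elim: r {rP} a ab => [|r IH] a ab; first by exists [::]; split=> // F; right.
have [am mb] := midf_lt ab; have [s [sP H]] := IH _ mb; set c := (a + b) / 2 in am mb sP H.
exists ((a, c) :: s); split.
  rewrite /= lexx am (ltW mb) /=; apply: sub_all sP => q /and3P[h1 h2 h3].
  by rewrite h2 h3 (le_trans (ltW am) h1).
move=> F /=; case: (pselect (homog F (fun y => a < y < c))) => [h|nh].
  by left; rewrite asboolT.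
case: (H F) => [->|aF]; first by left; rewrite orbT.
right=> e.
have [y [/andP[ay yc] yE]] : exists y, a < y < c /\ (F y <-> e).
  apply/not_notP => n; apply: nh; case: e n => n; [right|left] => y ayc.
    by move=> Fy; apply: n; exists y.
  by apply/not_notP => nF; apply: n; exists y; split=> //; split.
exists y; split=> //; first exact: ltW.
by apply: altf_le (aF (~~ e)); exact: ltW.
Qed.

Definition box d := {ffun 'I_d -> M * M}.
Definition inb d (b : box d) (v : 'rV[M]_d) := forall i, (b i).1 < v 0 i < (b i).2.
Definition pbox d (b : box d) := forall i, (b i).1 < (b i).2.
Definition sbox d (b b' : box d) := forall i, (b i).1 <= (b' i).1 /\ (b' i).2 <= (b i).2.

Lemma inb_sub d (b b' : box d) v : sbox b b' -> inb b' v -> inb b v.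
Proof.
move=> bb' bv i; have [h1 h2] := bb' i; have /andP[h3 h4] := bv i.
by rewrite (le_lt_trans h1 h3) (lt_le_trans h4 h2).
Qed.

Lemma sbox_trans d (b b' b'' : box d) : sbox b b' -> sbox b' b'' -> sbox b b''.
Proof.
move=> h h' i; have [h1 h2] := h i; have [h3 h4] := h' i.
by split; [exact: le_trans h1 h3|exact: le_trans h4 h2].
Qed.

Lemma pbox_point d (b : box d) : pbox b -> exists v, inb b v.
Proof.
move=> pb; exists (\row_i (((b i).1 + (b i).2) / 2)) => i; rewrite mxE.
by have [-> ->] := midf_lt (pb i).
Qed.

Definition bcons d (p : M * M) (b : box d) : box (1 + d) :=
  [ffun i : 'I_(1 + d) => match fintype.split i with inl _ => p | inr j => b j end].

Lemma inb_cons d p (b : box d) (y : M) x :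
  inb (bcons p b) (row_mx (y%:M : 'rV[M]_1) x) <-> p.1 < y < p.2 /\ inb b x.
Proof.
rewrite /inb /bcons; split.
  move=> H; split.
    have := H (lshift d ord0); rewrite ffunE row_mxEl mxE eqxx mulr1n.
    by rewrite (unsplitK (inl _ : 'I_1 + 'I_d)).
  by move=> i; have := H (rshift 1 i); rewrite ffunE row_mxEr (unsplitK (inr _ : 'I_1 + 'I_d)).
move=> [py bx] i; rewrite ffunE mxE; case: (fintype.split i) => j //.
by rewrite (ord1 j) mxE eqxx mulr1n.
Qed.

Definition hom_box_stmt d := forall (T : dtype) (E : T -> dvec d -> Prop) (b : box d),
  dall (fun q : dprod T (dvec d) => E q.1 q.2) -> pbox b ->
  exists s : seq (box d), all (fun b' => `[< pbox b' /\ sbox b b' >]) s /\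
    forall t, has (fun b' => `[< homog (E t) (inb b') >]) s.

(** [Q] stands for the homogeneity already achieved, which smaller boxes inherit. *)
Lemma hom_refine d : hom_box_stmt d ->
  forall (T : dtype) (E : T -> dvec d -> Prop) (b : box d) (s : seq (box d)),
  dall (fun q : dprod T (dvec d) => E q.1 q.2) ->
  all (fun b' => `[< pbox b' /\ sbox b b' >]) s ->
  exists s' : seq (box d), all (fun b' => `[< pbox b' /\ sbox b b' >]) s' /\
    forall t (Q : box d -> Prop), (forall b1 b2, sbox b1 b2 -> Q b1 -> Q b2) ->
      has (fun b' => `[< Q b' >]) s ->
      has (fun b' => `[< Q b' /\ homog (E t) (inb b') >]) s'.
Proof.
move=> hb T E b s dE; elim: s => [|b1 s IH] /=; first by exists [::].
move=> /andP[/asboolP[pb1 sb1] /IH[s' [s'P H]]].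
have [s1 [s1P H1]] := hb T E b1 dE pb1.
exists (s1 ++ s'); split.
  rewrite all_cat s'P andbT; apply: sub_all s1P => b2 /asboolP[pb2 sb2]; apply/asboolP.
  by split=> //; exact: sbox_trans sb1 sb2.
move=> t Q QS /orP[/asboolP Qb1|/(H t Q QS) h]; rewrite has_cat; last by rewrite h orbT.
have [b2 [/asboolP[_ sb2] /asboolP hb2]] := all_has_ex s1P (H1 t).
apply/orP; left; have := H1 t; have := s1P; elim: (s1) => //= b3 s2 IHs.
move=> /andP[/asboolP[_ sb3] hs2] /orP[/asboolP h3|h3].
  by apply/orP; left; apply/asboolP; split=> //; exact: QS Qb1.
by rewrite IHs ?orbT.
Qed.

Lemma hom_boxes d : hom_box_stmt d ->
  forall n (T : dtype) (E : nat -> T -> dvec d -> Prop) (b : box d),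
  (forall j, dall (fun q : dprod T (dvec d) => E j q.1 q.2)) -> pbox b ->
  exists s : seq (box d), all (fun b' => `[< pbox b' /\ sbox b b' >]) s /\
    forall t, has (fun b' => `[< forall j, (j < n)%N -> homog (E j t) (inb b') >]) s.
Proof.
move=> hb n T E b dE pb; elim: n => [|n [s [sP H]]].
  exists [:: b]; split=> [|t] /=.
    by rewrite andbT; apply/asboolP; split=> // i.
  by rewrite orbF; apply/asboolP.
have [s' [s'P H']] := hom_refine hb (dE n) sP.
exists s'; split=> // t.
have := H' t (fun b' => forall j, (j < n)%N -> homog (E j t) (inb b')) _ (H t).
have mono : forall b1 b2, sbox b1 b2 -> (forall j, (j < n)%N -> homog (E j t) (inb b1)) ->
    forall j, (j < n)%N -> homog (E j t) (inb b2).
  by move=> b1 b2 sb h j /h; apply: homog_sub => v; exact: inb_sub.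
move=> /(_ mono); apply: sub_has => b' /asboolP[h1 h2]; apply/asboolP => j.
by rewrite ltnS leq_eqVlt => /orP[/eqP->|/h1].
Qed.

(** Over each point of the last coordinates some interval of a finite list is homogeneous; which
    one, and with which value, is a definable condition on that point, to which the induction
    applies. *)
Lemma hom_box d : hom_box_stmt d.
Proof.
elim: d => [|d IH] T E b dE pb.
  exists [:: b]; split=> [|t] /=; first by rewrite andbT; apply/asboolP; split=> // i.
  rewrite orbF; apply/asboolP; case: (pselect (E t 0)) => h; [left|right] => v _.
    by have -> : v = 0 by apply/rowP => -[].
  by have -> : v = 0 by apply/rowP => -[].
pose cons (y : dM) (x : dvec d) : dvec d.+1 := row_mx (y%:M : 'rV[M]_1) x.
have ccons : cmap (fun q : dprod dM (dvec d) => cons q.1 q.2).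
  by exists id => q; apply/rowP => i; rewrite !mxE.
have dcons : dfun setT (fun q : dprod dM (dvec d) => cons q.1 q.2) by exact: dfun_cmap.
pose E' (q : dprod T (dvec d)) (y : dM) := E q.1 (cons y q.2).
have dE' : dall (fun q : dprod (dprod T (dvec d)) dM => E' q.1 q.2).
  by move: dE; rewrite /dall /E' => dE; dset_tac.
pose b0 := b (@lshift 1 d ord0).
have [s1 [s1P H1]] := hom_interval (pb (@lshift 1 d ord0)) dE'.
(* The index [j] encodes the interval [j./2] of the list together with the truth value [odd j]. *)
pose H j (t : T) (x : dvec d) := forall y : dM,
  ((nth b0 s1 j./2).1 < y /\ y < (nth b0 s1 j./2).2) -> (E t (cons y x) <-> odd j).
have dH j : dall (fun q : dprod T (dvec d) => H j q.1 q.2).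
  have d1 := dpt_all ((nth b0 s1 j./2).1 : dM); have d2 := dpt_all ((nth b0 s1 j./2).2 : dM).
  by move: dE; rewrite /dall /H => dE; dset_tac.
pose b' : box d := [ffun i => b (@rshift 1 d i)].
have pb' : pbox b' by move=> i; rewrite ffunE; exact: pb.
have [s2 [s2P H2]] := hom_boxes IH (size s1).*2 dH pb'.
exists [seq bcons p b2 | p <- s1, b2 <- s2]; split.
  apply/allP => _ /allpairsP[[p b2] /= [/(allP s1P)/and3P[p1 p2 p3] /(allP s2P) h ->]].
  move/asboolP: h => [pb2 sb2]; apply/asboolP; split=> i; rewrite ffunE.
    by case: (@fintype.split 1 d i).
  case: (@fintype.splitP 1 d i) => j ij; last first.
    have -> : i = @rshift 1 d j by apply: val_inj.
    by have := sb2 j; rewrite ffunE.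
  by have -> : i = @lshift 1 d ord0 by apply: ord_inj; rewrite ij (ord1 j).
move=> t; have /hasP[b2 b2s /asboolP h2] := H2 t.
have /asboolP[pb2 _] := allP s2P b2 b2s.
have [x bx] := pbox_point pb2.
have [j [js Hj]] : exists j, (j < (size s1).*2)%N /\ H j t x.
  have /hasP[p ps /asboolP hp] := H1 (t, x).
  pose i := index p s1; have is1 : (i < size s1)%N by rewrite index_mem.
  case: hp => hp.
    exists i.*2.+1; split; first by rewrite -doubleS leq_double.
    move=> y; rewrite /= uphalf_double nth_index // odd_double /= => -[h3 h4].
    by split=> // _; apply: hp; rewrite h3.
  exists i.*2; split; first by rewrite ltn_double.
  move=> y; rewrite doubleK nth_index // odd_double /= => -[h3 h4].
  by split=> // h; case: (hp y) => //; rewrite h3.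
have Hjb v : inb b2 v -> H j t v.
  have [h|h] := h2 j js; first exact: h.
  by have := h x bx.
apply/hasP; exists (bcons (nth b0 s1 j./2) b2).
  by apply: allpairs_f => //; apply: mem_nth; rewrite ltn_half_double.
apply/asboolP.
have E1 v : inb (bcons (nth b0 s1 j./2) b2) v -> (E t v <-> odd j).
  rewrite -(@hsubmxK _ 1 1 d v) [lsubmx v]mx11_scalar => /inb_cons[/andP[h3 h4] /Hjb Hx].
  exact: Hx.
by case: (odd j) E1 => E1; [left|right] => v /E1 [h3 h4]; [exact: h4|move/h3].
Qed.

End Boxes.

(** * The definable group topology *)

Section GroupTopology.
Variables (L : language) (M : rcfType) (S : expansion L M) (A0 : set M).
Hypotheses (S_omin : o_minimal S) (S_sat : saturated S) (A00 : A0 0).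
Hypothesis sA0 : small A0.
Local Notation dtype := (dtype S A0).
Local Notation dM := (dM S A0).
Local Notation dvec := (dvec S A0).

Lemma dset_ord (T : dtype) A m (P : 'I_m -> T -> Prop) :
  (forall j, dset A (P j)) -> dset A (fun t => forall j, P j t).
Proof.
move=> dP; have : dset A (fun t => forall j, j \in enum 'I_m -> P j t).
  elim: (enum 'I_m) => [|j s IH]; first by apply: dset_ext (dset_true T A) => t; split.
  apply: dset_ext (dset_and (dP j) IH) => t; split.
    by move=> [Pj H] i; rewrite inE => /orP[/eqP->|/H].
  move=> H; split; first by apply: H; rewrite mem_head.
  by move=> i si; apply: H; rewrite inE si orbT.
apply: dset_ext => t; split=> H j; first by apply: H; rewrite mem_enum.
by move=> _; exact: H.
Qed.

Lemma dfun_coord (T : dtype) A m (g : T -> dvec m) j : dfun A g ->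
  dfun A (fun t => g t 0 j : dM).
Proof.
move=> dg; apply: (dfun_comp (g := fun v : dvec m => v 0 j : dM) _ dg).
apply: dfun_cmap; exists (fun _ : 'I_1 => j) => v.
by apply/rowP => i; rewrite !mxE (ord1 i) eqxx mulr1n.
Qed.

Definition ballbox m (w : 'rV[M]_m) (e : M) : box M m :=
  [ffun j => (w 0 j - e, w 0 j + e)].

Lemma inb_ball m (w v : 'rV[M]_m) e : 0 < e -> inb (ballbox w e) v <-> ball w e v.
Proof.
move=> e0; split.
  move=> H; split=> // i j; have := H j; rewrite ffunE /= (ord1 i) => /andP[h1 h2].
  by rewrite /ball /= ltr_distlC h1 h2.
move=> [_ H] j; have := H 0 j; rewrite ffunE /ball /= ltr_distlC => /andP[-> ->] //.
Qed.

Lemma dset_inb (T : dtype) A m (g : T -> dvec m) (b : T -> box M m) :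
  dfun A g -> (forall j, dfun A (fun t => (b t j).1 : dM)) ->
  (forall j, dfun A (fun t => (b t j).2 : dM)) -> dset A (fun t => inb (b t) (g t)).
Proof.
move=> dg d1 d2.
apply: (@dset_ext _ _ _ _ T A (fun t => forall j, (b t j).1 < g t 0 j /\ g t 0 j < (b t j).2)).
  move=> t; split=> H j; first by have [-> ->] := H j.
  by have /andP[] := H j.
by apply: dset_ord => j; apply: dset_and; apply: dset_lt => //; exact: dfun_coord.
Qed.

Lemma dset_ballbox (T : dtype) A m (g h : T -> dvec m) (e : T -> dM) :
  dfun A g -> dfun A h -> dfun A e -> dset A (fun t => inb (ballbox (g t) (e t)) (h t)).
Proof.
move=> dg dh de; apply: dset_inb => // j.
  apply: (@dset_ext _ _ _ _ _ _ (fun p : dprod T dM => p.2 = g p.1 0 j - e p.1)).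
    by move=> p; rewrite ffunE.
  exact: (dfun_addM (f := fun t => g t 0 j) (g := fun t => - e t) (dfun_coord j dg) (dfun_oppM de)).
apply: (@dset_ext _ _ _ _ _ _ (fun p : dprod T dM => p.2 = g p.1 0 j + e p.1)).
  by move=> p; rewrite ffunE.
exact: (dfun_addM (f := fun t => g t 0 j) (g := e) (dfun_coord j dg) de).
Qed.

Lemma open_inb m (b : box M m) : open [set v : 'rV[M]_m | inb b v].
Proof.
rewrite openE => v bv.
exists (fun _ j => [set y | (b j).1 < y < (b j).2]) => [i j|w H]; last by move=> j; exact: H.
have := bv j; rewrite (ord1 i) => /andP[h1 h2].
apply/nbhs_ballP; exists (Num.min (v 0 j - (b j).1) ((b j).2 - v 0 j)).
  by rewrite /= lt_min !subr_gt0 h1.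
move=> y; rewrite /ball /= lt_min !ltr_norml => /andP[/andP[h3 h4] /andP[h5 h6]].
by apply/andP; split; lra.
Qed.

Variables (G : topologicalZmodType) (n : nat) (code : G -> 'rV[M]_n).
Hypotheses (code_inj : injective code) (code_ran : definable_over S A0 (range code)).
Definition dG : dtype := DType code_inj code_ran.

Variables (d k : nat) (U : 'I_k -> set G) (f : 'I_k -> G -> 'rV[M]_d).
Hypothesis Ucov : forall x : G, exists i, U i x.
Hypothesis Uopen : forall i, open (U i).
Hypothesis fdef : forall i, definable_over S A0 [set row_mx (code x) (f i x) | x in U i].
Hypothesis finj : forall i, {in U i &, injective (f i)}.
Hypothesis fopen : forall i W, W `<=` U i -> (open W <-> open (f i @` W)).

Let ch i (x : dG) (v : dvec d) := U i x /\ v = f i x.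

Let dch A i : dset A (fun q : dprod dG (dvec d) => ch i q.1 q.2).
Proof.
have := definable_overS (@subsetUl _ A0 A) (fdef i); congr (definable_over S _ _).
apply/seteqP; split=> z /=; first by move=> [x Ux <-]; exists (x, f i x).
by move=> [[x v] [/= Ux ->] <-]; exists x.
Qed.

Let chart_inj i x y : U i x -> U i y -> f i x = f i y -> x = y.
Proof. by move=> Ux Uy; apply: finj; rewrite inE. Qed.

Lemma open_chart i (b : box M d) : open [set y | U i y /\ inb b (f i y)].
Proof.
apply/(fopen (i := i)); first by move=> y [].
have -> : f i @` [set y | U i y /\ inb b (f i y)] =
    (f i @` U i) `&` [set v | inb b v].
  apply/seteqP; split=> v /=; first by move=> [y [Uy by_] <-]; split=> //; exists y.
  by move=> [[y Uy <-] bv]; exists y.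
by apply: openI; [exact/(fopen (i := i))|exact: open_inb].
Qed.

Lemma chart_ball i x (N : set G) : U i x -> nbhs x N -> exists2 e, 0 < e &
  forall v, inb (ballbox (f i x) e) v -> exists y, [/\ U i y, N y & f i y = v].
Proof.
move=> Ux; rewrite nbhsE => -[B [oB Bx] BN].
have oW : open (f i @` (B `&` U i)).
  by apply/(fopen (i := i)); [move=> y []|apply: openI].
have : nbhs (f i x) (f i @` (B `&` U i)).
  by apply: open_nbhs_nbhs; split=> //; exists x.
move=> /nbhs_ballP[e /= e0 He]; exists e => // v /(inb_ball _ _ e0)/He[y [By Uy] <-].
by exists y; split=> //; exact: BN.
Qed.

Lemma chart_nbhs i x (N : set G) : U i x -> nbhs x N <-> exists2 e, 0 < e &
  forall y, U i y -> inb (ballbox (f i x) e) (f i y) -> N y.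
Proof.
move=> Ux; split.
  move=> /(chart_ball Ux)[e e0 H]; exists e => // y Uy /H[z [Uz Nz E]].
  by rewrite -(chart_inj Uz Uy E).
move=> [e e0 H].
have : nbhs x [set y | U i y /\ inb (ballbox (f i x) e) (f i y)].
  apply: open_nbhs_nbhs; split; first exact: open_chart.
  by split=> // j; rewrite ffunE /=; apply/andP; split; lra.
by apply: filterS => y [Uy]; exact: H.
Qed.

Lemma dset_closure (T : dtype) A (X : T -> dG -> Prop) :
  dset A (fun q : dprod T dG => X q.1 q.2) ->
  dset A (fun q : dprod T dG => closure (X q.1) q.2).
Proof.
move=> dX.
apply: (@dset_ext _ _ _ _ (dprod T dG) A (fun q => forall i : 'I_k, forall v : dvec d, ch i q.2 v ->
    forall e : dM, 0 < e -> exists y : dG, X q.1 y /\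
      exists v' : dvec d, ch i y v' /\ inb (ballbox v e) v')).
  move=> [t x] /=; split.
    move=> H N Nx; have [i Ux] := Ucov x; have /(chart_nbhs _ Ux)[e e0 He] := Nx.
    have [y [Xy [v' [[Uy ->] bv]]]] := H i (f i x) (conj Ux erefl) e e0.
    by exists y; split=> //; exact: He.
  move=> cx i v [Ux ->] e e0.
  have /cx[y [Xy [Uy iy]]] : nbhs x [set y | U i y /\ inb (ballbox (f i x) e) (f i y)].
    by apply/(chart_nbhs _ Ux); exists e.
  by exists y; split=> //; exists (f i y).
apply: dset_ord => i; have dchi := dch A i; have d0 := dpt_M0 S A0 A.
apply: (dset_all (U := dvec d)); apply: dset_imp; first by dset_tac.
apply: (dset_all (U := dM)); apply: dset_imp; first by dset_tac.
apply: (dset_ex (U := dG)); apply: dset_and; first by dset_tac.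
apply: (dset_ex (U := dvec d)); apply: dset_and; first by dset_tac.
by apply: (dset_ballbox (T := dprod (dprod (dprod (dprod (dprod T dG) (dvec d)) dM) dG) (dvec d))
  (g := fun p => p.1.1.1.2) (h := fun p => p.2) (e := fun p => p.1.1.2)); dfun_tac.
Qed.

Hypothesis G_comp : definably_compact S code.

(** Each set has a constant germ at [0]; if all germs were empty, points near [0] would be left
    uncovered. *)
Lemma eventually_one (I : finType) (P : I -> dM -> Prop) : (forall i, dall (P i)) ->
  (forall u, 0 < u -> exists i, P i u) ->
  exists i, exists2 b, 0 < b & forall u, 0 < u < b -> P i u.
Proof.
move=> dP cov; apply/not_notP => nex.
suff [b b0 H] : exists2 b, 0 < b & forall i, i \in enum I -> forall u, 0 < u < b -> ~ P i u.
  have [h1 h2] := midf_lt b0; have [i Pi] := cov _ h1.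
  by apply: (H i _ _ _ Pi); rewrite ?mem_enum // h1.
elim: (enum I) => [|i s [b b0 IH]]; first by exists 1.
have [b1 b10 [H1|H1]] := dset_eventually S_omin 0 (dP i).
  by case: nex; exists i, b1.
exists (Num.min b b1); first by rewrite lt_min b0.
move=> j; rewrite inE => /orP[/eqP->|js] u /andP[u0]; rewrite lt_min => /andP[ub ub1].
  by apply: H1; rewrite u0.
by apply: IH => //; rewrite u0.
Qed.

(** Definable compactness concerns continuous curves on an interval. Near [0] a definable curve
    stays in one chart and has continuous coordinates there, so it applies to a restriction. *)
Lemma curve_limit (s : dM -> dG) : dfun [set: M] s -> exists g : G, s x @[x --> 0^'+] --> g.
Proof.
move=> ds.
have dU i : dall (fun u : dM => U i (s u)).
  have dchi := dch setT i.
  apply: (@dset_ext _ _ _ _ dM setT (fun u => exists v : dvec d, ch i (s u) v)); last first.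
    by dset_tac.
  by move=> u; split=> [[v []]|Uu] //; exists (f i (s u)).
have [|i [b b0 Ub]] := eventually_one dU; first by move=> u _; exact: Ucov.
(* The value [0] outside the chart makes the coordinate a total definable function. *)
pose g j (u : dM) : dM := if `[< U i (s u) >] then f i (s u) 0 j else 0.
have dg j : dfun setT (g j).
  have dchi := dch setT i; have d0 := dpt_M0 S A0 setT; have dUi := dU i.
  apply: (@dset_ext _ _ _ _ (dprod dM dM) setT (fun p => (exists v : dvec d, ch i (s p.1) v /\
    p.2 = v 0 j) \/ (~ U i (s p.1) /\ p.2 = 0))).
    move=> [u y] /=; rewrite /g; case: asboolP => Uu; split.
    - by case=> [[v [[_ ->] ->]]|[]].
    - by move=> ->; left; exists (f i (s u)).
    - by case=> [[v [[/Uu]]]|[_ ->]].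
    - by move=> ->; right.
  apply: dset_or.
    apply: (dset_ex (U := dvec d)); apply: dset_and; first by dset_tac.
    apply: dset_eq; first by dfun_tac.
    by apply: (dfun_coord (T := dprod (dprod dM dM) (dvec d)) (g := fun p => p.2)); dfun_tac.
  by apply: dset_and; [apply: dset_not; exact: (dset_cmap (cmap_fst0 dM dM) dUi)|dset_tac].
have cg j : exists2 b, 0 < b & forall u, 0 < u < b -> ctsat (g j) u.
  have [m [p dgp]] := dall_par (dg j).
  exact: (dfun_ctsat S_omin S_sat 0 (small_dpar sA0 p) dgp).
have [b1 b10 cb1] : exists2 b, 0 < b & forall j, j \in enum 'I_d -> forall u, 0 < u < b ->
    ctsat (g j) u.
  elim: (enum 'I_d) => [|j r [b1 b10 IH]]; first by exists 1.
  have [b2 b20 H2] := cg j; exists (Num.min b1 b2); first by rewrite lt_min b10.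
  move=> j'; rewrite inE => /orP[/eqP->|jr] u /andP[u0]; rewrite lt_min => /andP[h1 h2].
    by apply: H2; rewrite u0.
  by apply: IH => //; rewrite u0.
pose c := Num.min b b1; have c0 : 0 < c by rewrite lt_min b0.
have [||//] := G_comp (a := 0) (b := c) (s := s) c0.
- have d0 := dpt_M0 S A0 setT; have dc := dpt_all (c : dM).
  have : dset setT (fun p : dprod dM dG => p.2 = s p.1 /\ (0 < p.1 /\ p.1 < c)) by dset_tac.
  move=> /(definable_overS (@subsetT _ _)); congr (definable_over S _ _).
  apply/seteqP; split=> z /=.
    by move=> [[u x] [/= -> [h1 h2]] <-]; exists u => //; rewrite in_itv /= h1.
  by move=> [u]; rewrite in_itv /= => /andP[h1 h2] <-; exists (u, s u).
move=> u; rewrite in_itv /= => /andP[u0 uc].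
have Uu : U i (s u).
  by apply: Ub; rewrite u0 (lt_le_trans uc) // ge_min lexx.
move=> N /(chart_nbhs _ Uu)[e e0 He].
have near_c : \forall v \near u, 0 < v < c.
  apply/nbhs_ballP; exists (Num.min u (c - u)); first by rewrite /= lt_min u0 subr_gt0.
  move=> y; rewrite /ball /= lt_min !ltr_norml => /andP[/andP[h3 h4] /andP[h5 h6]].
  by apply/andP; split; lra.
have near_g : \forall v \near u, forall j, g j u - e < g j v < g j u + e.
  have FF : Filter (nbhs (u : M)) by exact: nbhs_filter.
  apply: (@filter_forall M 'I_d (fun j => [set v | g j u - e < g j v < g j u + e]) _ FF) => j.
  have ub1 : 0 < u < b1 by rewrite u0 (lt_le_trans uc) // ge_min lexx orbT.
  have [|d1 [d10 Hd]] := cb1 j _ u ub1 e e0; first by rewrite mem_enum.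
  apply/nbhs_ballP; exists d1 => // y; rewrite /ball /= ltr_norml => /andP[h1 h2].
  by have [|| -> ->] := Hd y => //; lra.
rewrite /fmap /=; apply: filterS2 near_c near_g => v /andP[v0 vc] Hv /=.
have Uv : U i (s v).
  by apply: Ub; rewrite v0 (lt_le_trans vc) // ge_min lexx.
apply: He => // j; rewrite ffunE /=; have := Hv j.
by rewrite /g !asboolT.
Qed.

(** Homogeneous boxes of a chart, transported to the group. The list of open sets is finite and
    independent of [t], as pigeonhole arguments along a curve will require. *)
Lemma group_box m (T : dtype) (E : nat -> T -> dG -> Prop) (W : set G) :
  (forall j, dall (fun q : dprod T dG => E j q.1 q.2)) -> open W -> W !=set0 ->
  exists ws : seq (set G), (forall w, w \in ws -> [/\ open w, w !=set0, w `<=` W &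
      dall (w : dG -> Prop)]) /\
    forall t, exists2 w, w \in ws & forall j, (j < m)%N -> homog (E j t) w.
Proof.
move=> dE oW [x Wx]; have [i Ux] := Ucov x.
have [|e e0 He] := chart_ball (N := W) Ux; first by apply: open_nbhs_nbhs.
pose b := ballbox (f i x) e.
have pb : pbox b by move=> j; rewrite ffunE /=; lra.
pose E' j (t : T) (v : dvec d) := exists y : dG, ch i y v /\ E j t y.
have dE' j : dall (fun q : dprod T (dvec d) => E' j q.1 q.2).
  by have dchi := dch setT i; move: (dE j); rewrite /dall /E' => dEj; dset_tac.
have [s [sP sH]] := hom_boxes (@hom_box _ _ _ _ S_omin S_sat sA0 d) m dE' pb.
pose wb (b' : box M d) : set G := [set y | U i y /\ inb b' (f i y)].
exists [seq wb b' | b' <- s]; split.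
  move=> _ /mapP[b' b's ->]; have /asboolP[pb' sb'] := allP sP b' b's; split.
  - exact: open_chart.
  - have [v bv] := pbox_point pb'; have [y [Uy _ yv]] := He v (inb_sub sb' bv).
    by exists y; split=> //; rewrite yv.
  - move=> y [Uy /(inb_sub sb')/He[z [Uz Wz zy]]].
    by rewrite -(chart_inj Uz Uy zy).
  - have dchi := dch setT i.
    apply: (@dset_ext _ _ _ _ dG setT (fun y => exists v : dvec d, ch i y v /\ inb b' v)).
      by move=> y; split=> [[v [[Uy ->]]]//|[Uy bv]]; exists (f i y).
    apply: (dset_ex (U := dvec d)); apply: dset_and => //.
    apply: (dset_inb (T := dprod dG (dvec d)) (g := fun p => p.2) (b := fun _ => b'));
      first by dfun_tac.
      by move=> j; apply: dfun_cst; exact: dpt_all.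
    by move=> j; apply: dfun_cst; exact: dpt_all.
move=> t; have /hasP[b' b's /asboolP h] := sH t.
exists (wb b'); first exact: map_f.
move=> j /h[hj|hj]; [left|right] => y [Uy /hj].
  by move=> [z [[Uz /esym zy] Ez]]; rewrite -(chart_inj Uz Uy zy).
by move=> nE Ey; apply: nE; exists y.
Qed.

End GroupTopology.

(** * Thin and generic sets *)

Lemma count_tnth (T : Type) (s : seq T) (P : pred T) :
  #|[pred i : 'I_(size s) | P (tnth (in_tuple s) i)]| = count P s.
Proof.
rewrite -[RHS]sum1_count; transitivity (\sum_(p <- (in_tuple s : seq T) | P p) 1)%N; last by [].
by rewrite big_tuple -sum1_card; apply: eq_bigl => i; rewrite inE.
Qed.

Lemma sum_ltc (I : Type) (s : seq I) (F : I -> nat) e m : (0 < size s)%N ->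
  (forall i, e * F i < m)%N -> (e * \sum_(i <- s) F i < size s * m)%N.
Proof.
move=> s0 H; case: m H => [|m] H; first by case: s s0 => // i s _; have := H i.
rewrite big_distrr /= mulnS; apply: leq_ltn_trans (_ : (size s * m < _)%N).
  rewrite mulnC -sum1_size big_distrr /=; apply: leq_sum => i _.
  by rewrite muln1 -ltnS H.
by rewrite -[X in (X < _)%N]add0n ltn_add2r.
Qed.

Lemma sum_gec (I : Type) (s : seq I) (F : I -> nat) e m : (forall i, m <= e * F i)%N ->
  (size s * m <= e * \sum_(i <- s) F i)%N.
Proof.
move=> H; rewrite big_distrr /= mulnC -sum1_size big_distrr /=; apply: leq_sum => i _.
by rewrite muln1.
Qed.

Section Thin.
Local Open Scope nat_scope.
Variable G : zmodType.
Implicit Types (X Y : set G) (gs : seq G).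

Definition cnt X gs (x : G) := count (fun g => `[< X (x + g)%R >]) gs.

Definition thin e X := exists2 gs, 0 < size gs & forall x, e * cnt X gs x < size gs.

Lemma cntS X Y gs x : X `<=` Y -> cnt X gs x <= cnt Y gs x.
Proof. by move=> XY; apply: sub_count => g /asboolP/XY ?; apply/asboolP. Qed.

Lemma thinS e X Y : X `<=` Y -> thin e Y -> thin e X.
Proof.
move=> XY [gs gs0 H]; exists gs => // x; apply: leq_ltn_trans (H x).
by rewrite leq_mul2l cntS ?orbT.
Qed.

Lemma thin_le e e' X : e <= e' -> thin e' X -> thin e X.
Proof.
move=> ee [gs gs0 H]; exists gs => // x; apply: leq_ltn_trans (H x).
by rewrite leq_mul2r ee orbT.
Qed.

Lemma thin0 e : thin e set0.
Proof.
exists [:: 0%R] => // x; rewrite /cnt /= asboolF ?muln0 //.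
Qed.

Lemma thin_empty e X : (forall x, ~ X x) -> thin e X.
Proof. by move=> nX; apply: thinS (thin0 e) => x /nX. Qed.

Definition addl gs hs : seq G := [seq (g + h)%R | g <- gs, h <- hs].

(** Counting along a sum of two lists is summing the counts along translates of either list, so a
    bound for one factor survives. *)
Lemma cnt_addl X gs hs x : cnt X (addl gs hs) x = \sum_(g <- gs) cnt X hs (x + g)%R.
Proof.
rewrite /cnt /addl; elim: gs => [|g gs IH] /=; first by rewrite big_nil.
rewrite count_cat IH big_cons; congr (_ + _); rewrite count_map.
by apply: eq_count => h /=; rewrite addrA.
Qed.

Lemma cnt_addlC X gs hs x : cnt X (addl gs hs) x = \sum_(h <- hs) cnt X gs (x + h)%R.
Proof.
rewrite cnt_addl /cnt; under eq_bigr do rewrite -sum1_count big_mkcond.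
rewrite exchange_big /=; apply: eq_bigr => h _; rewrite -sum1_count [RHS]big_mkcond.
by apply: eq_bigr => g _; rewrite /= addrAC.
Qed.

Lemma size_addl gs hs : size (addl gs hs) = size gs * size hs.
Proof. by rewrite size_allpairs. Qed.

(** The sum of the two lists works for both sets at once. *)
Lemma thinU e X Y : thin (2 * e) X -> thin (2 * e) Y -> thin e (X `|` Y).
Proof.
move=> [gs gs0 HX] [hs hs0 HY]; exists (addl gs hs); first by rewrite size_addl muln_gt0 gs0.
move=> x; rewrite size_addl.
have h1 : cnt (X `|` Y) (addl gs hs) x <= cnt X (addl gs hs) x + cnt Y (addl gs hs) x.
  rewrite /cnt -count_predUI -[X in X <= _]addn0 leq_add //.
  by apply: sub_count => g /asboolP[?|?]; apply/orP; [left|right]; apply/asboolP.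
have h2 : 2 * e * cnt X (addl gs hs) x < size gs * size hs.
  rewrite cnt_addlC [X in _ < X]mulnC; apply: sum_ltc => // h; exact: HX.
have h3 : 2 * e * cnt Y (addl gs hs) x < size gs * size hs.
  rewrite cnt_addl; apply: sum_ltc => // g; exact: HY.
move: (cnt (X `|` Y) _ _) (cnt X _ _) (cnt Y _ _) (size gs * size hs) h1 h2 h3.
move=> a b c m; nia.
Qed.

Lemma thin_trans e X g : thin e X -> thin e [set x | X (x + g)%R].
Proof.
move=> [gs gs0 H]; exists gs => // x; have := H (x + g)%R; rewrite /cnt.
by under eq_count do rewrite /= addrAC.
Qed.

Lemma thin_cover (s : seq (set G)) : (forall X, X \in s -> forall e, thin e X) ->
  forall e, thin e [set x | exists2 X, X \in s & X x].
Proof.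
elim: s => [|Y s IH] H e; first by apply: thin_empty => x [].
apply: thinS (thinU (H Y (mem_head _ _) (2 * e)) (IH _ (2 * e))).
  by move=> x [X]; rewrite inE => /orP[/eqP->|Xs] Xx; [left|right; exists X].
by move=> X Xs; apply: H; rewrite inE Xs orbT.
Qed.

Lemma not_thinT e : 0 < e -> ~ thin e [set: G].
Proof.
move=> e0 [gs gs0 /(_ 0%R)]; rewrite /cnt (eq_count (a2 := predT)); last first.
  by move=> g; rewrite /= asboolT.
by rewrite count_predT ltnNge leq_pmull.
Qed.

End Thin.

Section AtLeast.
Variables (L : language) (M : rcfType) (S : expansion L M) (A0 : set M).
Local Notation dtype := (dtype S A0).

(** Counting with multiplicity in a tuple, as a definable condition. *)
Fixpoint atleast (T : dtype) n m (Q : T -> Prop) : dpow T n -> Prop :=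
  match n, m with
  | _, 0 => fun _ => True
  | 0, _.+1 => fun _ => False
  | n'.+1, m'.+1 => fun z : dprod T (dpow T n') =>
      (Q z.1 /\ atleast m' Q z.2) \/ atleast m'.+1 Q z.2
  end%N.

Lemma dset_atleast (T U : dtype) n m A (Q : U -> T -> Prop) :
  dset A (fun q : dprod U T => Q q.1 q.2) ->
  dset A (fun q : dprod U (dpow T n) => atleast m (Q q.1) q.2).
Proof.
move=> dQ; elim: n m => [|n IH] [|m] /=; try exact: dset_true.
  exact: dset_false.
have c2 : cmap (fun q : dprod U (dprod T (dpow T n)) => (q.1, q.2.2) : dprod U (dpow T n)).
  by cmap_tac.
apply: dset_or; last exact: (dset_cmap c2 (IH m.+1)).
apply: dset_and; last exact: (dset_cmap c2 (IH m)).
apply: (dset_cmap (f := fun q : dprod U (dprod T (dpow T n)) => (q.1, q.2.1) : dprod U T) _ dQ).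
by cmap_tac.
Qed.

Lemma atleast_seq (T : dtype) (s : seq T) : exists z : dpow T (size s), forall m Q,
  atleast m Q z <-> (m <= count (fun t => `[< Q t >]) s)%N.
Proof.
elim: s => [|t s [z zP]]; first by exists tt => -[|m] Q; split.
exists (t, z) => -[|m] Q /=; first by split.
have [h1 h2] := zP m Q; have [h3 h4] := zP m.+1 Q.
case: (pselect (Q t)) => Qt; rewrite ?(asboolT Qt) ?(asboolF Qt) /=.
  rewrite add1n ltnS; split=> [[[_ /h1]|/h3/ltnW]//|/h2 ?]; by left.
by rewrite add0n; split=> [[[]//|/h3]|/h4]//; right.
Qed.

Lemma seq_atleast (T : dtype) n (z : dpow T n) : exists2 s : seq T, size s = n & forall m Q,
  atleast m Q z <-> (m <= count (fun t => `[< Q t >]) s)%N.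
Proof.
elim: n z => [|n IH] /= z; first by exists [::] => // -[|m] Q; split.
case: z => t z; have [s sn zP] := IH z; exists (t :: s); first by rewrite /= sn.
move=> [|m] Q /=; first by split.
have [h1 h2] := zP m Q; have [h3 h4] := zP m.+1 Q.
case: (pselect (Q t)) => Qt; rewrite ?(asboolT Qt) ?(asboolF Qt) /=.
  rewrite add1n ltnS; split=> [[[_ /h1]|/h3/ltnW]//|/h2 ?]; by left.
by rewrite add0n; split=> [[[]//|/h3]|/h4]//; right.
Qed.

Lemma exp_list (T : dtype) n (z : dpow T n) : exists s : seq T, forall Q,
  exp Q z -> has (fun t => `[< Q t >]) s.
Proof.
elim: n z => [|n IH] /= z; first by exists [::].
case: z => t z; have [s sP] := IH z; exists (t :: s) => Q /= [/asboolP->//|/sP ->].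
by rewrite orbT.
Qed.

End AtLeast.

Section Generic.
Variables (L : language) (M : rcfType) (S : expansion L M) (A0 : set M).
Hypotheses (S_omin : o_minimal S) (S_sat : saturated S) (A00 : A0 0).
Hypothesis sA0 : small A0.
Local Notation dtype := (dtype S A0).
Local Notation dM := (dM S A0).
Variables (G : topologicalZmodType) (n : nat) (code : G -> 'rV[M]_n).
Hypotheses (code_inj : injective code) (code_ran : definable_over S A0 (range code)).
Local Notation dG := (dG code_inj code_ran).
Hypothesis dadd0 : dset set0 (fun p : dprod (dprod dG dG) dG => p.2 = p.1.1 + p.1.2).
(** In this section the charts enter only through this hypothesis, [curve_lim] and [gbox]. *)
Hypothesis clos : forall (T : dtype) A (X : T -> dG -> Prop),
  dset A (fun q : dprod T dG => X q.1 q.2) ->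
  dset A (fun q : dprod T dG => closure (X q.1) q.2).
Hypothesis curve_lim : forall s : dM -> dG, dfun [set: M] s ->
  exists g : G, s x @[x --> 0^'+] --> g.

Lemma dfun_addG (T : dtype) A (f g : T -> dG) : dfun A f -> dfun A g ->
  dfun A (fun t => f t + g t : dG).
Proof.
move=> df dg; apply: (dfun_comp2 (h := fun x y : dG => x + y : dG) _ df dg).
by apply: dset_mono dadd0.
Qed.

Ltac addG_tac :=
  lazymatch goal with
  | |- dfun _ (fun p => GRing.add (@?f p) (@?g p)) =>
      apply: (dfun_addG (f := f) (g := g)); dfun_tac
  end.

Definition gen K (X : set G) := exists z : dpow dG K, forall x : G, exp (fun g : dG => X (x + g : G)) z.

Lemma dset_gen (T : dtype) A K (X : T -> dG -> Prop) :
  dset A (fun q : dprod T dG => X q.1 q.2) -> dset A (fun t => gen K (X t)).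
Proof.
move=> dX; apply: (dset_ex (U := dpow dG K)); apply: (dset_all (U := dG)).
pose Q (tx : dprod T dG) (g : dG) := X tx.1 (tx.2 + g).
have dQ : dset A (fun q : dprod (dprod T dG) dG => Q q.1 q.2).
  apply: (dset_comp2 dX (f := fun q : dprod (dprod T dG) dG => q.1.1)
    (g := fun q => (q.1.2 + q.2 : dG))); first by dfun_tac.
  by addG_tac.
apply: (dset_cmap (f := fun p : dprod (dprod T (dpow dG K)) dG =>
  ((p.1.1, p.2), p.1.2) : dprod (dprod T dG) (dpow dG K)) _ (dset_exp K dQ)).
by cmap_tac.
Qed.

Lemma gen_succ K X : gen K X -> gen K.+1 X.
Proof. by move=> [z H]; exists ((0 : dG), z) => x /=; right; exact: H. Qed.

Lemma gen_le K K' X : (K <= K')%N -> gen K X -> gen K' X.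
Proof.
move=> KK; rewrite -(subnK KK); elim: (K' - K)%N => // m IH /IH; exact: gen_succ.
Qed.

Lemma gen_seq X (gs : seq G) : (forall x, has (fun g => `[< X (x + g) >]) gs) ->
  gen (size gs) X.
Proof.
move=> H; have gs0 : (0 < size gs)%N by have := H 0; case: gs {H}.
have [z zP] := @exp_seq _ _ _ _ dG gs (size gs) (leqnn _) gs0.
by exists z => x; apply: zP; exact: H.
Qed.

(** With the number [N] of translates and the forbidden multiplicity [m] fixed, thinness becomes a
    definable condition; thinness itself is an infinite disjunction of these. *)
Definition thinNm N m (X : set G) := exists z : dpow dG N,
  forall x : G, ~ atleast m (fun g : dG => X (x + g : G)) z.

Lemma thinP e X : (0 < e)%N ->
  thin e X <-> exists N m, (e * m.-1 < N)%N /\ thinNm N m X.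
Proof.
move=> e0; split.
  (* The largest multiplicity allowed is the quotient of [(size gs).-1] by [e]; [m] is one more. *)
  move=> [gs gs0 H]; exists (size gs), ((size gs).-1 %/ e).+1; split.
    by rewrite /= mulnC (leq_ltn_trans (leq_divM _ _)) // prednK.
  have [z zP] := @atleast_seq _ _ _ _ dG gs; exists z => x /zP.
  rewrite -/(cnt X gs x) => h; have := H x; rewrite ltnNge => /negP; apply.
  move: h; rewrite ltn_divLR // mulnC => h.
  by rewrite -(prednK gs0).
move=> [N [m [emN [z zP]]]]; have [gs sgs gsP] := seq_atleast z.
exists gs => [|x]; first by rewrite sgs; case: N emN {z zP sgs gsP}.
rewrite sgs; apply: leq_ltn_trans emN; rewrite leq_mul2l; apply/orP; right.
have := zP x; rewrite gsP -/(cnt X gs x) => /negP; rewrite -ltnNge.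
by case: m {zP}.
Qed.

Lemma dset_thinNm (T : dtype) A N m (X : T -> dG -> Prop) :
  dset A (fun q : dprod T dG => X q.1 q.2) -> dset A (fun t => thinNm N m (X t)).
Proof.
move=> dX; apply: (dset_ex (U := dpow dG N)); apply: (dset_all (U := dG)); apply: dset_not.
pose Q (tx : dprod T dG) (g : dG) := X tx.1 (tx.2 + g).
have dQ : dset A (fun q : dprod (dprod T dG) dG => Q q.1 q.2).
  apply: (dset_comp2 dX (f := fun q : dprod (dprod T dG) dG => q.1.1)
    (g := fun q => (q.1.2 + q.2 : dG))); first by dfun_tac.
  by addG_tac.
apply: (dset_cmap (f := fun p : dprod (dprod T (dpow dG N)) dG =>
  ((p.1.1, p.2), p.1.2) : dprod (dprod T dG) (dpow dG N)) _ (dset_atleast N m dQ)).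
by cmap_tac.
Qed.

Definition lG : ltype S A0 := @LType _ _ _ _ dG (fun s g => s x @[x --> 0^'+] --> g) curve_lim.

Lemma cclosed_closed (C : set G) : closed C -> cclosed (O := lG) C.
Proof.
move=> cC s w ds sw [b b0 H].
apply: (@closed_cvg _ _ (0 : M)^'+ _ s C cC _ w sw).
by apply: filterS2 (nbhs_right_gt (0 : M)) (nbhs_right_lt b0) => u u0 ub; apply: H; rewrite u0.
Qed.

Lemma lim_addr (s : M -> G) (w g : G) : s x @[x --> (0 : M)^'+] --> w ->
  s x + g @[x --> (0 : M)^'+] --> w + g.
Proof.
move=> sw; apply: (@cvg_comp _ _ _ (fun x => (s x, g)) (fun z : G * G => z.1 + z.2) _ (nbhs (w, g))).
  by apply: cvg_pair => //; exact: cvg_cst.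
exact: (tvs.add_continuous (w, g)).
Qed.

(** Without a uniform [K], saturation gives a single [t] for which [X t] is not thin and its closure
    is generic for no [K]. Non-thinness is the hypothesis of [pierce] for the translates of [X t],
    so the closed sets [Z g] of piercing tuples have the finite intersection property. Hence each
    contains a tuple definable over [B], and by compactness finitely many such tuples serve all [g];
    their entries translate the closure onto the whole group. *)
Lemma generic_dichotomy (T : dtype) A (X : T -> dG -> Prop) e : small (A0 `|` A) -> (0 < e)%N ->
  dset A (fun q : dprod T dG => X q.1 q.2) ->
  exists K, forall t, thin e (X t) \/ gen K (closure (X t)).
Proof.
move=> sA e0 dX; apply/not_notP => nK.
have {}nK K : exists t, ~ thin e (X t) /\ ~ gen K (closure (X t)).
  apply/not_notP => n1; apply: nK; exists K => t; apply/not_notP => /not_orP h.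
  by apply: n1; exists t.
pose F : set (set T) := [set P | (exists K, P = [set t | ~ gen K (closure (X t))]) \/
  exists N m, (e * m.-1 < N)%N /\ P = [set t | ~ thinNm N m (X t)]].
have [|s sP|t tP] := @dsat _ _ _ _ S_sat T A F sA.
- move=> P [[K ->]|[N [m [_ ->]]]]; apply: dset_not.
    exact: dset_gen (clos dX).
  exact: dset_thinNm.
- suff [K KP] : exists K, forall P, P \in s -> forall t,
      ~ thin e (X t) -> ~ gen K (closure (X t)) -> P t.
    by have [t [h1 h2]] := nK K; exists t => P Ps; exact: KP.
  elim: s sP => [|P s IH] sP; first by exists 0%N.
  have [|K KP] := IH; first by move=> Q Qs; apply: sP; rewrite inE Qs orbT.
  case: (sP P (mem_head _ _)) => [[K' PE]|[N [m [emN PE]]]].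
    exists (maxn K K') => Q; rewrite inE => /orP[/eqP->|Qs] t h1 h2.
      by rewrite PE /= => g1; apply: h2; apply: gen_le g1; rewrite leq_maxr.
    by apply: (KP Q Qs t h1) => g1; apply: h2; apply: gen_le g1; rewrite leq_maxl.
  exists K => Q; rewrite inE => /orP[/eqP->|Qs] t h1 h2; last exact: (KP Q Qs t h1).
  by rewrite PE /= => tN; apply: h1; apply/thinP => //; exists N, m.
have nthin : ~ thin e (X t).
  move=> /(thinP _ e0)[N [m [emN tN]]].
  by apply: (tP [set t | ~ thinNm N m (X t)]) tN; right; exists N, m.
have ngen K : ~ gen K (closure (X t)).
  by apply: (tP [set t | ~ gen K (closure (X t))]); left; exists K.
pose B := A `|` range (denc t 0).
have sB : small (A0 `|` B) by exact: small_par.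
have dXB : dset B (fun q : dprod T dG => X q.1 q.2) by apply: dset_mono dX => x; left.
have dXt : dset B (X t) by apply: dset_fiber dXB _; exact: dpt_addpar.
pose R (g x : dG) := X t (x + g).
have dR : dset B (fun q : dprod dG dG => R q.2 q.1).
  apply: (dset_comp dXt (f := fun q : dprod dG dG => (q.1 + q.2 : dG))).
  by addG_tac.
have [C [d trR]] := @nip _ _ _ _ S_omin S_sat dG dG B (fun x g => R g x) sB dR.
have [N NP] := pierce C d e0.
pose Z (g : dG) (y : lpow lG N.+1) := exp (fun h : dG => closure (X t) (h + g)) y.
pose Q (g h : dG) := closure (X t) (h + g).
have dcl : dset B (closure (X t) : dG -> Prop).
  have dc := clos dXB.
  by apply: (@dset_fiber _ _ _ _ T dG B (fun t => closure (X t)) t dc); exact: dpt_addpar.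
have dQ : dset B (fun q : dprod dG dG => Q q.1 q.2).
  apply: (dset_comp dcl (f := fun q : dprod dG dG => (q.2 + q.1 : dG))).
  by addG_tac.
have dZ : dset B (fun q : dprod dG (lpow lG N.+1) => Z q.1 q.2) by exact: (dset_exp N.+1 dQ).
have cZ g : cclosed (Z g).
  apply: (cclosed_exp S_omin (O := lG)); first exact: dall_sec dQ.
  move=> s w ds sw [b b0 H].
  have dsg : dfun setT (fun u : dM => (s u + g : dG)).
    by apply: (dfun_addG ds); apply: dfun_cst; exact: dpt_all.
  have cc := @cclosed_closed (closure (X t)) (@closed_closure _ _).
  apply: (cc (fun u => (s u + g : G)) (w + g : G) dsg); last by exists b.
  exact: (@lim_addr s w g sw).
have fip m (z : dpow dG m) : exists w, allp (Z^~ w) z.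
  have [h hP] := allp_ord z.
  have [||xs [sxs xsP]] := NP 'I_m dG (fun i x => R (h i) x).
  - exact: (trb_comp id h trR).
  - move=> w w0; apply/not_notP => nx; apply: nthin.
    (* A weight becomes a list with repetitions; thinness fails for it at some [x], which pierces
       the required share. *)
    pose gs := flatten [seq nseq (w i) (h i) | i <- enum 'I_m].
    have cE (P : pred G) : count P gs = \sum_(i | P (h i)) w i.
      rewrite /gs count_flatten -map_comp sumnE big_map big_enum /= [RHS]big_mkcond.
      by apply: eq_bigr => i _; rewrite /= count_nseq; case: (P _); rewrite ?mul1n ?mul0n.
    have sE : size gs = \sum_i w i by rewrite -count_predT cE.
    exists gs; first by rewrite sE.
    move=> x; rewrite ltnNge; apply/negP => hx; apply: nx; exists x.
    by move: hx; rewrite sE /cnt cE.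
  have [||y yP] := @exp_seq _ _ _ _ dG (if xs is [::] then [:: 0 : G] else xs) N.+1.
  - by case: (xs) sxs => //= *; exact: leqW.
  - by case: (xs).
  exists y; apply/hP => i; apply: yP; have := xsP i; case: (xs) => // x xs'.
  apply: sub_has => u /asboolP Ru; apply/asboolP; exact: subset_closure.
have pp := peterzil_pillay_dtype S_omin S_sat A00 sA0 sB dZ cZ fip.
pose F2 : set (set dG) := [set P | exists y : lpow lG N.+1,
  dset B (fun x : lpow lG N.+1 => x = y) /\ P = [set g | Z g y]].
have [||s [sF scov]] := @dcover _ _ _ _ S_sat dG B F2 sB.
- move=> P [y [dy ->]].
  apply: (dset_comp2 dZ (f := fun g : dG => g) (g := fun _ => y)); first by dfun_tac.
  exact: dfun_cst.
- move=> g; have [y Zy dy] := pp g; exists [set g | Z g y] => //; by exists y.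
have [hs hsP] : exists hs : seq G, forall P, P \in s -> forall g, P g ->
    has (fun h => `[< closure (X t) (g + h) >]) hs.
  elim: s sF {scov} => [|P s IH] sF; first by exists [::].
  have [|hs hsP] := IH; first by move=> Q' Qs; apply: sF; rewrite inE Qs orbT.
  have [y [_ PE]] := sF P (mem_head _ _); have [l lP] := exp_list (T := dG) y.
  exists (l ++ hs) => Q'; rewrite inE => Qin g Qg; rewrite has_cat.
  case/orP: Qin Qg => [/eqP->|/hsP H]; last by move=> /H ->; rewrite orbT.
  rewrite PE => Zg; apply/orP; left; apply: sub_has (lP _ Zg) => u /asboolP cu.
  by apply/asboolP; rewrite addrC.
by apply: (ngen (size hs)); apply: gen_seq => x; have [P Ps Px] := scov x; exact: hsP Px.
Qed.


(** * Boundaries of definable sets *)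

Hypothesis gbox : forall m (T : dtype) (E : nat -> T -> dG -> Prop) (W : set G),
  (forall j, dall (fun q : dprod T dG => E j q.1 q.2)) -> open W -> W !=set0 ->
  exists ws : seq (set G), (forall w, w \in ws -> [/\ open w, w !=set0, w `<=` W &
      dall (w : dG -> Prop)]) /\
    forall t, exists2 w, w \in ws & forall j, (j < m)%N -> homog (E j t) w.

Lemma dpt_G0 A : dset A (fun x : dG => x = 0).
Proof.
have : dset A (fun x : dG => x + x = x :> dG).
  by apply: dset_eq; [addG_tac|dfun_tac].
apply: dset_ext => x; split=> [/eqP|->]; last by rewrite addr0.
by rewrite -subr_eq0 addrK => /eqP.
Qed.

Fixpoint pj K (j : nat) : dpow dG K -> dG :=
  if K is K'.+1 then fun z : dprod dG (dpow dG K') => if j is j'.+1 then pj j' z.2 else z.1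
  else fun _ => 0.

Lemma exp_pj K (Q : dG -> Prop) (z : dpow dG K) :
  exp Q z -> exists2 j, (j < K)%N & Q (pj j z).
Proof.
elim: K z => //= K IH [g z] /= [Qg|/IH[j jK Qj]]; first by exists 0%N.
by exists j.+1.
Qed.

Lemma dfun_pj A K j : dfun A (pj j : dpow dG K -> dG).
Proof.
elim: K j => [|K IH] j /=; first by apply: dfun_cst; exact: dpt_G0.
case: j => [|j]; first exact/dfun_cmap/cmap_fst0.
apply: (dfun_comp (f := fun z : dprod dG (dpow dG K) => z.2) (IH j)).
exact/dfun_cmap/cmap_snd0.
Qed.

Lemma continuous_shift (g : G) : continuous (fun y : G => y + g).
Proof.
move=> y; apply: (@cvg_comp _ _ _ (fun x => (x, g)) (fun z : G * G => z.1 + z.2) _ (nbhs (y, g))).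
  by apply: cvg_pair; [exact: cvg_id|exact: cvg_cst].
exact: (tvs.add_continuous (y, g)).
Qed.

Lemma open_shift (W : set G) g : open W -> open [set y | W (y + g)].
Proof.
move=> oW; apply: (@open_comp _ _ (fun y : G => y + g) W) => // y _.
exact: continuous_shift.
Qed.

Definition bd (X : set G) := closure X `&` closure (~` X).

Lemma closed_bd X : closed (bd X).
Proof. by apply: closedI; exact: closed_closure. Qed.

(** Some open subset of [W] lies inside [X] or inside its complement, and so misses one of the two
    closures. *)
Lemma bd_no_open (W X : set G) : dall (X : dG -> Prop) -> open W -> W !=set0 -> ~ W `<=` bd X.
Proof.
move=> dX oW W0 WX.
have [|ws [wsP H]] := @gbox 1 (dunit S A0) (fun _ _ => X) W _ oW W0.
  by move=> _; exact: (dset_cmap (cmap_snd0 _ _) dX).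
have [w /wsP[ow [y wy] wW _] /(_ 0%N isT) hw] := H tt.
have [cX cnX] := WX y (wW y wy).
have nw : nbhs y w by apply: open_nbhs_nbhs.
have [y1 [Xy1 wy1]] := cX w nw; have [y2 [Xy2 wy2]] := cnX w nw.
by case: hw => h; [apply: Xy2; exact: h|exact: (h y1 wy1)].
Qed.

(** If [K] translates covered the group, an open set on which all of them are homogeneous would lie
    in one of them. *)
Lemma bd_not_gen K X : dall (X : dG -> Prop) -> dall (bd X : dG -> Prop) -> ~ gen K (bd X).
Proof.
move=> dX db [z zP].
have [||ws [wsP H]] := @gbox K (dunit S A0) (fun j _ x => bd X (x + pj j z)) setT _ openT.
- move=> j; apply: (dset_comp db (f := fun q : dprod (dunit S A0) dG => q.2 + pj j z : dG)).
  apply: (dfun_addG (f := fun q : dprod (dunit S A0) dG => q.2) (g := fun _ => pj j z)).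
    by dfun_tac.
  by apply: dfun_cst; exact: dpt_all.
- by exists 0.
have [w /wsP[ow [y wy] _ _] hw] := H tt.
have [j jK bj] := exp_pj (zP y).
have bw x : w x -> bd X (x + pj j z).
  by case: (hw j jK) => h wx; [exact: h|case: (h y wy)].
apply: (bd_no_open dX (open_shift (- pj j z) ow)).
  by exists (y + pj j z); rewrite /= addrK.
by move=> x /= /bw; rewrite subrK.
Qed.

Lemma dset_clos1 A (X : dG -> Prop) : dset A X -> dset A (closure X : dG -> Prop).
Proof.
move=> dX; have dX2 : dset A (fun q : dprod (dunit S A0) dG => (fun _ => X) q.1 q.2).
  exact: (dset_cmap (cmap_snd0 _ _) dX).
apply: (@dset_fiber _ _ _ _ (dunit S A0) dG A (fun _ => closure X) tt (clos dX2)).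
by apply: dset_ext (dset_true _ _) => -[].
Qed.

Lemma dset_bd A (X : dG -> Prop) : dset A X -> dset A (bd X : dG -> Prop).
Proof.
move=> dX; apply: dset_and; first exact: dset_clos1.
by apply: dset_clos1; exact: dset_not.
Qed.

Lemma bd_thin e X : (0 < e)%N -> dall (X : dG -> Prop) -> thin e (bd X).
Proof.
move=> e0 dX; have [m [p dXp]] := dall_par dX.
have dbp := dset_bd dXp.
have dX2 : dset (range (denc p 0)) (fun q : dprod (dunit S A0) dG => (fun _ => bd X) q.1 q.2).
  exact: (dset_cmap (cmap_snd0 _ _) dbp).
have [K KP] := @generic_dichotomy (dunit S A0) _ (fun _ => bd X) e (small_dpar sA0 p) e0 dX2.
have [//|] := KP tt; rewrite -((closure_id _).1 (@closed_bd X)) => gb.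
by case: (bd_not_gen dX (dset_bd dX) gb).
Qed.

(** * Families near an end of a line *)

Lemma eventually_near (I : finType) (P : I -> dM -> Prop) b : 0 < b -> (forall i, dall (P i)) ->
  (forall u, 0 < u < b -> exists i, P i u) ->
  exists i, exists2 b', 0 < b' & forall u, 0 < u < b' -> P i u.
Proof.
move=> b0 dP cov; have [h1 h2] := midf_lt b0.
have [i0 Pi0] := cov _ (introT andP (conj h1 h2)).
have [||i [b' b'0 H]] := eventually_one S_omin (P := fun i u => P i u \/ b <= u).
- move=> i; apply: dset_or; first exact: dP.
  have db := dpt_all (b : dM).
  by apply: dset_le; dfun_tac.
- move=> u u0; case: (leP b u) => bu; first by exists i0; right.
  by have [|i Pi] := cov u; [rewrite u0|exists i; left].
exists i, (Num.min b b'); first by rewrite lt_min b0.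
move=> u /andP[u0]; rewrite lt_min => /andP[ub ub'].
by have [|//|] := H u; [rewrite u0|rewrite leNgt ub].
Qed.

(** The [K] translates are chosen definably along a curve going to the left end. Near the end one
    fixed open set, moved by one of the shifts [k j s], lies in the closures; letting the shift tend
    to its limit [k0] puts a fixed open set into every closure. There each [C u] is dense, hence
    contains an open set from a finite list, and one member of the list serves for all [u]. *)
Lemma near_left_gen K (I : dM -> Prop) (C : dM -> dG -> Prop) i0 : dall I -> I i0 ->
  (forall u, I u -> exists2 v, I v & v < u) ->
  dall (fun q : dprod dM dG => C q.1 q.2) ->
  (forall u v x, I u -> I v -> u <= v -> C u x -> C v x) ->
  (forall u, I u -> gen K (closure (C u))) -> exists x, forall u, I u -> C u x.
Proof.
move=> dI Ii0 nomin dC Cmono gC.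
have [phi [dphi phiP]] := left_end S_omin dI Ii0 nomin.
have dcl : dall (fun q : dprod dM dG => closure (C q.1) q.2) by exact: clos.
have [z0 _] := gC i0 Ii0.
have [||z [dz zP]] := @dall_choice _ _ _ _ S_omin S_sat A00 sA0 dM (dpow dG K)
    (fun u z => I u -> forall x : dG, exp (fun g : dG => closure (C u) (x + g)) z).
- apply: dset_imp; first exact: (dset_cmap (cmap_fst0 _ _) dI).
  apply: (dset_all (U := dG)).
  pose Q (tx : dprod dM dG) (g : dG) := closure (C tx.1) (tx.2 + g).
  have dQ : dset setT (fun q : dprod (dprod dM dG) dG => Q q.1 q.2).
    apply: (dset_comp2 (R := fun u => closure (C u)) dcl
      (f := fun q : dprod (dprod dM dG) dG => q.1.1)
      (g := fun q => (q.1.2 + q.2 : dG))); first by dfun_tac.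
    by addG_tac.
  apply: (dset_cmap (f := fun p : dprod (dprod dM (dpow dG K)) dG =>
    ((p.1.1, p.2), p.1.2) : dprod (dprod dM dG) (dpow dG K)) _ (dset_exp K dQ)).
  by cmap_tac.
- move=> u; case: (pselect (I u)) => Iu; last by exists z0.
  by have [z zP] := gC u Iu; exists z.
pose k j (s : dM) : dG := pj j (z (phi s)).
have dk j : dfun setT (k j).
  apply: (dfun_comp (g := pj j) (f := fun s => z (phi s)) (dfun_pj _ _ _)).
  exact: dfun_comp dz dphi.
have [||ws [wsP wsH]] := @gbox K dM (fun j s x => closure (C (phi s)) (x + k j s)) setT _ openT.
- move=> j; apply: (dset_comp2 (R := fun u => closure (C u)) dcl
    (f := fun q : dprod dM dG => phi q.1) (g := fun q => (q.2 + k j q.1 : dG))).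
    by dfun_tac.
  have dkj := dk j.
  apply: (dfun_addG (f := fun q : dprod dM dG => q.2) (g := fun q => k j q.1)); first by dfun_tac.
  by apply: (dfun_comp (f := fun q : dprod dM dG => q.1) dkj); dfun_tac.
- by exists 0.
pose wn (a : 'I_(size ws)) := nth set0 ws a.
have wnP a : [/\ open (wn a), wn a !=set0, wn a `<=` setT & dall (wn a : dG -> Prop)].
  by apply: wsP; exact: mem_nth.
have [b0 b00 phiI] := phiP i0 Ii0.
(* The open set [a] and the coordinate [j] become constant near the end. *)
have [||[a j] [b b_gt0 aj]] := @eventually_near ('I_(size ws) * 'I_K)%type
  (fun aj s => forall x : dG, wn aj.1 x -> closure (C (phi s)) (x + k aj.2 s)) b0 b00.
- move=> [a j] /=; apply: (dset_all (U := dG)); have [_ _ _ dw] := wnP a.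
  apply: dset_imp; first exact: (dset_cmap (cmap_snd0 _ _) dw).
  apply: (dset_comp2 (R := fun u => closure (C u)) dcl
    (f := fun q : dprod dM dG => phi q.1) (g := fun q => (q.2 + k j q.1 : dG))).
    by dfun_tac.
  have dkj := dk j.
  apply: (dfun_addG (f := fun q : dprod dM dG => q.2) (g := fun q => k j q.1)); first by dfun_tac.
  by apply: (dfun_comp (f := fun q : dprod dM dG => q.1) dkj); dfun_tac.
- move=> s sb; have [Is _] := phiI s sb.
  have [w wws hw] := wsH s; have [_ [y wy] _ _] := wsP w wws.
  have [j jK cj] := exp_pj (zP (phi s) Is y).
  have aw : (index w ws < size ws)%N by rewrite index_mem.
  exists (Ordinal aw, Ordinal jK) => x; rewrite /wn /= nth_index // => wx.
  by case: (hw j jK) => h; [exact: h|case: (h y wy)].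
rewrite /= in aj; have [ow [y0 wy0] _ _] := wnP a.
have [k0 kk0] := curve_lim (dk j).
(* The closures decrease towards the end, so for a fixed [u] the shifted points eventually stay in
   the closure of [C u]. *)
have Wcl x u : wn a x -> I u -> closure (C u) (x + k0).
  move=> wx Iu; have dsx : dfun setT (fun s : dM => (k j s + x : dG)).
    by apply: (dfun_addG (dk j)); apply: dfun_cst; exact: dpt_all.
  have lx := lim_addr (g := x) kk0.
  rewrite addrC.
  have cc := @cclosed_closed (closure (C u)) (@closed_closure _ _).
  apply: (cc (fun s => (k j s + x : G)) (k0 + x : G) dsx lx).
  have [s0 s00 Hs] := phiP u Iu; exists (Num.min b s0); first by rewrite lt_min b_gt0.
  move=> s /andP[s_gt0]; rewrite lt_min => /andP[sb ss0].
  have [Ip pu] := Hs s (introT andP (conj s_gt0 ss0)).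
  have := aj s (introT andP (conj s_gt0 sb)) x wx; rewrite addrC.
  by apply: closureS => y; apply: Cmono => //; exact: ltW.
have oW' := open_shift (- k0) ow.
have W'0 : [set y | wn a (y - k0)] !=set0 by exists (y0 + k0); rewrite /= addrK.
have [|ws' [ws'P ws'H]] := @gbox 1 dM (fun _ u => C u) _ _ oW' W'0; first by move=> _.
have inC u : I u -> exists2 w, w \in ws' & forall y, w y -> C u y.
  move=> Iu; have [w wws /(_ 0%N isT) hw] := ws'H u; exists w => //.
  case: hw => // h; have [ow1 [y wy] wW' _] := ws'P w wws.
  have := Wcl (y - k0) u (wW' y wy) Iu; rewrite subrK => cy.
  have [y1 [Cy1 wy1]] := cy w (open_nbhs_nbhs (conj ow1 wy)).
  by case: (h y1 wy1).
have [||a' [b' b'0 Ha']] := @eventually_near 'I_(size ws')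
    (fun a s => forall x : dG, nth set0 ws' a x -> C (phi s) x) b0 b00.
- move=> a'; have [_ _ _ dw] := ws'P (nth set0 ws' a') (mem_nth _ (ltn_ord a')).
  apply: (dset_all (U := dG)); apply: dset_imp; first exact: (dset_cmap (cmap_snd0 _ _) dw).
  by apply: (dset_comp2 dC (f := fun q : dprod dM dG => phi q.1) (g := fun q => q.2)); dfun_tac.
- move=> s /phiI[Is _]; have [w wws h] := inC _ Is.
  have aw : (index w ws' < size ws')%N by rewrite index_mem.
  by exists (Ordinal aw) => x; rewrite /= nth_index //; exact: h.
have [_ [y wy] _ _] := ws'P (nth set0 ws' a') (mem_nth _ (ltn_ord a')).
exists y => u Iu; have [s0 s00 Hs] := phiP u Iu.
have m0 : 0 < Num.min b' s0 by rewrite lt_min b'0.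
have [h1 h2] := midf_lt m0; move: h2; rewrite lt_min => /andP[h2 h3].
have [Ip pu] := Hs _ (introT andP (conj h1 h3)).
by apply: (Cmono _ u y Ip Iu (ltW pu)); apply: Ha' wy; rewrite h1.
Qed.

(** The sets [C u] decrease to the empty set, so their closures cannot all be [K]-generic, and the
    dichotomy makes one of the sets thin. *)
Lemma near_left A (I : dM -> Prop) (C : dM -> dG -> Prop) i0 e : small (A0 `|` A) -> (0 < e)%N ->
  dall I -> I i0 -> (forall u, I u -> exists2 v, I v & v < u) ->
  dset A (fun q : dprod dM dG => C q.1 q.2) ->
  (forall u v x, I u -> I v -> u <= v -> C u x -> C v x) ->
  (forall x, exists2 u, I u & ~ C u x) -> exists2 u, I u & thin e (C u).
Proof.
move=> sA e0 dI Ii0 nomin dC Cmono van; have [K KP] := generic_dichotomy sA e0 dC.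
apply/not_notP => n1.
have [||x Hx] := @near_left_gen K I C i0 dI Ii0 nomin _ Cmono.
- exact: dset_dall dC.
- by move=> u Iu; case: (KP u) => // tu; case: n1; exists u.
by have [u Iu] := van x; apply; exact: Hx.
Qed.

Lemma near_right A (I : dM -> Prop) (C : dM -> dG -> Prop) i0 e : small (A0 `|` A) -> (0 < e)%N ->
  dall I -> I i0 -> (forall u, I u -> exists2 v, I v & u < v) ->
  dset A (fun q : dprod dM dG => C q.1 q.2) ->
  (forall u v x, I u -> I v -> u <= v -> C v x -> C u x) ->
  (forall x, exists2 u, I u & ~ C u x) -> exists2 u, I u & thin e (C u).
Proof.
move=> sA e0 dI Ii0 nomax dC Cmono van.
have [||||||u Iu tu] := @near_left A (fun u => I (- u)) (fun u => C (- u)) (- i0) e sA e0.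
- by move: dI; rewrite /dall => dI; dset_tac.
- by rewrite opprK.
- by move=> u /nomax[v Iv uv]; exists (- v); rewrite ?opprK // ltrNl.
- by dset_tac.
- by move=> u v x Iu Iv uv; apply: Cmono => //; rewrite lerN2.
- by move=> x; have [u Iu nC] := van x; exists (- u); rewrite opprK.
by exists (- u).
Qed.

Lemma exp_atleast K (Q : dG -> Prop) (z : dpow dG K) : exp Q z -> atleast 1 Q z.
Proof.
elim: K z => //= K IH [g z] /= [Qg|/IH]; [left|by right].
by split=> //; case: (K) z.
Qed.

(** Double counting along one list [ls] that meets each closure in a share of at least [1 / K]. A
    point in a closure but not in the set lies on a boundary, and the boundaries together take a
    share below [1 / (2 * K)], so they account for at most half of the incidences. *)
Lemma generic_count m K r (C : 'I_m -> set G) : (forall i, dall (C i : dG -> Prop)) ->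
  (forall i, gen K (closure (C i))) ->
  (forall x, (#|[pred i | `[< C i x >]]| <= r)%N) -> (m <= 2 * K * r)%N.
Proof.
move=> dC gC rP; case: (posnP m) => [->//|m0].
have K0 : (0 < K)%N.
  by case: (posnP K) => // K0; have [z /(_ 0)] := gC (Ordinal m0); move: z; rewrite K0.
pose synd X (gs : seq G) := forall x, (size gs <= K * cnt X gs x)%N.
have synd_r X gs hs : synd X gs -> synd X (addl gs hs).
  by move=> H x; rewrite size_addl cnt_addlC mulnC; apply: sum_gec => h; exact: H.
have synd_l X gs hs : synd X gs -> synd X (addl hs gs).
  by move=> H x; rewrite size_addl cnt_addl; apply: sum_gec => h; exact: H.
have [gs gs0 gsP] : exists2 gs, (0 < size gs)%N & forall i, i \in enum 'I_m -> synd (closure (C i)) gs.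
  elim: (enum 'I_m) => [|i s [gs gs0 IH]]; first by exists [:: 0].
  have [z zP] := gC i; have [ks sks ksP] := seq_atleast z.
  have si : synd (closure (C i)) ks.
    move=> x; rewrite sks -{1}(muln1 K) leq_mul2l; apply/orP; right.
    by apply/ksP/exp_atleast/zP.
  exists (addl gs ks); first by rewrite size_addl muln_gt0 gs0 sks.
  by move=> j; rewrite inE => /orP[/eqP->|/IH]; [exact: synd_l|exact: synd_r].
have [hs hs0 hsP] : thin (2 * K) [set x | exists2 X, X \in [seq bd (C i) | i <- enum 'I_m] & X x].
  apply: thin_cover => _ /mapP[i _ ->] [|e]; last exact: bd_thin.
  by apply: (@thin_le _ 0 1) => //; exact: bd_thin.
pose Bd := [set x | exists2 X, X \in [seq bd (C i) | i <- enum 'I_m] & X x].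
pose ls := addl gs hs.
have lP i : (size ls <= K * cnt (closure (C i)) ls 0)%N.
  by apply: synd_r; apply: gsP; rewrite mem_enum.
have sl : (0 < size ls)%N by rewrite size_addl muln_gt0 gs0.
have bP : (2 * K * cnt Bd ls 0 < size ls)%N.
  by rewrite /ls cnt_addl size_addl; apply: sum_ltc => // g; exact: hsP.
have up : (\sum_(i < m) cnt (closure (C i)) ls 0 <= r * size ls + m * cnt Bd ls 0)%N.
  have -> : (\sum_(i < m) cnt (closure (C i)) ls 0 =
      \sum_(g <- ls) \sum_(i < m) (`[< closure (C i) (0 + g)%R >] : nat))%N.
    rewrite exchange_big /=; apply: eq_bigr => i _.
    by rewrite /cnt -sum1_count big_mkcond; apply: eq_bigr => g _; case: asboolP.
  have -> : (r * size ls + m * cnt Bd ls 0 =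
      \sum_(g <- ls) (r + m * (`[< Bd (0 + g)%R >] : nat)))%N.
    rewrite big_split /= -big_distrr /= big_const_seq count_predT iter_addn_0; congr (_ + _ * _)%N.
    by rewrite /cnt -sum1_count big_mkcond; apply: eq_bigr => g _; case: asboolP.
  apply: leq_sum => g _; case: asboolP => nB.
    rewrite muln1; apply: leq_trans (leq_addl _ _).
    apply: (@leq_trans (\sum_(i < m) 1)%N); first by apply: leq_sum => i _; exact: leq_b1.
    by rewrite sum1_card card_ord.
  rewrite muln0 addn0; apply: leq_trans (rP (0 + g)).
  rewrite -sum1_card [X in (_ <= X)%N]big_mkcond; apply: leq_sum => i _.
  case: asboolP => //= ci; rewrite inE; case: asboolP => // nCi.
  case: nB; exists (bd (C i)); first by apply: map_f; rewrite mem_enum.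
  by split=> //; apply: subset_closure.
have low : (m * size ls <= K * \sum_(i < m) cnt (closure (C i)) ls 0)%N.
  have -> : (m * size ls = \sum_(i < m) size ls)%N by rewrite sum_nat_const card_ord.
  by rewrite big_distrr /=; apply: leq_sum => i _; exact: lP.
move: up low bP sl; move: (\sum_(i < m) _)%N (size ls) (cnt Bd ls 0) => a l c.
move=> up low bP sl.
have h : (2 * (m * l) <= 2 * K * r * l + m * l)%N by nia.
by rewrite -(leq_pmul2r sl); lia.
Qed.

(** * Partitions making a definable family almost constant *)

Definition cross (T : Type) (X : T -> G -> Prop) (D : T -> Prop) : set G :=
  [set x | ~ homog (X^~ x) D].

Lemma crossS (T : Type) (X : T -> G -> Prop) (D D' : T -> Prop) :
  (forall t, D t -> D' t) -> cross X D `<=` cross X D'.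
Proof. by move=> DD x nD hD; apply: nD; exact: homog_sub hD. Qed.

Lemma dset_cross (T U : dtype) A (X : U -> T -> dG -> Prop) (D : U -> T -> Prop) :
  dset A (fun q : dprod (dprod U T) dG => X q.1.1 q.1.2 q.2) ->
  dset A (fun q : dprod U T => D q.1 q.2) ->
  dset A (fun q : dprod U dG => cross (X q.1) (D q.1) q.2).
Proof.
move=> dX dD.
have d1 : dset A (fun q : dprod (dprod U dG) T => D q.1.1 q.2).
  by apply: (dset_comp2 dD (f := fun q : dprod (dprod U dG) T => q.1.1) (g := fun q => q.2)); dfun_tac.
have d2 : dset A (fun q : dprod (dprod U dG) T => X q.1.1 q.2 q.1.2).
  by apply: (dset_comp3 dX (f := fun q : dprod (dprod U dG) T => q.1.1) (g := fun q => q.2)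
    (h := fun q => q.1.2)); dfun_tac.
apply: (@dset_not _ _ _ _ (dprod U dG) A (fun q => homog (fun t => X q.1 t q.2) (D q.1))).
apply: dset_or; apply: (dset_all (U := T)); first exact: dset_imp d1 d2.
exact: dset_imp d1 (dset_not d2).
Qed.

Section OneVariable.
Variable A : set M.
Hypothesis sA : small (A0 `|` A).
Variables (X : dM -> dG -> Prop) (e : nat).
Hypotheses (e0 : (0 < e)%N) (dX : dset A (fun q : dprod dM dG => X q.1 q.2)).

Definition icross (p : dprod dM dM) : set G := cross X (fun t : dM => p.1 < t /\ t < p.2).

Lemma dset_icross : dset A (fun q : dprod (dprod dM dM) dG => icross q.1 q.2).
Proof.
apply: (@dset_cross dM (dprod dM dM) A (fun _ => X) (fun p t => p.1 < t /\ t < p.2)).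
  by dset_tac.
by dset_tac.
Qed.

Variable Gam : dprod dM dM -> Prop.
Hypothesis dGam : dset A Gam.

(** How many disjoint intervals of [Gam] fit to the left of [w], as a definable condition. *)
Fixpoint lev j (w : dM) : Prop :=
  if j is j'.+1 then exists p : dprod dM dM, (p.1 < p.2 /\ p.2 <= w) /\ (Gam p /\ lev j' p.1)
  else True.

Lemma dset_lev j : dset A (lev j : dM -> Prop).
Proof. by elim: j => [|j IH] /=; [exact: dset_true|dset_tac]. Qed.

Fixpoint chain (s : seq (dprod dM dM)) (w : M) : Prop :=
  if s is p :: s' then [/\ p.1 < p.2, p.2 <= w, Gam p & chain s' p.1] else True.

Lemma lev_chain j w : lev j w -> exists2 s, size s = j & chain s w.
Proof.
elim: j w => [|j IH] w /=; first by exists [::].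
by move=> [p [[h1 h2] [h3 /IH[s sj cs]]]]; exists (p :: s); rewrite /= ?sj.
Qed.

Lemma chain_all s w : chain s w -> all (fun p => `[< Gam p >]) s.
Proof. by elim: s w => //= p s IH w [_ _ /asboolP -> /IH ->]. Qed.

(** Each interval on which [F] is not constant contains a point that prolongs an alternation found
    to its right by one step. *)
Lemma chain_alt (F : M -> Prop) s w : chain s w -> forall c m y, w <= y -> altf F c m y ->
  exists c' (y' : M), altf F c' (m + count (fun p : dprod dM dM =>
    `[< ~ homog F (fun t => (p.1 < t)%R /\ (t < p.2)%R) >]) s)%N y'.
Proof.
elim: s w => [|p s IH] w /= => [_ c m y _ H|[h1 h2 _ cs] c m y wy H].
  by exists c, y; rewrite addn0.
have py : p.1 <= y by apply: le_trans (ltW h1) (le_trans h2 wy).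
case: asboolP => [nh|_]; last by rewrite add0n; exact: (IH _ cs c m y py H).
have [z [[z1 z2] zE]] : exists z, (p.1 < z /\ z < p.2) /\ (F z <-> ~~ c).
  apply/not_notP => n1; apply: nh; case: c H n1 => H n1 /=; [left|right] => z pz.
    by apply/not_notP => nF; apply: n1; exists z; split.
  by move=> Fz; apply: n1; exists z.
rewrite add1n -addSnnS; apply: (IH _ cs (~~ c) m.+1 z (ltW z1)).
exists z; split=> //; rewrite negbK; apply: altf_le H.
by apply: le_trans (ltW z2) (le_trans h2 wy).
Qed.

(** By the alternation bound a point lies in boundedly many of the sets [icross] of a chain, so
    [generic_count] bounds its length. *)
Lemma lev_bound K : (forall p, Gam p -> gen K (closure (icross p))) ->
  exists N, forall w, ~ lev N w.
Proof.
move=> GK.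
have [r rP] := @alt_bound _ _ _ _ S_omin S_sat dG A (fun x t => X t x) sA
  (dset_cmap (f := fun q : dprod dG dM => (q.2, q.1) : dprod dM dG)
     (cmap_pair (cmap_snd0 _ _) (cmap_fst0 _ _)) dX).
exists (2 * K * r).+1 => w /lev_chain[s sj cs].
suff : (size s <= 2 * K * r)%N by rewrite sj ltnn.
apply: (@generic_count (size s) K r (fun i => icross (tnth (in_tuple s) i))).
- move=> i; exact: (@dset_fiber _ _ _ _ (dprod dM dM) dG [set: M] (fun p x => icross p x)
    (tnth (in_tuple s) i) (dset_dall dset_icross) (dpt_all _)).
- move=> i; apply: GK; apply/asboolP.
  by have /(all_tnthP (t := in_tuple s)) := chain_all cs; apply.
- move=> x.
  have -> : #|[pred i | `[< icross (tnth (in_tuple s) i) x >]]| =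
      count (fun p : dprod dM dM => `[< ~ homog (X^~ x) (fun t => p.1 < t /\ t < p.2) >]) s.
    exact: (count_tnth s (fun p : dprod dM dM =>
      `[< ~ homog (X^~ x) (fun t => p.1 < t /\ t < p.2) >])).
  rewrite leqNgt; apply/negP => rc.
  have [c [y H]] := @chain_alt (X^~ x) s w cs true 0%N w (lexx _) I.
  apply: (rP x y); apply: (alt_leq (ltnW rc)); rewrite add0n in H.
  by case: c H => H; [left|right].
Qed.

End OneVariable.

Lemma thin_single (T : Type) (X : T -> G -> Prop) e t0 : thin e (cross X (fun t => t = t0)).
Proof.
apply: thin_empty => x; apply; case: (pselect (X t0 x)) => h; [left|right] => t ->//.
Qed.

(** Fixing the numbers [N] and [m] that witness thinness leaves a definable condition, which has a
    definable solution. *)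
Lemma thin_dpoint A (X : dM -> dG -> Prop) (I : dM -> Prop) e : (0 < e)%N ->
  dset A (fun q : dprod dM dG => X q.1 q.2) -> dset A I ->
  (exists2 u, I u & thin e (X u)) ->
  exists u, [/\ I u, thin e (X u) & dset A (fun x : dM => x = u)].
Proof.
move=> e0 dX dI [u Iu /(thinP _ e0)[N [m [emN tN]]]].
have [||v [Iv tv] dv] := @dpoint _ _ _ _ S_omin dM A (fun u => I u /\ thinNm N m (X u)).
- by apply: dset_and => //; exact: dset_thinNm.
- by exists u.
by exists v; split=> //; apply/(thinP _ e0); exists N, m.
Qed.

(** [D0] collects the points with the same maximal number of generically varying intervals to their
    left as [t0]; between two of its points the variation is therefore thin. The ends must be
    reached with parameters in [A] only: either [A]-definable points of [D0] enclose [t0], or [D0]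
    has no extreme point on one side and the variation near that end is thin. *)
Lemma cell_point A (X : dM -> dG -> Prop) e t0 : small (A0 `|` A) -> (0 < e)%N ->
  dset A (fun q : dprod dM dG => X q.1 q.2) ->
  exists D : dM -> Prop, [/\ dset A D, D t0 & thin e (cross X D)].
Proof.
move=> sA e0 dX.
have [K KP] := generic_dichotomy sA e0 (dset_icross dX).
pose Gam (p : dprod dM dM) := gen K (closure (icross X p)).
have dGam : dset A Gam by exact: dset_gen (clos (dset_icross dX)).
have dlev := dset_lev dGam.
have [N NP] := @lev_bound A sA X dX Gam K (fun p h => h).
have [||j /asboolP lj jmax] := @ex_maxnP (fun j => `[< lev Gam j t0 >]) N.
- by exists 0%N; apply/asboolP.
- move=> i /asboolP li; rewrite leqNgt; apply/negP => Ni; apply: (NP t0).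
  have lS k w : lev Gam k.+1 w -> lev Gam k w.
    elim: k w => //= k IH w [p [h1 [h2 h3]]]; exists p; do 2!split=> //; exact: IH.
  rewrite -(subnK (ltnW Ni)) in li; elim: (i - N)%N li => // k IH; rewrite addSn => /lS; exact: IH.
pose D0 (t : dM) := lev Gam j t /\ ~ lev Gam j.+1 t.
have dD0 : dset A D0 by apply: dset_and => //; exact: dset_not.
have D0t : D0 t0 by split=> //; move=> /asboolP/jmax; rewrite ltnn.
have itv u v : D0 u -> D0 v -> u < v -> thin e (icross X (u, v)).
  move=> [lu _] [_ nlv] uv; case: (KP (u, v)) => // G1; case: nlv.
  by exists (u, v); split.
have [r rP] := @alt_bound _ _ _ _ S_omin S_sat dG A (fun x t => X t x) sA
  (dset_cmap (f := fun q : dprod dG dM => (q.2, q.1) : dprod dM dG)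
     (cmap_pair (cmap_snd0 _ _) (cmap_fst0 _ _)) dX).
have nonhom (F : M -> Prop) (D : M -> Prop) c : ~ homog F D -> exists2 y, D y & (F y <-> is_true c).
  move=> nh; apply/not_notP => n1; apply: nh; case: c n1 => n1; [right|left] => y Dy.
    by move=> Fy; apply: n1; exists y.
  by apply/not_notP => nF; apply: n1; exists y => //; split.
case: (pselect (exists u, [/\ D0 u, u <= t0 & dset A (fun x : dM => x = u)])); last first.
  move=> nu.
  pose C (u : dM) := cross X (fun t : dM => D0 t /\ t < u).
  have dC : dset A (fun q : dprod dM dG => C q.1 q.2).
    apply: (@dset_cross dM dM A (fun _ => X) (fun u t => D0 t /\ t < u)); by dset_tac.
  have [|u [D0u tu du]] := @thin_dpoint A C D0 e e0 dC dD0.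
    apply: (@near_left A D0 C t0 e sA e0) => //.
    - exact: dset_dall dD0.
    (* A minimum of [D0] would be an [A]-definable point up to [t0], which [nu] excludes. *)
    - move=> u D0u; apply/not_notP => n1.
      have umin v : D0 v -> u <= v.
        by move=> D0v; rewrite leNgt; apply/negP => vu; apply: n1; exists v.
      apply: nu; exists u; split=> //; first exact: umin.
      apply: (@dpt_unique _ _ _ _ dM A (fun x => D0 x /\ forall v : dM, D0 v -> x <= v)) => //.
        by dset_tac.
      by move=> s [D0s smin]; apply/le_anti; rewrite smin // umin.
    - by move=> u v x _ _ uv; apply: crossS => t [D0t' tu]; split=> //; exact: lt_le_trans tu uv.
    (* If membership of [x] varied arbitrarily close to the end, its alternations would be
       unbounded. *)
    - move=> x; apply/not_notP => n1.
      have H m c : exists2 y, D0 y & altf (X^~ x) c m y.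
        elim: m c => [|m IH] c; first by exists t0.
        have [y D0y ay] := IH (~~ c).
        have nC : ~ homog (X^~ x) (fun t : dM => D0 t /\ t < y).
          by move=> h; apply: n1; exists y => // nh; exact: nh.
        have [y' [D0y' y'y] y'c] := nonhom _ _ c nC.
        by exists y' => //; exists y'; split=> //; apply: altf_le ay; exact: ltW.
      by have [y _ ay] := H r true; apply: (rP x y); left.
  exists (fun t => D0 t /\ t < u); split=> //; first by dset_tac.
  (* The point [u] is [A]-definable, so it lies beyond [t0] by [nu]. *)
  by split=> //; rewrite ltNge; apply/negP => ut; apply: nu; exists u.
move=> [u [D0u ut du]].
case: (pselect (exists v, [/\ D0 v, t0 <= v & dset A (fun x : dM => x = v)])); last first.
  move=> nv.
  pose C (u : dM) := cross X (fun t : dM => D0 t /\ u < t).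
  have dC : dset A (fun q : dprod dM dG => C q.1 q.2).
    apply: (@dset_cross dM dM A (fun _ => X) (fun u t => D0 t /\ u < t)); by dset_tac.
  have [|v [D0v tv dv]] := @thin_dpoint A C D0 e e0 dC dD0.
    apply: (@near_right A D0 C t0 e sA e0) => //.
    - exact: dset_dall dD0.
    - move=> w D0w; apply/not_notP => n1.
      have wmax v : D0 v -> v <= w.
        by move=> D0v; rewrite leNgt; apply/negP => vw; apply: n1; exists v.
      apply: nv; exists w; split=> //; first exact: wmax.
      apply: (@dpt_unique _ _ _ _ dM A (fun x => D0 x /\ forall v : dM, D0 v -> v <= x)) => //.
        by dset_tac.
      by move=> s [D0s smax]; apply/le_anti; rewrite smax // wmax.
    - by move=> w v x _ _ wv; apply: crossS => t [D0t' vt]; split=> //; exact: le_lt_trans wv vt.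
    - move=> x; apply/not_notP => n1.
      have H m c y : D0 y -> altf (X^~ x) c m y.
        elim: m c y => // m IH c y D0y.
        have nC : ~ homog (X^~ x) (fun t : dM => D0 t /\ y < t).
          by move=> h; apply: n1; exists y => // nh; exact: nh.
        have [y' [D0y' y'y] y'c] := nonhom _ _ c nC.
        by exists y'; split=> //; [exact: ltW|exact: IH].
      by apply: (rP x t0); left; exact: H.
  exists (fun t => D0 t /\ v < t); split=> //; first by dset_tac.
  by split=> //; rewrite ltNge; apply/negP => tv'; apply: nv; exists v.
move=> [v [D0v tv dv]].
have [tu|ut'] := eqVneq t0 u.
  by exists (fun t => t = t0); split=> //; [rewrite tu|exact: thin_single].
have [tv'|vt'] := eqVneq t0 v.
  by exists (fun t => t = t0); split=> //; [rewrite tv'|exact: thin_single].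
have ut0 : u < t0 by rewrite lt_neqAle eq_sym ut' ut.
have tv0 : t0 < v by rewrite lt_neqAle vt' tv.
exists (fun t => u < t /\ t < v); split=> //; first by dset_tac.
exact: itv (lt_trans ut0 tv0).
Qed.

(** The cell at [(t0, b)] is definable over [A] and [b]. Freeing [b], and keeping only the
    parameters at which the same [N] and [m] witness thinness, gives an [A]-definable cell that is
    good in every fibre. *)
Lemma cells_one (T : dtype) A (X : dprod dM T -> dG -> Prop) e : small (A0 `|` A) -> (0 < e)%N ->
  dset A (fun q : dprod (dprod dM T) dG => X q.1 q.2) ->
  exists s : seq (set (dprod dM T)), [/\ forall D, D \in s -> dset A D,
    forall p, exists2 D, D \in s & D p &
    forall D, D \in s -> forall b, thin e (cross (fun t x => X (t, b) x) (fun t => D (t, b)))].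
Proof.
move=> sA e0 dX.
have [||s [sF scov]] := @dcover _ _ _ _ S_sat (dprod dM T) A [set D | dset A D /\
    forall b, thin e (cross (fun t x => X (t, b) x) (fun t => D (t, b)))] sA.
- by move=> D [].
- move=> [t0 b].
  pose B := A `|` range (denc b 0).
  have sB : small (A0 `|` B) by exact: small_par.
  have dXB : dset B (fun q : dprod (dprod dM T) dG => X q.1 q.2) by apply: dset_mono dX => x; left.
  have db : dset B (fun x : T => x = b) by exact: dpt_addpar.
  have dXb : dset B (fun q : dprod dM dG => (fun t => X (t, b)) q.1 q.2).
    apply: (dset_comp2 (R := X) dXB (f := fun q : dprod dM dG => (q.1, b) : dprod dM T)
      (g := fun q => q.2)); by dfun_tac.
  have [D1 [dD1 D1t /(thinP _ e0)[N [m [emN tN]]]]] := @cell_point B (fun t => X (t, b)) e t0 sB e0 dXb.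
  have [R [dR RE]] := dset_unfiber A00 dD1.
  pose W (b' : T) := thinNm N m (cross (fun t x => X (t, b') x) (R b')).
  have dW : dset A W.
    apply: dset_thinNm.
    apply: (@dset_cross dM T A (fun b' t => X (t, b')) R) => //.
    apply: (dset_comp2 (R := X) dX (f := fun q : dprod (dprod T dM) dG => (q.1.2, q.1.1) : dprod dM T)
      (g := fun q => q.2)); by dfun_tac.
  have Wb : W b.
    have [z zP] := tN; exists z => x ax; apply: (zP x).
    have -> : D1 = R b by apply/funext => t; apply/propext; exact: RE.
    exact: ax.
  exists (fun p => R p.2 p.1 /\ W p.2); last by split=> //; apply/RE.
  split.
    apply: dset_and; last by dset_tac.
    by apply: (dset_comp2 dR (f := fun p : dprod dM T => p.2) (g := fun p => p.1)); dfun_tac.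
  move=> b'; case: (pselect (W b')) => Wb'.
    apply: (@thinS _ e _ (cross (fun t x => X (t, b') x) (R b'))).
      by apply: crossS => t [].
    by apply/(thinP _ e0); exists N, m.
  by apply: thin_empty => x; apply; left => t [].
exists s; split=> //; first by move=> D /sF[].
by move=> D /sF[].
Qed.

(** Over a cell [D] of the first coordinate, the union [U] and the intersection [V] of the family
    along fibres are families in fewer coordinates. Where both are almost constant, one reference
    fibre over [b0] decides: outside three thin sets, membership is constant on the whole cell. *)
Lemma cells_pow k A (X : dpow dM k -> dG -> Prop) e : small (A0 `|` A) -> (0 < e)%N ->
  dset A (fun q : dprod (dpow dM k) dG => X q.1 q.2) ->
  exists s : seq (set (dpow dM k)), [/\ forall D, D \in s -> dset A D,
    forall p, exists2 D, D \in s & D p & forall D, D \in s -> thin e (cross X D)].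
Proof.
move=> sA; elim: k X e => [|k IH] X e e0 dX.
  exists [:: setT]; split.
  - by move=> D; rewrite mem_seq1 => /eqP->; exact: dset_true.
  - by move=> p; exists setT; rewrite ?mem_head.
  - move=> D; rewrite mem_seq1 => /eqP->; apply: thin_empty => x; apply.
    by case: (pselect (X tt x)) => h; [left|right] => -[].
(* The exceptional set of a cell is a union of three sets, two of order [4 * e] and one of order
   [2 * e]. *)
pose T := dpow dM k; have e40 : (0 < 2 * (2 * e))%N by rewrite !muln_gt0.
have [s1 [s1d s1c s1t]] := @cells_one T A X _ sA e40 dX.
suff [s [sd st sc]] : exists s : seq (set (dprod dM T)), [/\ forall D, D \in s -> dset A D,
    forall D, D \in s -> thin e (cross X D) &
    forall D1, D1 \in s1 -> forall p, D1 p -> exists2 D, D \in s & D p].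
  exists s; split=> // p; have [D1 D1s D1p] := s1c p; exact: sc D1p.
elim: s1 s1d s1t {s1c} => [|D s1 IHs] s1d s1t; first by exists [::]; split.
have [||s [sd st sc]] := IHs.
- by move=> D' D's; apply: s1d; rewrite inE D's orbT.
- by move=> D' D's; apply: s1t; rewrite inE D's orbT.
have dD := s1d D (mem_head _ _); have tD := s1t D (mem_head _ _).
pose U (b : T) (x : dG) := exists t : dM, D (t, b) /\ X (t, b) x.
pose V (b : T) (x : dG) := forall t : dM, D (t, b) -> X (t, b) x.
have e20 : (0 < 2 * e)%N by rewrite muln_gt0.
have dDs : dset A (fun q : dprod (dprod T dG) dM => D (q.2, q.1.1)).
  by apply: (dset_comp dD (f := fun q : dprod (dprod T dG) dM => (q.2, q.1.1) : dprod dM T)); dfun_tac.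
have dXs : dset A (fun q : dprod (dprod T dG) dM => X (q.2, q.1.1) q.1.2).
  by apply: (dset_comp2 (R := X) dX (f := fun q : dprod (dprod T dG) dM => (q.2, q.1.1) : dprod dM T)
    (g := fun q => q.1.2)); dfun_tac.
have [|sU [sUd sUc sUt]] := IH U _ e40.
  by apply: (dset_ex (U := dM)); exact: dset_and.
have [|sV [sVd sVc sVt]] := IH V _ e20.
  by apply: (dset_all (U := dM)); exact: dset_imp.
pose cell (E E' : set T) : set (dprod dM T) := [set p | D p /\ (E p.2 /\ E' p.2)].
exists ([seq cell E E' | E <- sU, E' <- sV] ++ s); split.
- move=> C; rewrite mem_cat => /orP[/allpairsP[[E E'] /= [Es E's ->]]|/sd//].
  apply: dset_and => //; apply: dset_and; first exact: (dset_cmap (cmap_snd0 _ _) (sUd E Es)).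
  exact: (dset_cmap (cmap_snd0 _ _) (sVd E' E's)).
- move=> C; rewrite mem_cat => /orP[/allpairsP[[E E'] /= [Es E's ->]]|/st//].
  case: (pselect (exists p, cell E E' p)) => [[[t0 b0] [/= D0 [E0 E'0]]]|nc]; last first.
    by apply: thin_empty => x; apply; left => p cp; case: nc; exists p.
  apply: thinS (thinU (thinU (sUt E Es) (tD b0)) (sVt E' E's)) => x nh.
  apply/not_notP => /not_orP[/not_orP[nU nD] nV].
  have {}nU : homog (U^~ x) E by apply/not_notP.
  have {}nV : homog (V^~ x) E' by apply/not_notP.
  have {}nD : homog (fun t => X (t, b0) x) (fun t => D (t, b0)) by apply/not_notP.
  apply: nh.
  case: nU => hU; last first.
    by right => -[t b] [/= Dt [Eb _]] Xt; apply: (hU b Eb); exists t.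
  case: nV => hV; first by left => -[t b] [/= Dt [_ E'b]]; exact: (hV b E'b).
  have [t1 [D1 X1]] := hU b0 E0.
  case: nD => hD; last by case: (hD t1 D1).
  by case: (hV b0 E'0) => t Dt; exact: hD.
- move=> D1; rewrite inE => /orP[/eqP->|D1s] [t b] Dp; last first.
    by have [C Cs Cp] := sc D1 D1s (t, b) Dp; exists C => //; rewrite mem_cat Cs orbT.
  have [E Es Eb] := sUc b; have [E' E's E'b] := sVc b.
  exists (cell E E'); last by [].
  by rewrite mem_cat; apply/orP; left; apply/allpairsP; exists (E, E').
Qed.

Lemma cells (T : dtype) A (X : T -> dG -> Prop) e : small (A0 `|` A) -> (0 < e)%N ->
  dset A (fun q : dprod T dG => X q.1 q.2) ->
  exists s : seq (set T), [/\ forall D, D \in s -> dset A D,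
    forall p, exists2 D, D \in s & D p & forall D, D \in s -> thin e (cross X D)].
Proof.
move=> sA e0 dX; pose em : T -> dpow dM (ddim T) := @emb _ _ _ _ T.
have dem : dfun A em by exact/dfun_cmap/cmap_emb.
have [|s [sd sc st]] := @cells_pow (ddim T) A (fun c x => exists t : T, c = em t /\ X t x) e sA e0.
  by dset_tac.
exists [seq [set t | D (em t)] | D <- s]; split.
- by move=> _ /mapP[D /sd dD ->]; apply: (dset_comp dD dem).
- by move=> p; have [D Ds Dp] := sc (em p); exists [set t | D (em t)] => //; exact: map_f.
- move=> _ /mapP[D Ds ->]; apply: thinS (st D Ds) => x nh [h|h]; apply: nh; [left|right] => t Dt.
    by have [t' [/emb_inj -> ]] := h (em t) Dt.
  by move=> Xt; apply: (h (em t) Dt); exists t.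
Qed.

(** Summing the counts of the combined list along either factor gives contradictory bounds. *)
Lemma gen_not_thin K X : gen K X -> ~ thin K X.
Proof.
move=> [z zP] [gs gs0 gsP]; have [ks sks ksP] := seq_atleast z.
have one x : (1 <= cnt X ks x)%N by apply/ksP/exp_atleast/zP.
have ks0 : (0 < size ks)%N by have := one 0; rewrite /cnt; case: (ks).
have h1 : (K * cnt X (addl ks gs) 0 < size ks * size gs)%N.
  by rewrite cnt_addl; apply: sum_ltc => // k; exact: gsP.
have h2 : (size gs * K <= K * cnt X (addl ks gs) 0)%N.
  rewrite cnt_addlC; apply: sum_gec => g; rewrite -{1}(muln1 K) leq_mul2l one orbT //.
by move: h1; rewrite sks ltnNge [(K * size gs)%N]mulnC h2.
Qed.

Lemma dfun_subG (T : dtype) A (f g : T -> dG) : dfun A f -> dfun A g ->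
  dfun A (fun t => f t - g t : dG).
Proof.
move=> df dg; apply: (dfun_addG df).
apply: (dfun_comp (g := fun x : dG => - x : dG) _ dg).
have d0 := dpt_G0 A.
have : dset A (fun p : dprod dG dG => p.1 + p.2 = 0 :> dG).
  by apply: dset_eq; [addG_tac|exact: dfun_cst].
apply: dset_ext => -[x y] /=; split=> [/eqP|->]; last by rewrite subrr.
by rewrite addrC addr_eq0 => /eqP.
Qed.

(** * Translates and stabilizers *)

Definition diffs (P : set G) : set G := [set h | exists p q, [/\ P p, P q & h = p - q]].

Lemma diffsS (P P' : set G) : P `<=` P' -> diffs P `<=` diffs P'.
Proof. by move=> PP h [p [q [Pp Pq hE]]]; exists p, q; split=> //; exact: PP. Qed.

(** Let [g = x + p - q]. The first partition makes [X + k] almost independent of [k] in [D]; the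
    second makes [Y h], the union of the [X + k] moved back by [h], almost independent of [h] in
    [E]. For a fixed [h0] in both, [Y q g] gives [Y h0 g], so [g + h0] is in some [X + k], hence in
    [X + h0], and [g] is in [X]. *)
Lemma translate_pieces A (X : dG -> Prop) e : small (A0 `|` A) -> (0 < e)%N -> dset A X ->
  exists s : seq (set G), [/\ forall P, P \in s -> dset A (P : dG -> Prop),
    forall p, exists2 P, P \in s & P p &
    forall P, P \in s -> thin e [set g | (exists2 x, X x & diffs P (g - x)) /\ ~ X g]].
Proof.
move=> sA e0 dX; have e20 : (0 < 2 * e)%N by rewrite muln_gt0.
have dX1 : dset A (fun q : dprod dG dG => (fun g x => X (x - g)) q.1 q.2).
  apply: (dset_comp dX (f := fun q : dprod dG dG => (q.2 - q.1 : dG))).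
  by apply: (dfun_subG (f := fun q : dprod dG dG => q.2) (g := fun q => q.1)); dfun_tac.
have [s1 [s1d s1c s1t]] := @cells dG A (fun g x => X (x - g)) _ sA e20 dX1.
suff [s [sd st sc]] : exists s : seq (set G), [/\ forall P, P \in s -> dset A (P : dG -> Prop),
    forall P, P \in s -> thin e [set g | (exists2 x, X x & diffs P (g - x)) /\ ~ X g] &
    forall D, D \in s1 -> forall p, D p -> exists2 P, P \in s & P p].
  exists s; split=> // p; have [D Ds Dp] := s1c p; exact: sc Dp.
elim: s1 s1d s1t {s1c} => [|D s1 IHs] s1d s1t; first by exists [::]; split.
have [||s [sd st sc]] := IHs.
- by move=> D' D's; apply: s1d; rewrite inE D's orbT.
- by move=> D' D's; apply: s1t; rewrite inE D's orbT.
have dD := s1d D (mem_head _ _); have tD := s1t D (mem_head _ _).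
pose Y (h x : dG) := exists g : dG, D g /\ X (x + h - g).
have dY : dset A (fun q : dprod dG dG => Y q.1 q.2).
  apply: (dset_ex (U := dG)); apply: dset_and; first exact: (dset_cmap (cmap_snd0 _ _) dD).
  apply: (dset_comp dX (f := fun q : dprod (dprod dG dG) dG => (q.1.2 + q.1.1 - q.2 : dG))).
  apply: (dfun_subG (f := fun q : dprod (dprod dG dG) dG => (q.1.2 + q.1.1 : dG)) (g := fun q => q.2)).
    by addG_tac.
  by dfun_tac.
have [s2 [s2d s2c s2t]] := @cells dG A Y _ sA e20 dY.
exists ([seq D `&` E | E <- s2] ++ s); split.
- move=> P; rewrite mem_cat => /orP[/mapP[E Es ->]|/sd//]; exact: dset_and (s2d E Es).
- move=> P; rewrite mem_cat => /orP[/mapP[E Es ->]|/st//].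
  case: (pselect (exists h, (D `&` E) h)) => [[h0 [Dh0 Eh0]]|nh]; last first.
    by apply: thin_empty => g [[x _ [p [q [Pp]]]]]; case: nh; exists p.
  apply: thinS (thinU (s2t E Es) (thin_trans h0 tD)) => g [[x Xx [p [q [[Dp _] [_ Eq] gE]]]] nXg].
  apply/not_notP => /not_orP[nE nD].
  have {}nE : homog (Y^~ g) E by apply/not_notP.
  have {}nD : homog (fun k => X (g + h0 - k)) D by apply/not_notP.
  have Yq : Y q g.
    exists p; split=> //; have -> // : g + q - p = x.
    have -> : g = x + (p - q) by rewrite -gE addrC subrK.
    by rewrite -(addrA x) subrK addrK.
  have [k [Dk Xk]] : Y h0 g by case: nE => h; [exact: h|case: (h q Eq)].
  case: nD => h; last by case: (h k Dk).
  by apply: nXg; have := h h0 Dh0; rewrite addrK.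
- move=> D1; rewrite inE => /orP[/eqP->|D1s] p Dp; last first.
    by have [C Cs Cp] := sc D1 D1s p Dp; exists C => //; rewrite mem_cat Cs orbT.
  have [E Es Ep] := s2c p; exists (D `&` E); last by [].
  by rewrite mem_cat (map_f (fun E => D `&` E) Es).
Qed.

(** The finitely many intersections of pieces for [X] and for its complement cover the group, which
    is not thin, so one of them is not thin. *)
Lemma good_piece A (X : dG -> Prop) e : small (A0 `|` A) -> (0 < e)%N -> dset A X ->
  exists P : set G, [/\ dset A (P : dG -> Prop), exists2 e1, (0 < e1)%N & ~ thin e1 P &
    thin e [set g | (exists2 x, X x & diffs P (g - x)) /\ (exists2 y, ~ X y & diffs P (g - y))]].
Proof.
move=> sA e0 dX; have e20 : (0 < 2 * e)%N by rewrite muln_gt0.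
have [s1 [s1d s1c s1t]] := translate_pieces sA e20 dX.
have [s2 [s2d s2c s2t]] := translate_pieces sA e20 (dset_not dX).
pose s := [seq P `&` Q | P <- s1, Q <- s2].
have [P Ps [e1 ne1]] : exists2 P, P \in s & exists e1, ~ thin e1 P.
  apply/not_notP => n1; apply: (@not_thinT G 1) => //.
  apply: thinS (@thin_cover G s _ 1) => [x _|P Ps e1].
    have [P Ps Px] := s1c x; have [Q Qs Qx] := s2c x.
    by exists (P `&` Q) => //; apply/allpairsP; exists (P, Q).
  by apply/not_notP => nt; apply: n1; exists P => //; exists e1.
have /allpairsP[[P1 P2] /= [P1s P2s PE]] := Ps.
exists P; split.
- by rewrite PE; apply: dset_and; [exact: s1d|exact: s2d].
- exists e1 => //; case: e1 ne1 => // nt; case: nt.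
  by exists [:: 0] => // x; rewrite mul0n.
- apply: thinS (thinU (s1t P1 P1s) (s2t P2 P2s)) => g [[x Xx Px] [y nXy Py]].
  case: (pselect (X g)) => Xg; [right|left]; split=> //.
  + by exists y => //; apply: diffsS Py; rewrite PE => z [].
  + by exists x => //; apply: diffsS Px; rewrite PE => z [].
Qed.

(** Thinness of the symmetric difference [sd g] of [P] and its translate is an infinite disjunction,
    not a definable condition on [g]; non-genericity of the closure for a fixed number of translates
    is definable, and implies thinness by the dichotomy. The orders [ee m] are chosen so that each
    set controls the differences of the next. *)
Lemma stabilizer A (P : dG -> Prop) e1 : small (A0 `|` A) -> (0 < e1)%N -> dset A P ->
  ~ thin e1 P ->
  exists B : nat -> dG -> Prop, [/\ forall m, dset A (B m), forall m, B m 0,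
    forall m g g', B m.+1 g -> B m.+1 g' -> B m (g - g'), forall g, B 0%N g -> diffs P g &
    exists s : nat -> seq (set G), forall m, (forall g, exists2 D, D \in s m & D g) /\
      forall D, D \in s m -> forall g g', D g -> D g' -> B m (g - g')].
Proof.
move=> sA e10 dP nP.
pose sd (g x : dG) := (P x /\ ~ P (x - g)) \/ (~ P x /\ P (x - g)).
have dP1 : dset A (fun q : dprod dG dG => (fun g x => P (x - g)) q.1 q.2).
  apply: (dset_comp dP (f := fun q : dprod dG dG => (q.2 - q.1 : dG))).
  by apply: (dfun_subG (f := fun q : dprod dG dG => q.2) (g := fun q => q.1)); dfun_tac.
have dP2 : dset A (fun q : dprod dG dG => P q.2) by exact: (dset_cmap (cmap_snd0 _ _) dP).
have dsd : dset A (fun q : dprod dG dG => sd q.1 q.2).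
  by apply: dset_or; apply: dset_and => //; exact: dset_not.
have exK e : exists K, (0 < e)%N -> forall g, thin e (sd g) \/ gen K (closure (sd g)).
  case: (posnP e) => [->|e0]; first by exists 0%N.
  by have [K KP] := generic_dichotomy sA e0 dsd; exists K.
have [kap kapP] := choice exK.
(* The factors 2 pay for the union of two symmetric differences and for the boundary added by the
   closure. The initial value [e1] puts [B 0] inside the differences of [P]. *)
pose ee := fix ee m := if m is m'.+1 then (2 * (2 * (kap (ee m')).+1))%N else e1.
have ee0 m : (0 < ee m)%N by case: m => //= m; rewrite !muln_gt0.
pose B m g := ~ gen (kap (ee m)) (closure (sd g)).
have Bthin m g : B m g -> thin (ee m) (sd g).
  by move=> nB; case: (kapP (ee m) (ee0 m) g).
have dall_sd g : dall (sd g) by exact: dall_sec dsd.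
have thinB m g : thin (2 * (kap (ee m)).+1) (sd g) -> B m g.
  move=> t1 g1; apply: (gen_not_thin g1); apply: (@thin_le _ _ (kap (ee m)).+1) => //.
  apply: thinS (thinU t1 (bd_thin _ (dall_sd g))); last by rewrite muln_gt0.
  move=> x cx; case: (pselect (sd g x)) => sx; [by left|right; split=> //].
  exact: subset_closure.
exists B; split.
- by move=> m; apply: dset_not; exact: dset_gen (clos dsd).
- move=> m; apply: thinB; apply: thin_empty => x; rewrite /sd subr0.
  by case=> -[].
- move=> m g g' /Bthin t1 /Bthin t2; apply: thinB.
  apply: thinS (thinU t1 (thin_trans (g' - g) t2)) => x; rewrite /sd /=.
  have -> : x + (g' - g) - g' = x - g by rewrite [g' - g]addrC addrA addrK.
  have -> : x - (g - g') = x + (g' - g) by rewrite opprB.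
  case: (pselect (P (x - g))) => h1; case: (pselect (P (x + (g' - g)))) => h2; tauto.
(* If [P] and its translate were disjoint, [P] would be part of a thin symmetric difference. *)
- move=> g /Bthin t1; apply/not_notP => nd; apply: nP; apply: thinS t1 => x Px.
  left; split=> // Pxg; apply: nd; exists x, (x - g); split=> //.
  by rewrite opprB addrC subrK.
(* The translates of [P] are almost constant on each of finitely many cells, so the differences of a
   cell lie in [B m]; this will bound the index. *)
- have exs m : exists s : seq (set G), (forall g, exists2 D, D \in s & D g) /\
      forall D, D \in s -> forall g g', D g -> D g' -> B m (g - g').
    have k0 : (0 < 2 * (kap (ee m)).+1)%N by rewrite muln_gt0.
    have [s [_ sc st]] := @cells dG A (fun g x => P (x - g)) _ sA k0 dP1.
    exists s; split=> // D Ds g g' Dg Dg'; apply: thinB.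
    apply: thinS (thin_trans g' (st D Ds)) => x; rewrite /sd /= => h hh.
    rewrite (_ : x - (g - g') = x + g' - g) in h; last by rewrite opprB addrA.
    by case: hh => hh; have := hh g Dg; have := hh g' Dg'; rewrite /= addrK; tauto.
  have [s sP] := choice exs; by exists s.
Qed.

End Generic.

(** * Compact domination *)

Section CountableIntersection.
Variables (G : zmodType) (B : nat -> G -> Prop).
Hypotheses (B0 : forall m, B m 0).
Hypothesis BS : forall m g g', B m.+1 g -> B m.+1 g' -> B m (g - g').

Definition cap_pred : {pred G} := fun g => `[< forall m, B m g >].

Lemma cap_closed : zmod_closed cap_pred.
Proof.
split; first by rewrite unfold_in; apply/asboolP.
move=> g g'; rewrite !unfold_in => /asboolP h /asboolP h'.
by apply/asboolP => m; exact: BS.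
Qed.

Definition cap_sub : zmodClosed G :=
  HB.pack_for (zmodClosed G) cap_pred (GRing.isZmodClosed.Build G cap_pred cap_closed).

Lemma cap_subP g : reflect (forall m, B m g) (g \in cap_sub).
Proof. exact: asboolP. Qed.

End CountableIntersection.

(** A coset is determined by the pieces, one for each [m], that contain a representative; the
    sequence of their indices is coded by a set of natural numbers. *)
Lemma quot_card_le (G : zmodType) (H : zmodClosed G) (s : nat -> seq (set G)) :
  (forall m g, exists2 D, D \in s m & D g) ->
  (forall g g', (forall m, exists2 D, D \in s m & D g /\ D g') -> g - g' \in H) ->
  [set: quot H] #<= [set: set nat].
Proof.
move=> cov sep.
pose idx m g := find (fun D : set G => `[< D g >]) (s m).
have hasD m g : has (fun D : set G => `[< D g >]) (s m).
  by have [D Ds Dg] := cov m g; apply/hasP; exists D => //; apply/asboolP.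
have idxP m g : nth set0 (s m) (idx m g) \in s m /\ nth set0 (s m) (idx m g) g.
  split; first by apply: mem_nth; rewrite -has_find.
  by have /asboolP := nth_find set0 (hasD m g).
pose c (g : G) : set nat := [set x | exists m, x = choice.pickle (m, idx m g)].
have cI g g' : c g = c g' -> g - g' \in H.
  move=> E; apply: sep => m; have [h1 h2] := idxP m g.
  have : c g (choice.pickle (m, idx m g)) by exists m.
  rewrite E => -[m' /(pcan_inj choice.pickleK)[mm' ii']].
  exists (nth set0 (s m) (idx m g)) => //; split=> //.
  by rewrite ii' -mm'; case: (idxP m g').
pose f (Z : set nat) : quot H := xget 0 [set q | c (repr q) = Z].
apply: card_le_trans (card_image_le f [set: set nat]); apply: subset_card_le => q _.
exists (c (repr q)) => //.
have : c (repr (f (c (repr q)))) = c (repr q).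
  exact: (@xgetPex _ 0 [set q' | c (repr q') = c (repr q)] (ex_intro _ q erefl)).
move=> /cI h; rewrite -[RHS]reprK -[LHS]reprK; apply/eqP.
by rewrite -Quotient.idealrBE.
Qed.

Lemma probability_cover_le (d : measure_display) (T : measurableType d) (R : realType)
    (P : probability T R) (I : Type) (Y : I -> set T) (s : seq I) e : (0 < e)%N ->
  (forall i, measurable (Y i)) ->
  (forall x, (e * count (fun i => `[< Y i x >]) s <= size s)%N) ->
  (\sum_(i <- s) P (Y i) <= ((size s)%:R / e%:R)%:E)%E.
Proof.
move=> e0 mY H.
have mI i : measurable_fun [set: T] (\1_(Y i) : T -> R) by exact: measurable_indic.
have mE i : measurable_fun [set: T] (fun x => (\1_(Y i) x : R)%:E).
  exact/measurable_EFinP.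
have -> : (\sum_(i <- s) P (Y i) = \int[P]_x \sum_(i <- s) (\1_(Y i) x)%:E)%E.
  rewrite ge0_integral_sum //.
  by apply: eq_bigr => i _; rewrite integral_indic // setIT.
have -> : (((size s)%:R / e%:R)%:E = \int[P]_x (cst ((size s)%:R / e%:R)%:E) x)%E.
  by rewrite integral_cst //= probability_setT mule1.
apply: ge0_le_integral => //.
- by move=> x _; apply: sume_ge0 => i _; rewrite lee_fin.
- exact: emeasurable_sum.
- move=> x _; rewrite sumEFin lee_fin /=.
  have -> : \sum_(i <- s) \1_(Y i) x = (count (fun i => `[< Y i x >]) s)%:R :> R.
    rewrite -sum1_count natr_sum [RHS]big_mkcond /=; apply: eq_bigr => i _.
    by rewrite indicE; case: asboolP => h; [rewrite mem_set|rewrite memNset].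
  by rewrite ler_pdivlMr ?ltr0n // -natrM ler_nat mulnC.
Qed.

Lemma definable_finite_par (L : language) (M : rcfType) (S : expansion L M) m
    (D : set 'rV[M]_m) : definable S D -> exists B, finite_set B /\ definable_over S B D.
Proof.
move=> [k [p [phi [_ ->]]]]; exists (range (p 0)).
split; first exact: finite_range_row.
by exists k, p, phi; split=> // i; exists i.
Qed.

Lemma small_finite (M : rcfType) (B : set M) : finite_set B -> small B.
Proof.
move=> fB; rewrite -[B]set0U; apply: small_setU_finite => //; split.
  by apply: subset_card_le => x [].
rewrite card_le0 => /eqP E.
by have : [set: M] 0 by []; rewrite E.
Qed.

Section CompactDomination.
Variables (L : language) (M : rcfType) (S : expansion L M).
Hypotheses (S_omin : o_minimal S) (S_sat : saturated S).
Hypothesis M_large : card_lt [set: set nat] [set: M].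
Variables (G : topologicalZmodType) (n : nat) (code : G -> 'rV[M]_n).
Hypotheses (G_def : definable_group S code) (G_top : definable_group_topology S code).
Hypothesis G_comp : definably_compact S code.
Variable N : zmodClosed G.
Hypothesis NP : is_G00 S code N.

(** The intersection [H] of the sets [B m] is a type-definable subgroup of index at most the
    continuum, hence bounded, so [N] lies in the differences of [P]. A point of a split coset is
    then reached by such differences both from [X] and from its complement, and these points form a
    thin set. *)
Lemma thin_split_cosets (X : set G) e : (0 < e)%N -> definable S (code @` X) ->
  thin e (\pi_(quot N)%qT @^-1` split_cosets N X).
Proof.
move=> e0 defX; have [code_inj ran_def add_def] := G_def.
have [d [k [U [f [Ucov chP]]]]] := G_top.
have [B1 [f1 d1]] := definable_finite_par ran_def.
have [B2 [f2 d2]] := definable_finite_par add_def.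
have [B3 [f3 d3]] := definable_finite_par defX.
have exc i : exists Bi, finite_set Bi /\ definable_over S Bi [set row_mx (code x) (f i x) | x in U i].
  by apply: definable_finite_par; case: (chP i).
have [Bc BcP] := choice exc.
(* Finitely many parameters define the group, its law, the charts and [X]; [0] serves as the default
   value of [dset_unfiber]. *)
pose A0 := [set 0] `|` (B1 `|` (B2 `|` (B3 `|` \bigcup_i Bc i))).
have A00 : A0 0 by left.
have sA0 : small A0.
  apply: small_finite; rewrite !finite_setU; do !split=> //.
  by apply: bigcup_finite => [|i _]; [exact: finite_finset|case: (BcP i)].
have code_ran : definable_over S A0 (range code).
  by apply: definable_overS d1 => x h; right; left.
have fdef i : definable_over S A0 [set row_mx (code x) (f i x) | x in U i].
  by apply: definable_overS (BcP i).2 => x h; right; right; right; right; exists i.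
have Uopen i : open (U i) by case: (chP i).
have finj i : {in U i &, injective (f i)} by case: (chP i).
have fopen i W : W `<=` U i -> (open W <-> open (f i @` W)) by case: (chP i) => _ _ _; exact.
pose D := dG code_inj code_ran.
have dadd0 : dset set0 (fun p : dprod (dprod D D) D => p.2 = p.1.1 + p.1.2 :> G).
  have := definable_overS (_ : B2 `<=` A0 `|` set0) d2 => H.
  rewrite /dset; have -> : [set denc x | x in [set t : dprod (dprod D D) D | t.2 = t.1.1 + t.1.2 :> G]] =
      [set z | exists x y : G, z = row_mx (row_mx (code x) (code y)) (code (x + y))].
    apply/seteqP; split=> z /=; first by move=> [[[x y] w] /= -> <-]; exists x, y.
    by move=> [x [y ->]]; exists ((x, y), x + y).
  by apply: H => x h; left; right; right; left.
have clos (T : dtype S A0) A (Z : T -> D -> Prop) : dset A (fun q : dprod T D => Z q.1 q.2) ->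
    dset A (fun q : dprod T D => closure (Z q.1) q.2).
  exact: (dset_closure Ucov Uopen fdef finj fopen).
have clim (s : dM S A0 -> D) : dfun [set: M] s -> exists g : G, s x @[x --> 0^'+] --> g.
  exact: (curve_limit S_omin S_sat sA0 Ucov Uopen fdef finj fopen G_comp).
have gbx := @group_box _ _ _ _ S_omin S_sat sA0 _ _ _ code_inj code_ran _ _ _ _
  Ucov Uopen fdef finj fopen.
have sA : small (A0 `|` set0) by rewrite setU0.
have dX : dset set0 (X : D -> Prop).
  rewrite /dset; have -> : [set t : D | X t] = X by [].
  by apply: definable_overS d3 => x h; left; right; right; right; left.
have [P [dP [e1 e10 nP] tP]] :=
  good_piece S_omin S_sat A00 sA0 dadd0 clos clim gbx sA e0 dX.
have [B [dB B0 BS Bd [s sP]]] :=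
  stabilizer S_omin S_sat A00 sA0 dadd0 clos clim gbx sA e10 dP nP.
pose H := cap_sub B0 BS.
have HB g : g \in H -> diffs P g by move=> /(elimT (cap_subP B0 BS g))/(_ 0%N)/Bd.
have bdH : bounded_type_definable S code H.
  split.
    exists (A0 `|` set0), [set E | exists m, E = code @` [set g | B m g]]; split=> //.
      by move=> E [m ->]; exact: dB.
    apply/seteqP; split=> z.
      by move=> [g Hg <-] _ [m ->]; exists g => //; exact: (elimT (cap_subP B0 BS g) Hg m).
    move=> Hz; have [g _ gz] : (code @` [set g | B 0%N g]) z by apply: Hz; exists 0%N.
    exists g => //; apply: (introT (cap_subP B0 BS g)) => m.
    have [g' Bg' g'z] : (code @` [set g | B m g]) z by apply: Hz; exists m.
    by have <- : g' = g by exact: (code_inj _ _ (etrans g'z (esym gz))).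
  have cH : [set: quot H] #<= [set: set nat].
    apply: (@quot_card_le _ H s) => [m g|g g' h]; first by case: (sP m).
    apply: (introT (cap_subP B0 BS _)) => m; have [E Es [Eg Eg']] := h m; exact: (sP m).2 Eg Eg'.
  split; first exact: card_le_trans cH M_large.1.
  by move=> MH; apply: M_large.2; exact: card_le_trans MH cH.
have NH : forall g, g \in N -> diffs P g by move=> g gN; apply: HB; exact: (NP.2 H bdH g gN).
apply: thinS tP; rewrite split_cosetsE => g [[x Xx gx] [y Xy gy]].
by split; [exists x|exists y] => //; exact: NH.
Qed.

End CompactDomination.

Theorem theorem8p1 (L : language) (M : rcfType) (S : expansion L M)
    (S_omin : o_minimal S) (S_sat : saturated S)
    (M_large : card_lt [set: set nat] [set: M])
    (G : topologicalZmodType) (n : nat) (code : G -> 'rV[M]_n)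
    (G_def : definable_group S code)
    (G_top : definable_group_topology S code)
    (G_conn : definably_connected S code)
    (G_comp : definably_compact S code)
    (G00 : zmodClosed G) (G00P : is_G00 S code G00)
    (R : realType)
    (mu : probability (g_sigma_algebraType (logic_closed S code G00)) R)
    (mu_haar : is_haar mu) :
  forall X : set G, definable S (code @` X) ->
    (logic_closed S code G00).-sigma.-measurable (split_cosets G00 X) /\
    mu (split_cosets G00 X) = 0%E.
Proof.
move=> X defX; have [[tdN _] _] := G00P.
pose pi (g : G) : quot G00 := \pi_(quot G00)%qT g.
have lc (Z : set G) : definable S (code @` Z) -> logic_closed S code G00 (split_cosets G00 Z).
  exact: logic_closed_split_cosets.
have mS (Z : set G) : definable S (code @` Z) ->
    (logic_closed S code G00).-sigma.-measurable (split_cosets G00 Z).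
  by move=> /lc h; exact: sub_sigma_algebra.
split; first exact: mS.
have [code_inj ran_def add_def] := G_def.
(* Translates of the set of split cosets come from translates of [X]; they are therefore measurable
   and, by invariance, of equal measure. *)
have shiftE g : split_cosets G00 [set x | X (x + g)] =
    [set - pi g + b | b in split_cosets G00 X].
  have piD x y : pi (x + y) = pi x + pi y by rewrite /pi raddfD.
  apply/seteqP; split=> b /=.
    move=> [[x [/= xb Xx]] [y [/= yb Xy]]]; exists (b + pi g); last by rewrite addrC addrK.
    split; [exists (x + g)|exists (y + g)]; split=> //=; rewrite -/(pi _) piD.
      by congr (_ + _).
    by congr (_ + _).
  move=> [b' [[x [/= xb Xx]] [y [/= yb Xy]]] <-].
  have piB x' : pi (x' - g) = - pi g + pi x' by rewrite /pi raddfB addrC.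
  split; [exists (x - g)|exists (y - g)]; split=> /=; rewrite ?subrK //.
    by rewrite -/(pi _) piB; congr (_ + _).
  by rewrite -/(pi _) piB; congr (_ + _).
have defs g : definable S (code @` [set x | X (x + g)]).
  have [B2 [f2 d2]] := definable_finite_par add_def.
  have [B1 [f1 d1]] := definable_finite_par ran_def.
  have [B3 [f3 d3]] := definable_finite_par defX.
  pose D := dG (A0 := B1) code_inj d1.
  have dX : dset setT (X : D -> Prop) by apply: definable_overS d3 => x h; right.
  have dadd : dset setT (fun p : dprod (dprod D D) D => p.2 = p.1.1 + p.1.2 :> G).
    have H := definable_overS (@subsetT _ B2) d2.
    rewrite /dset setUT; have -> : [set denc x | x in [set t : dprod (dprod D D) D | t.2 = t.1.1 + t.1.2 :> G]] =
        [set z | exists x y : G, z = row_mx (row_mx (code x) (code y)) (code (x + y))].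
      apply/seteqP; split=> z /=; first by move=> [[[x y] w] /= -> <-]; exists x, y.
      by move=> [x [y ->]]; exists ((x, y), x + y).
    exact: H.
  have dsh : dset setT (fun x : D => X (x + g)).
    apply: (dset_comp dX (f := fun x : D => (x + g : D))).
    apply: (dfun_comp2 (h := fun x y : D => (x + y : D)) dadd); first by dfun_tac.
    by apply: dfun_cst; exact: dpt_all.
  by move: dsh; rewrite /dset setUT.
have mmu g : mu (split_cosets G00 [set x | X (x + g)]) = mu (split_cosets G00 X).
  by rewrite shiftE (mu_haar.1 (- pi g)) //; exact: mS.
pose m := fine (mu (split_cosets G00 X)).
have mfin : mu (split_cosets G00 X) = m%:E by rewrite fineK // fin_num_measure //; exact: mS.
have m0 : 0 <= m by rewrite /m fine_ge0.
(* The multiplicity of the translates at [pi x] is at most the count of the preimage at [x], so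
   thinness of every order bounds the measure. *)
have bound e : (0 < e)%N -> m * e%:R <= 1.
  move=> e0; have [gs gs0 gsP] := thin_split_cosets S_omin S_sat M_large G_def G_top G_comp G00P e0 defX.
  have := @probability_cover_le _ _ _ mu G (fun g => split_cosets G00 [set x | X (x + g)]) gs e e0.
  have mY g : measurable (split_cosets G00 [set x | X (x + g)] :
      set (g_sigma_algebraType (logic_closed S code G00))) by exact: mS.
  move=> /(_ mY) H.
  have {}H : (\sum_(i <- gs) m%:E <= ((size gs)%:R / e%:R)%:E)%E.
    rewrite (eq_bigr (fun g => mu (split_cosets G00 [set x | X (x + g)]))); last first.
      by move=> g _; rewrite mmu mfin.
    apply: H => q.
    have [x ->] : exists x, q = pi x by exists (repr q); rewrite /pi reprK.
    apply: leq_trans (ltnW (gsP x)); rewrite leq_mul2l; apply/orP; right.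
    apply: sub_count => g /asboolP; rewrite shiftE => -[b sb bE]; apply/asboolP => /=.
    have -> // : \pi_(quot G00)%qT (x + g) = b.
    transitivity (pi x + pi g); first by rewrite /pi raddfD.
    by rewrite -bE addrAC addNr add0r.
  rewrite sumEFin lee_fin big_const_seq count_predT iter_addr_0 in H.
  have s0 : 0 < (size gs)%:R :> R by rewrite ltr0n.
  have ep : 0 < e%:R :> R by rewrite ltr0n.
  rewrite ler_pdivlMr // -[m *+ _]mulr_natr in H.
  by rewrite -(ler_pM2r s0) mul1r mulrAC.
rewrite mfin; congr (_%:E); apply/eqP; rewrite eq_le m0 andbT leNgt; apply/negP => mp.
have := bound (Num.bound m^-1).+1 isT; rewrite leNgt => /negP; apply.
rewrite -ltr_pdivrMl // mulr1; apply: lt_trans (archi_boundP _) _; first by rewrite invr_ge0.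
by rewrite ltr_nat.
Qed.
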